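(* Let $\mathbf X_n\sim\mathcal U(\mathcal M_n^{\mathbb T})$, $\mathbf A_n=\psi^{(n)}(\mathbf X_n)$, and, for fixed $k$, let $\mathbf A_n^k$ denote the projection of $\mathbf A_n$ onto the first $k$ coordinates. Then $(\mathbf A_n^k)_n$ satisfies a large deviation principle (in $(\mathbb C^{p\times p})^k$) with speed $n$ and good rate function $$\mathcal I_{\mathbf A}(Z_1,\dots,Z_k)=\begin{cases}-2p\sum_{i=1}^k\log\det(I_p-Z_i^*Z_i),&\text{if }(Z_1,\dots,Z_k)\in(\mathrm{Int}\,\mathbb D_p)^k,\\ \infty,&\text{otherwise.}\end{cases}$$
   Context: Fix an integer $p\ge1$. Lebesgue measure on $\mathbb C^{p\times p}$ is $dX=\prod_{1\le i,j\le p}d\,\mathrm{Re}(x_{ij})\,d\,\mathrm{Im}(x_{ij})$. $\mathbb D_p=\{U\in\mathbb C^{p\times p}:UU^*\le I_p\}$ (Loewner order). Let $\mathcal P(\mathbb T)$ be the set of nonnegative-Hermitian-$p\times p$-matrix-valued measures $\mu$ on the unit circle $\mathbb T$ with $\mu(\mathbb T)=I_p$, $\Gamma_j(\mu)=\int_{-\pi}^{\pi}e^{ij\theta}d\mu(\theta)$, and $\mathcal M_n^{\mathbb T}=\{(\Gamma_1(\mu),\dots,\Gamma_n(\mu)):\mu\in\mathcal P(\mathbb T)\}\subset(\mathbb C^{p\times p})^n$, compact with nonempty interior. $\mathcal U(\mathcal M_n^{\mathbb T})$ is the uniform distribution on $\mathcal M_n^{\mathbb T}$ with respect to $d\Gamma_1\cdots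 d\Gamma_n$; almost surely $\mathbf X_n\in\mathrm{Int}\,\mathcal M_n^{\mathbb T}$. Canonical moments: for $(\Gamma_1,\dots,\Gamma_n)\in\mathrm{Int}\,\mathcal M_n^{\mathbb T}$ put $\Gamma_0=I_p$, $\Gamma_{-j}=\Gamma_j^*$, $T_m=(\Gamma_{j-i})_{i,j=0,\dots,m}$ (positive definite), and for $1\le m\le n$ $L_m=I_p-(\Gamma_1,\dots,\Gamma_m)T_{m-1}^{-1}(\Gamma_1,\dots,\Gamma_m)^*$, $R_m=I_p-(\Gamma_{-m},\dots,\Gamma_{-1})T_{m-1}^{-1}(\Gamma_{-m},\dots,\Gamma_{-1})^*$, $M_m=(\Gamma_1,\dots,\Gamma_m)T_{m-1}^{-1}(\Gamma_{-m},\dots,\Gamma_{-1})^*$. The canonical moments are $A_1=\Gamma_1$ and $A_j=L_{j-1}^{-1/2}(\Gamma_j-M_{j-1})R_{j-1}^{-1/2}$ for $2\le j\le n$. The map $\psi^{(n)}:(\Gamma_1,\dots,\Gamma_n)\mapsto(A_1,\dots,A_n)$ is a bijection from $\mathrm{Int}\,\mathcal M_n^{\mathbb T}$ onto $(\mathrm{Int}\,\mathbb D_p)^n$. A sequence of random variables with laws $Q_n$ on a Hausdorff space $U$ satisfies a large deviation principle with speed $n$ and rate function $I:U\to[0,\infty]$ if $I$ is lower semicontinuous and for every Borel $A$: $-\inf_{\mathrm{Int}A}I\le\liminf_n\frac1n\log Q_n(A)\le\limsup_n\frac1n\log Q_n(A)\le-\inf_{\overline A}I$; $I$ is good if its level sets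 $\{I\le x\}$ are compact. *)

(* Defs.v *)
From HB Require Import structures.
From mathcomp Require Import all_boot all_order all_algebra.
From mathcomp Require Import spectral.
From mathcomp Require Import all_classical all_reals all_analysis.
From mathcomp Require Import complex.

Set Implicit Arguments.
Unset Strict Implicit.
Unset Printing Implicit Defensive.

Import Order.TTheory GRing.Theory Num.Theory.
Import numFieldNormedType.Exports.

Local Open Scope classical_set_scope.
Local Open Scope ring_scope.
Local Open Scope complex_scope.
Local Open Scope sesquilinear_scope.

(* The modulus topology on R[i]. MathComp-Analysis only provides it for
   R[i]^o, since R[i] is not a variable of type numFieldType. Matrices then get
   the product topology, which on a finite-dimensional space is the usual one. *)
HB.instance Definition _ (R : realType) := NormedModule.copy R[i] R[i]^o.

Definition Borel (U : ptopologicalType) := g_sigma_algebraType (@open U).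

Section LargeDeviations.
Context {R : realType} {U : ptopologicalType}.
Implicit Types (Q : nat -> set U -> \bar R) (I : U -> \bar R).
Local Open Scope ereal_scope.

(* lne 0 = -oo, and the infimum over the empty set is +oo. *)
Definition satisfies_ldp Q I :=
  [/\ hausdorff_space U,
      forall u, 0 <= I u,
      lower_semicontinuous I &
      forall A : set (Borel U), measurable A ->
        let u n := n%:R^-1%:E * lne (Q n A) in
        [/\ - ereal_inf (I @` (A : set U)^°) <= limn_einf u,
            limn_einf u <= limn_esup u &
            limn_esup u <= - ereal_inf (I @` closure (A : set U))]].

Definition good_rate I := forall x : R, compact [set u | I u <= x%:E].

End LargeDeviations.

Section Matrices.
Context {R : realType}.

Definition psdmx p (A : 'M[R[i]]_p) :=
  A^t* = A /\ forall v : 'cV[R[i]]_p, 0 <= (v^t* *m A *m v) 0 0.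

Definition loewner_le p (A B : 'M[R[i]]_p) := psdmx (B - A).

(* The nonnegative Hermitian square root: for A nonnegative Hermitian the set
   below has exactly one element. *)
Definition sqrtmx p (A : 'M[R[i]]_p) : 'M[R[i]]_p :=
  xget 0 [set B | psdmx B /\ B *m B = A].

Definition Dball p : set 'M[R[i]]_p :=
  [set U | loewner_le (U *m U^t*) 1%:M].

End Matrices.

Arguments Dball {R} p.

Section MatrixMeasures.
Context {R : realType}.
Local Notation T := (measurableTypeR R).

(* Integral against a signed measure, through its Jordan decomposition; the
   value does not depend on the choice of the Hahn decomposition. *)
Definition charge_integral (nu : {charge set T -> \bar R}) (D : set T)
    (f : T -> R) : R :=
  let HP := cid (Hahn_decomposition nu) in
  let HN := cid (projT2 HP) in
  let nuPN := projT2 HN in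
  \int[jordan_pos nuPN]_(x in D) f x - \int[jordan_neg nuPN]_(x in D) f x.

(* A complex p x p matrix-valued measure, given by the real and imaginary parts
   of its entries. *)
Record matrix_charge p := MatrixCharge {
  mcRe : 'I_p -> 'I_p -> {charge set T -> \bar R} ;
  mcIm : 'I_p -> 'I_p -> {charge set T -> \bar R} }.

Definition mc_val p (mu : matrix_charge p) (E : set T) : 'M[R[i]]_p :=
  \matrix_(a, b) (fine (mcRe mu a b E) +i* fine (mcIm mu a b E)).

(* The unit circle is parametrized by the angle in ]-pi, pi]. *)
Definition angles : set T := `]- pi, pi].

Definition circle_measure p (mu : matrix_charge p) :=
  [/\ forall E, measurable E -> psdmx (mc_val mu E),
      mc_val mu (~` angles) = 0 &
      mc_val mu angles = 1%:M].

(* Entrywise (c + i s)(dmuRe + i dmuIm), with c + i s = exp(i j theta). *)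
Definition moment p (mu : matrix_charge p) (j : nat) : 'M[R[i]]_p :=
  let c (theta : T) := cos (j%:R * theta) in
  let s (theta : T) := sin (j%:R * theta) in
  \matrix_(a, b)
   ((charge_integral (mcRe mu a b) angles c
     - charge_integral (mcIm mu a b) angles s)
    +i* (charge_integral (mcIm mu a b) angles c
         + charge_integral (mcRe mu a b) angles s)).

(* Component j (counted from 0) is the moment of order j + 1. *)
Definition moment_space p n : set 'rV['M[R[i]]_p]_n :=
  [set G : 'rV['M[R[i]]_p]_n | exists2 mu, circle_measure mu &
                       forall j : 'I_n, G 0 j = @moment p mu j.+1].

End MatrixMeasures.

Arguments moment_space {R} p n.

Section Uniform.
Context {R : realType}.

(* m-dimensional Lebesgue measure, as an iterated integral. *)
Fixpoint lebesgue_tuple (m : nat) : set (m.-tuple R) -> \bar R :=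
  match m with
  | 0 => fun A => \d_([tuple] : 0.-tuple R) A
  | m'.+1 => fun A =>
      (\int[@lebesgue_measure R]_x
         lebesgue_tuple [set t : m'.-tuple R | A [tuple of x :: t]])%E
  end.

(* The real coordinates of a point of (C^(p x p))^n: which matrix, which entry,
   and real (false) or imaginary (true) part. *)
Definition coordinate n p : finType := ('I_n * 'I_p * 'I_p * bool)%type.

Definition of_coordinates n p (t : #|coordinate n p|.-tuple R) :
    'rV['M[R[i]]_p]_n :=
  let x (c : coordinate n p) := tnth t (enum_rank c) in
  \row_j \matrix_(a, b) (x (j, a, b, false) +i* x (j, a, b, true)).

Definition lebesgue_mx n p (A : set 'rV['M[R[i]]_p]_n) : \bar R :=
  lebesgue_tuple (@of_coordinates n p @^-1` A).

Definition uniform_on n p (K : set 'rV['M[R[i]]_p]_n)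
    (Q : set 'rV['M[R[i]]_p]_n -> \bar R) :=
  forall A : set (Borel 'rV['M[R[i]]_p]_n), measurable A ->
    (Q A = lebesgue_mx (A `&` K) / lebesgue_mx K)%E.

End Uniform.

Section CanonicalMoments.
Context {R : realType} {p n : nat}.
Variable G : 'rV['M[R[i]]_p]_n.

(* Gamma_j for every integer j (0 when |j| > n, which is never used). *)
Definition Gam (j : int) : 'M[R[i]]_p :=
  let g m := if insub m is Some i then G 0 i else 0 in
  match j with
  | Posz 0 => 1%:M
  | Posz m.+1 => g m
  | Negz m => (g m)^t*
  end.

(* m block rows and columns: this is T_(m-1). *)
Definition toeplitz m : 'M[R[i]]_(\sum_(i < m) p) :=
  \mxblock_(i < m, j < m) Gam (j%:Z - i%:Z).

(* (Gamma_1, ..., Gamma_m) and (Gamma_(-m), ..., Gamma_(-1)) *)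
Definition row_pos m : 'M[R[i]]_(p, \sum_(i < m) p) :=
  \mxrow_(j < m) Gam (j.+1%:Z).
Definition row_neg m : 'M[R[i]]_(p, \sum_(i < m) p) :=
  \mxrow_(j < m) Gam (j%:Z - m%:Z).

Definition Lmx m := 1%:M - row_pos m *m invmx (toeplitz m) *m (row_pos m)^t*.
Definition Rmx m := 1%:M - row_neg m *m invmx (toeplitz m) *m (row_neg m)^t*.
Definition Mmx m := row_pos m *m invmx (toeplitz m) *m (row_neg m)^t*.

(* A_j, for 1 <= j *)
Definition canonical_moment (j : nat) : 'M[R[i]]_p :=
  if j == 1%N then Gam 1
  else sqrtmx (invmx (Lmx j.-1)) *m (Gam j%:Z - Mmx j.-1)
       *m sqrtmx (invmx (Rmx j.-1)).

Definition canonical_moments : 'rV['M[R[i]]_p]_n :=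
  \row_j canonical_moment j.+1.

End CanonicalMoments.

(* Padded with 0 when n < k. *)
Definition first_coords {R : realType} {p n : nat} (k : nat)
    (Z : 'rV['M[R[i]]_p]_n) : 'rV['M[R[i]]_p]_k :=
  \row_(i < k) (if insub (i : nat) is Some j then Z 0 j else 0).

(* The determinant is a positive real on the interior of the ball, hence the
   real part. *)
Definition rateA {R : realType} {p k : nat} (Z : 'rV['M[R[i]]_p]_k) : \bar R :=
  if `[< forall i, (Dball p)^° (Z 0 i) >] then
    (- (2 * p%:R) *
      \sum_(i < k) ln (complex.Re (\det (1%:M - (Z 0 i)^t* *m Z 0 i))))%:E
  else +oo%E.

(* Main.v *)
(* Up to a null set the moment space is the set of Gamma whose block Toeplitz
   matrix is positive definite: a positive definite Toeplitz matrix is a Gram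
   matrix whose block shift extends to a unitary matrix, and the spectral measure
   of the latter has the prescribed moments; conversely dilations by t < 1 map the
   moment space into the positive definite tuples.
   By Schur complements, T_(m+1) > 0 iff T_m > 0 and the next canonical moment A is
   in the open ball, and then det L_(m+1) = det L_m det(1 - A A^* ). Given the first
   m moments, Gamma_(m+1) runs over the image of the ball under an affine map with
   Jacobian (det L_m)^(2p). Hence integrating out Gamma_(k+1), ..., Gamma_n leaves on
   the first k moments a density proportional to (det L_k)^(2p(n-k)), where
   det L_k = prod_(i <= k) det(1 - A_i A_i^* ). The rate function is -2p log det L_k,
   and the two bounds follow by comparing (det L_k)^(2p(n-k)) with constants to that
   power on sets of positive volume; the normalization is handled in the same way,
   as det L_k <= 1 with equality at Gamma = 0. *)

(* Two factorizations of $L_m$ and $R_m$ coexist. Canonical moments use Hermitian square roots,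
   while the Jacobian is computed with triangular factors written as products of row operations, for
   which a change of variables reduces to affine substitutions in single real coordinates. The left
   and right factors contribute $(\det L_m)^p$ and $(\det R_m)^p$, and $\det L_m=\det R_m$ gives the
   exponent $2p$. Integrals against charges are defined through a Hahn decomposition, about which
   nothing explicit is known. They are reached through Riemann sums, which involve only the values
   of the charge and converge at an explicit rate for Lipschitz integrands. For the lower bound a
   neighbourhood in the space of canonical moments has to be pulled back to moments. This requires
   continuity of the Hermitian square root, obtained from an explicit estimate, and surjectivity of
   the canonical moments onto the product of open balls. *)
Require Import Defs.
From HB Require Import structures.
From mathcomp Require Import all_boot all_order all_algebra.
From mathcomp Require Import spectral ring lra.
From mathcomp Require Import all_classical all_reals all_analysis.
From mathcomp Require Import complex measurable_realfun zify.

Set Implicit Arguments.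
Unset Strict Implicit.
Unset Printing Implicit Defensive.

Import Order.TTheory GRing.Theory Num.Theory.
Import numFieldNormedType.Exports.

Local Open Scope classical_set_scope.
Local Open Scope ring_scope.
Local Open Scope sesquilinear_scope.

Local Notation "A ^H" := (A^t*) (at level 8, format "A ^H").

(** * Positive definite matrices *)

Section PositiveDefinite.
Context {C : numClosedFieldType}.

Lemma trmxC_mul m n q (A : 'M[C]_(m, n)) (B : 'M[C]_(n, q)) :
  (A *m B)^H = B^H *m A^H.
Proof. by rewrite trmx_mul map_mxM. Qed.

Lemma trmxC_add m n (A B : 'M[C]_(m, n)) : (A + B)^H = A^H + B^H.
Proof. by rewrite linearD map_mxD. Qed.

Lemma trmxC_sub m n (A B : 'M[C]_(m, n)) : (A - B)^H = A^H - B^H.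
Proof. by rewrite linearB map_mxB. Qed.

Lemma trmxC1 n : (1%:M : 'M[C]_n)^H = 1%:M.
Proof. by rewrite trmx1 map_mx1. Qed.

Lemma trmxC0 m n : (0 : 'M[C]_(m, n))^H = 0.
Proof. by rewrite trmx0 map_mx0. Qed.

Lemma trmxC_inv n (A : 'M[C]_n) : (invmx A)^H = invmx (A^H).
Proof. by rewrite trmx_inv map_invmx. Qed.

Lemma trmxC_block m1 m2 n1 n2 (A : 'M[C]_(m1, n1)) (B : 'M[C]_(m1, n2))
    (D : 'M[C]_(m2, n1)) (E : 'M[C]_(m2, n2)) :
  (block_mx A B D E)^H = block_mx A^H D^H B^H E^H.
Proof. by rewrite tr_block_mx map_block_mx. Qed.

Lemma trmxC_col m1 m2 n (A : 'M[C]_(m1, n)) (B : 'M[C]_(m2, n)) :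
  (col_mx A B)^H = row_mx A^H B^H.
Proof. by rewrite tr_col_mx map_row_mx. Qed.

Lemma trmxC_row m n1 n2 (A : 'M[C]_(m, n1)) (B : 'M[C]_(m, n2)) :
  (row_mx A B)^H = col_mx A^H B^H.
Proof. by rewrite tr_row_mx map_col_mx. Qed.

Lemma unitmx_trmxC n (A : 'M[C]_n) : (A^H \in unitmx) = (A \in unitmx).
Proof. by rewrite map_unitmx unitmx_tr. Qed.

Lemma det_trmxC n (A : 'M[C]_n) : \det (A^H) = (\det A)^*.
Proof. by rewrite det_map_mx det_tr. Qed.

Lemma trmxC_dot_ge0 n (v : 'cV[C]_n) : 0 <= (v^H *m v) 0 0.
Proof.
by rewrite mxE sumr_ge0 // => i _; rewrite !mxE mulrC mul_conjC_ge0.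
Qed.

Lemma trmxC_dot_gt0 n (v : 'cV[C]_n) : v != 0 -> 0 < (v^H *m v) 0 0.
Proof.
move=> v0; rewrite lt_def trmxC_dot_ge0 andbT; apply: contraNneq v0 => h.
apply/eqP/colP => i; rewrite mxE.
move: h; rewrite mxE => /eqP; rewrite psumr_eq0; last first.
  by move=> j _; rewrite !mxE mulrC mul_conjC_ge0.
move=> /allP /(_ i); rewrite mem_index_enum => /(_ isT).
by rewrite !mxE mulf_eq0 conjC_eq0 orbb => /eqP.
Qed.

Definition posdef n (A : 'M[C]_n) :=
  A^H = A /\ forall v : 'cV[C]_n, v != 0 -> 0 < (v^H *m A *m v) 0 0.

Lemma posdef1 n : posdef (1%:M : 'M[C]_n).
Proof.
by split=> [|v v0]; [exact: trmxC1 | rewrite mulmx1 trmxC_dot_gt0].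
Qed.

Lemma posdef_ge0 n (A : 'M[C]_n) (v : 'cV_n) :
  posdef A -> 0 <= (v^H *m A *m v) 0 0.
Proof.
move=> [_ hA]; have [->|/hA/ltW//] := eqVneq v 0.
by rewrite mulmx0 mxE.
Qed.

Lemma posdefZ n (A : 'M[C]_n) (a : C) : 0 < a -> posdef A -> posdef (a *: A).
Proof.
move=> a0 [hA pA]; split; first by
  rewrite linearZ /= map_mxZ hA /= conj_Creal // gtr0_real.
by move=> v v0; rewrite -scalemxAr -scalemxAl mxE mulr_gt0 // pA.
Qed.

Lemma posdef_unit n (A : 'M[C]_n) : posdef A -> A \in unitmx.
Proof.
move=> [hA pA]; rewrite -row_free_unit -kermx_eq0; apply/eqP.
apply/row_matrixP => i; rewrite row0; apply/eqP; apply: contraT => v0.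
have := pA (row i (kermx A))^H; rewrite trmxCK -row_mul mulmx_ker row0 mul0mx.
rewrite mxE ltxx; move=> -> //; apply: contraNneq v0 => /(congr1 (fun X => X^H)).
by rewrite trmxCK trmxC0 => ->.
Qed.

Lemma posdef_congr m n (A : 'M[C]_n) (B : 'M[C]_(n, m)) :
  (forall v : 'cV_m, v != 0 -> B *m v != 0) ->
  posdef A -> posdef (B^H *m A *m B).
Proof.
move=> iB [hA pA]; split.
  by rewrite !trmxC_mul trmxCK hA mulmxA.
by move=> v /iB/pA; rewrite trmxC_mul !mulmxA.
Qed.

Lemma unit_mul_neq0 m n (B : 'M[C]_n) (v : 'M[C]_(n, m)) :
  B \in unitmx -> v != 0 -> B *m v != 0.
Proof.
move=> uB; apply: contra_neq => /(congr1 (mulmx (invmx B))).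
by rewrite mulKmx // mulmx0.
Qed.

Lemma posdef_congrP n (A B : 'M[C]_n) :
  B \in unitmx -> posdef (B^H *m A *m B) <-> posdef A.
Proof.
move=> uB; split=> [|pA]; last first.
  by apply: posdef_congr => // v; exact: unit_mul_neq0.
move=> /(@posdef_congr n n _ (invmx B)).
rewrite trmxC_inv !mulmxA mulVmx ?unitmx_trmxC // mul1mx mulmxK //; apply=> v.
by apply: unit_mul_neq0; rewrite unitmx_inv.
Qed.

Lemma posdef_inv n (A : 'M[C]_n) : posdef A -> posdef (invmx A).
Proof.
move=> pA; have uA := posdef_unit pA.
apply/(posdef_congrP _ uA); rewrite pA.1.
by rewrite mulmxV // mul1mx.
Qed.

Lemma posdef_cast m n (e : m = n) (A : 'M[C]_m) :
  posdef (castmx (e, e) A) <-> posdef A.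
Proof. by case: n / e; rewrite castmx_id. Qed.

Lemma det_cast m n (e : m = n) (A : 'M[C]_m) : \det (castmx (e, e) A) = \det A.
Proof. by case: n / e; rewrite castmx_id. Qed.

Lemma posdef_ulsub m n (A : 'M[C]_m) B D (E : 'M[C]_n) :
  posdef (block_mx A B D E) -> posdef A.
Proof.
move=> /(posdef_congr (B := col_mx 1%:M 0)) h.
suff: posdef ((col_mx 1%:M 0)^H *m block_mx A B D E *m col_mx 1%:M 0).
  rewrite trmxC_col trmxC1 trmxC0 mul_row_block !mul1mx !mul0mx !addr0.
  by rewrite mul_row_col mulmx1 mulmx0 addr0.
apply: h => v; apply: contra_neq; rewrite mul_col_mx mul1mx mul0mx => /eqP.
by rewrite col_mx_eq0 => /andP[/eqP].
Qed.

Lemma posdef_drsub m n (A : 'M[C]_m) B D (E : 'M[C]_n) :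
  posdef (block_mx A B D E) -> posdef E.
Proof.
move=> /(posdef_congr (B := col_mx 0 1%:M)) h.
suff: posdef ((col_mx 0 1%:M)^H *m block_mx A B D E *m col_mx 0 1%:M).
  rewrite trmxC_col trmxC1 trmxC0 mul_row_block !mul1mx !mul0mx !add0r.
  by rewrite mul_row_col mulmx1 mulmx0 add0r.
apply: h => v; apply: contra_neq; rewrite mul_col_mx mul1mx mul0mx => /eqP.
by rewrite col_mx_eq0 => /andP[_ /eqP].
Qed.

Lemma posdef_block_diag m n (A : 'M[C]_m) (E : 'M[C]_n) :
  posdef (block_mx A 0 0 E) <-> posdef A /\ posdef E.
Proof.
split=> [pd|[pA pE]]; first by split; [exact: posdef_ulsub pd | exact: posdef_drsub pd].
split; first by rewrite trmxC_block !trmxC0 pA.1 pE.1.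
move=> v; rewrite -[v]vsubmxK; set a := usubmx v; set b := dsubmx v.
rewrite trmxC_col mul_row_block mul_row_col !mulmx0 add0r addr0 mxE col_mx_eq0.
rewrite negb_and => /orP[/pA.2|/pE.2] h.
  by rewrite ltr_wpDr // posdef_ge0.
by rewrite ltr_wpDl // posdef_ge0.
Qed.

Definition schur m n (A : 'M[C]_m) (B : 'M[C]_(m, n)) (E : 'M[C]_n) :=
  E - B^H *m invmx A *m B.

(** Block elimination as a congruence by a unipotent matrix: positivity and determinant of the block
    matrix become those of its two diagonal blocks. *)
Lemma schur_factor m n (A : 'M[C]_m) (B : 'M[C]_(m, n)) (E : 'M[C]_n)
    (U := block_mx 1%:M (invmx A *m B) 0 1%:M) :
  A \in unitmx -> A^H = A ->
  block_mx A B B^H E = U^H *m block_mx A 0 0 (schur A B E) *m U.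
Proof.
move=> uA hA; rewrite trmxC_block !trmxC1 trmxC0 trmxC_mul trmxC_inv hA.
rewrite !mulmx_block !(mul1mx, mulmx1, mulmx0, mul0mx, addr0, add0r).
by rewrite !mulmxKV // mulmxA mulmxV // mul1mx mulmxA addrC subrK.
Qed.

Lemma schur_factor_unit m n (X : 'M[C]_(m, n)) :
  block_mx 1%:M X 0 1%:M \in unitmx.
Proof. by rewrite unitmxE det_ublock !det1 mulr1 unitr1. Qed.

Lemma schur_det m n (A : 'M[C]_m) (B : 'M[C]_(m, n)) (E : 'M[C]_n) :
  A \in unitmx -> A^H = A ->
  \det (block_mx A B B^H E) = \det A * \det (schur A B E).
Proof.
move=> uA hA; rewrite schur_factor // !det_mulmx det_trmxC !det_ublock !det1.
by rewrite !mulr1 conjC1 mul1r.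
Qed.

Lemma schur_posdef m n (A : 'M[C]_m) (B : 'M[C]_(m, n)) (E : 'M[C]_n) :
  posdef (block_mx A B B^H E) <-> posdef A /\ posdef (schur A B E).
Proof.
split=> [pd|[pA pS]].
  have pA := posdef_ulsub pd; have uA := posdef_unit pA.
  move: pd; rewrite schur_factor // ?pA.1 // posdef_congrP ?schur_factor_unit //.
  by rewrite posdef_block_diag.
rewrite schur_factor ?pA.1 // ?posdef_unit // posdef_congrP ?schur_factor_unit //.
by rewrite posdef_block_diag.
Qed.

(** A block permutation; conjugating by it exchanges elimination of the upper left block with
    elimination of the lower right one. *)
Definition swap_mx m n : 'M[C]_(m + n, n + m) := block_mx 0 1%:M 1%:M 0.

Lemma swap_block m n (A : 'M[C]_m) (B : 'M[C]_(m, n)) D (E : 'M[C]_n) :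
  (swap_mx m n)^H *m block_mx A B D E *m swap_mx m n = block_mx E D B A.
Proof.
rewrite /swap_mx trmxC_block !trmxC0 !trmxC1 !mulmx_block.
by rewrite !(mul1mx, mulmx1, mulmx0, mul0mx, addr0, add0r).
Qed.

Lemma swap_mx_mul m n : (swap_mx m n)^H *m swap_mx m n = 1%:M.
Proof.
rewrite /swap_mx trmxC_block !trmxC0 !trmxC1 !mulmx_block.
by rewrite !(mul1mx, mulmx1, mulmx0, mul0mx, addr0, add0r) -scalar_mx_block.
Qed.

Lemma posdef_swap m n (A : 'M[C]_m) (B : 'M[C]_(m, n)) D (E : 'M[C]_n) :
  posdef (block_mx A B D E) -> posdef (block_mx E D B A).
Proof.
move=> pd; rewrite -(swap_block A B D E); apply: posdef_congr => // v.
apply: contra_neq => /(congr1 (mulmx (swap_mx m n)^H)).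
by rewrite mulmxA swap_mx_mul mul1mx mulmx0.
Qed.

Lemma schur_posdef_dr m n (A : 'M[C]_m) (B : 'M[C]_(m, n)) (E : 'M[C]_n) :
  posdef (block_mx A B B^H E) <-> posdef E /\ posdef (schur E B^H A).
Proof.
rewrite -schur_posdef trmxCK.
by split; exact: posdef_swap.
Qed.

Lemma schur_det_dr m n (A : 'M[C]_m) (B : 'M[C]_(m, n)) (E : 'M[C]_n) :
  E \in unitmx -> E^H = E ->
  \det (block_mx A B B^H E) = \det E * \det (schur E B^H A).
Proof.
move=> uE hE; pose U := block_mx 1%:M 0 (invmx E *m B^H) 1%:M : 'M[C]_(m + n).
have -> : block_mx A B B^H E = U^H *m block_mx (schur E B^H A) 0 0 E *m U.
  rewrite /U /schur trmxC_block !trmxC1 trmxC0 trmxC_mul trmxCK trmxC_inv hE.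
  rewrite !mulmx_block !(mul1mx, mulmx1, mulmx0, mul0mx, addr0, add0r).
  by rewrite !mulmxKV // !mulmxA mulmxV // mul1mx subrK.
rewrite !det_mulmx det_trmxC !det_lblock !det1 mulr1 conjC1 mul1r mulr1.
by rewrite mulrC.
Qed.

(** In the coordinates of [schur_factor] the row becomes [row_mx r w], where [w] is the part of [g]
    not predicted by [r], and the form becomes block diagonal. This yields the recursion for [tzL]
    when one moment is appended. *)
Lemma schur_quad q m n (A : 'M[C]_m) (B : 'M[C]_(m, n)) (E : 'M[C]_n)
    (r : 'M[C]_(q, m)) (g : 'M[C]_(q, n)) :
  posdef (block_mx A B B^H E) ->
  row_mx r g *m invmx (block_mx A B B^H E) *m (row_mx r g)^H =
  r *m invmx A *m r^H +
  (g - r *m invmx A *m B) *m invmx (schur A B E) *m (g - r *m invmx A *m B)^H.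
Proof.
move=> /schur_posdef[pA pS]; have uA := posdef_unit pA; have uS := posdef_unit pS.
rewrite schur_factor ?pA.1 //; set U := block_mx 1%:M _ _ _.
set w := g - _; set D := block_mx _ _ _ _.
have uU : U \in unitmx by exact: schur_factor_unit.
have uD : D \in unitmx by rewrite block_diag_mx_unit uA uS.
have -> : row_mx r g = row_mx r w *m U.
  by rewrite mul_row_block !mulmx1 mulmx0 addr0 mulmxA addrC subrK.
have -> : invmx (U^H *m D *m U) = invmx U *m invmx D *m invmx U^H.
  have uT : U^H *m D *m U \in unitmx by rewrite !unitmx_mul unitmx_trmxC uU uD.
  apply: (can_inj (mulKmx uT)); rewrite mulmxV // !mulmxA mulmxK // mulmxK //.
  by rewrite mulmxV // unitmx_trmxC.
rewrite trmxC_mul !mulmxA mulmxK // mulmxKV ?unitmx_trmxC //.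
rewrite invmx_block_diag // mul_row_block !mulmx0 addr0 add0r trmxC_row.
by rewrite mul_row_col.
Qed.

Lemma posdef_scalar1 (a : 'M[C]_1) : posdef a <-> 0 < a 0 0.
Proof.
split=> [[_ /(_ 1)]|a0].
  have -> : (1 : 'cV[C]_1)^H = 1 by exact: (@trmxC1 1).
  by rewrite mulmx1 mul1mx; apply; exact: oner_neq0.
rewrite [a]mx11_scalar -scalemx1; apply: posdefZ => //; exact: posdef1.
Qed.

(** One step of Sylvester's criterion, removing the first row and column. Iterated, it expresses
    positivity of a Hermitian matrix by finitely many determinants, which is how measurability and
    openness of positivity are obtained below. *)
Lemma posdef_sylvester n (A : 'M[C]_(1 + n)) :
  A^H = A -> posdef A <-> posdef (drsubmx A) /\ 0 < \det A.
Proof.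
move=> hA.
have hB : dlsubmx A = (ursubmx A)^H.
  by rewrite -{1}hA -map_dlsubmx -trmx_ursub.
have hE : (drsubmx A)^H = drsubmx A.
  by rewrite -[in RHS]hA -map_drsubmx -trmx_drsub.
rewrite -[X in posdef X]submxK -[X in \det X]submxK hB.
have key : posdef (drsubmx A) ->
    0 < \det (block_mx (ulsubmx A) (ursubmx A) (ursubmx A)^H (drsubmx A)) /
      \det (drsubmx A) <-> posdef (schur (drsubmx A) (ursubmx A)^H (ulsubmx A)).
  move=> pE; have uE := posdef_unit pE.
  rewrite schur_det_dr // mulrC mulKf -?unitfE -?unitmxE //.
  by rewrite posdef_scalar1 det_mx11.
(* A positive matrix has as determinant a product of positive scalar Schur complements. *)
have detpos k (D : 'M[C]_k) : posdef D -> 0 < \det D.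
  elim: k D => [|k IH] D pD; first by rewrite det_mx00.
  suff gen : forall D : 'M[C]_(1 + k), posdef D -> 0 < \det D by exact: gen.
  move=> {pD}D pD.
  have hD : dlsubmx D = (ursubmx D)^H by rewrite -{1}pD.1 -map_dlsubmx -trmx_ursub.
  move: pD; rewrite -[X in posdef X]submxK -[X in \det X]submxK hD.
  move=> /schur_posdef_dr[pE] /posdef_scalar1; rewrite -det_mx11 => h.
  by rewrite schur_det_dr ?(posdef_unit pE) ?pE.1 // mulr_gt0 // IH.
split=> [pd|[pE dpos]].
  by split; [exact: posdef_drsub pd | exact: detpos].
by apply/schur_posdef_dr; split=> //; apply/key => //; rewrite divr_gt0 // detpos.
Qed.

Lemma posdef_det_gt0 n (A : 'M[C]_n) : posdef A -> 0 < \det A.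
Proof.
case: n A => [|n] A pA; first by rewrite det_mx00.
by have [_] := (posdef_sylvester (A := A : 'M[C]_(1 + n)) pA.1).1 pA.
Qed.

End PositiveDefinite.

(** * Block Toeplitz matrices *)

Section BlockToeplitz.
Context {C : numClosedFieldType} {p : nat}.
Import tagnat.

Lemma val_Rank_const m (i : 'I_m) (k : 'I_p) :
  Rank (p_ := fun=> p) i k = (i * p + k)%N :> nat.
Proof.
rewrite [LHS]RankEsum; congr (_ + _)%N.
rewrite (eq_bigr (fun=> p)) // sum_nat_const; congr (_ * _)%N.
rewrite -sum1_card (eq_bigl (fun j : 'I_m => (j < i)%N)) //.
rewrite -(big_ord_widen m (fun=> 1%N)) 1?ltnW ?ltn_ord //.
by rewrite sum1_card card_ord.
Qed.

Lemma mxsize_recr m : (\sum_(i < m) p + p = \sum_(i < m.+1) p)%N.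
Proof. by rewrite big_ord_recr. Qed.

Lemma mxrow_recr n m (B : 'I_m.+1 -> 'M[C]_(n, p)) :
  \mxrow_(j < m.+1) B j = castmx (erefl, mxsize_recr m)
    (row_mx (\mxrow_(j < m) B (widen_ord (leqnSn m) j)) (B ord_max)).
Proof.
apply/mxrowP => i; rewrite mxrowK; apply/matrixP => a k.
rewrite !(castmxE, mxE) /= cast_ord_id.
have := val_Rank_const i k.
case: splitP => l /= e; rewrite e => e'.
  have im : (i < m)%N.
    have := ltn_ord l; rewrite e' sum_nat_const card_ord => h.
    rewrite ltnNge; apply/negP => mi; move: h; rewrite ltnNge => /negP; apply.
    by rewrite (leq_trans _ (leq_addr _ _)) // leq_mul2r mi orbT.
  have -> : l = Rank (p_ := fun=> p) (Ordinal im) k.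
    by apply: ord_inj; rewrite val_Rank_const e'.
  have /matrixP/(_ a k) := mxrowK (fun j => B (widen_ord (leqnSn m) j)) (Ordinal im).
  by rewrite mxE => ->; congr (B _ _ _); apply: val_inj.
have kp := ltn_ord k; have lp := ltn_ord l.
move: e'; rewrite sum_nat_const card_ord => e'.
have im : i = ord_max.
  apply: val_inj => /=; move: (congr1 (divn^~ p) e').
  by rewrite !divnMDl ?(leq_ltn_trans _ kp) // !divn_small // !addn0.
move: e'; rewrite im /= => /addnI e'.
by congr (B _ _ _); apply: val_inj; rewrite /= e'.
Qed.

Lemma mxcol_recr n m (B : 'I_m.+1 -> 'M[C]_(p, n)) :
  \mxcol_(j < m.+1) B j = castmx (mxsize_recr m, erefl)
    (col_mx (\mxcol_(j < m) B (widen_ord (leqnSn m) j)) (B ord_max)).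
Proof.
by apply: trmx_inj; rewrite trmx_cast tr_col_mx !tr_mxcol mxrow_recr.
Qed.

Lemma mxblock_recr m (B : 'I_m.+1 -> 'I_m.+1 -> 'M[C]_p) :
  let w := widen_ord (leqnSn m) in
  \mxblock_(i < m.+1, j < m.+1) B i j = castmx (mxsize_recr m, mxsize_recr m)
    (block_mx (\mxblock_(i < m, j < m) B (w i) (w j))
      (\mxcol_(i < m) B (w i) ord_max)
      (\mxrow_(j < m) B ord_max (w j)) (B ord_max ord_max)).
Proof.
move=> w; rewrite mxblockEh mxrow_recr block_mxEh.
rewrite mxcol_recr.
under eq_mxrow do rewrite mxcol_recr.
have -> : \mxrow_(j < m) castmx (mxsize_recr m, erefl)
    (col_mx (\mxcol_(i < m) B (w i) (w j)) (B ord_max (w j))) =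
  castmx (mxsize_recr m, erefl) (col_mx (\mxrow_(j < m) \mxcol_(i < m) B (w i) (w j))
     (\mxrow_(j < m) B ord_max (w j))).
  apply/matrixP => a b; rewrite castmxE !mxE castmxE !mxE /= !cast_ord_id.
  by case: splitP => c _; rewrite !mxE.
rewrite -mxblockEh.
by case: _ / (mxsize_recr m); rewrite !castmx_id.
Qed.

Implicit Type g : int -> 'M[C]_p.

(** The matrices of the statement for a two-sided sequence, so that one recursion serves tuples of
    every length. With [m] block rows, [tz g m] is $T_{m-1}$, whereas [tzL g m], [tzR g m] and
    [tzM g m] are $L_m$, $R_m$ and $M_m$. *)
Definition tz g m : 'M[C]_(\sum_(i < m) p) :=
  \mxblock_(i < m, j < m) g (j%:Z - i%:Z).
Definition tzrow g m : 'M[C]_(p, \sum_(i < m) p) := \mxrow_(j < m) g (j.+1%:Z).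
Definition tzrown g m : 'M[C]_(p, \sum_(i < m) p) :=
  \mxrow_(j < m) g (j%:Z - m%:Z).
Definition tzL g m := 1%:M - tzrow g m *m invmx (tz g m) *m (tzrow g m)^H.
Definition tzR g m := 1%:M - tzrown g m *m invmx (tz g m) *m (tzrown g m)^H.
Definition tzM g m := tzrow g m *m invmx (tz g m) *m (tzrown g m)^H.

Definition hermseq g := g 0 = 1%:M /\ forall j, g (- j) = (g j)^H.

(** Splitting off the first block row and column shows $L_m$ as the Schur complement of $T_{m-1}$ in
    $T_m$. *)
Lemma tz_recl g m : hermseq g ->
  tz g m.+1 = castmx (mxsize_recl, mxsize_recl)
    (block_mx 1%:M (tzrow g m) (tzrow g m)^H (tz g m)).
Proof.
move=> [g0 gN]; rewrite /tz mxblock_recul; congr (castmx _ _).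
rewrite subrr g0; congr block_mx.
- by apply: eq_mxrow => j; rewrite subr0 lift0.
- rewrite tr_mxrow; apply/matrixP => a b; rewrite !mxE sub0r gN mxE lift0.
  by rewrite mxE.
- by apply: eq_mxblock => i j; rewrite !lift0 !intS opprD addrACA subrr add0r.
Qed.

(** Splitting off the last block row and column instead shows $R_m$ as a Schur complement of the
    same $T_{m-1}$. *)
Lemma tz_recr g m : hermseq g ->
  tz g m.+1 = castmx (mxsize_recr m, mxsize_recr m)
    (block_mx (tz g m) (tzrown g m)^H (tzrown g m) 1%:M).
Proof.
move=> [g0 gN]; rewrite /tz mxblock_recr; congr (castmx _ _).
rewrite subrr g0; congr block_mx.
rewrite tr_mxrow; apply/matrixP => a b; rewrite !mxE /=.
by rewrite -opprB gN !mxE.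
Qed.

Lemma tzrow_recr g m :
  tzrow g m.+1 = castmx (erefl, mxsize_recr m) (row_mx (tzrow g m) (g m.+1%:Z)).
Proof. by rewrite /tzrow mxrow_recr. Qed.

Lemma mul_empty m n (X : 'M[C]_(m, \sum_(i < 0) p)) (Y : 'M[C]_(\sum_(i < 0) p, n)) :
  X *m Y = 0.
Proof.
have n0 : (\sum_(i < 0) p = 0)%N by rewrite big_ord0.
apply/matrixP => a b; rewrite !mxE; apply: big1 => i.
by move: (ltn_ord i); rewrite {2}n0.
Qed.

Lemma tz_initial g : [/\ tzL g 0 = 1%:M, tzR g 0 = 1%:M & tzM g 0 = 0].
Proof. by rewrite /tzL /tzR /tzM !mul_empty subr0. Qed.

Lemma tz0_posdef g : posdef (tz g 0).
Proof.
have n0 : (\sum_(i < 0) p = 0)%N by rewrite big_ord0.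
split=> [|v]; first by apply/matrixP => i; move: (ltn_ord i); rewrite {2}n0.
suff -> : v = 0 by rewrite eqxx.
by apply/matrixP => i; move: (ltn_ord i); rewrite {2}n0.
Qed.

Lemma tz0_det g : \det (tz g 0) = 1.
Proof.
have n0 : (\sum_(i < 0) p = 0)%N by rewrite big_ord0.
by move: (tz g 0); case: _ / (esym n0) => X; rewrite det_mx00.
Qed.

Section Herm.
Variables (g : int -> 'M[C]_p) (hg : hermseq g).

Lemma tz_posdefS m :
  posdef (tz g m.+1) <-> posdef (tz g m) /\ posdef (tzL g m).
Proof.
rewrite tz_recl // posdef_cast.
by rewrite schur_posdef_dr /schur trmxCK.
Qed.

Lemma tz_detS m : posdef (tz g m) ->
  \det (tz g m.+1) = \det (tz g m) * \det (tzL g m).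
Proof.
move=> pT; rewrite tz_recl // det_cast schur_det_dr ?posdef_unit ?pT.1 //.
by rewrite /schur trmxCK.
Qed.

Lemma tzR_posdef m : posdef (tz g m.+1) -> posdef (tzR g m).
Proof.
rewrite tz_recr // posdef_cast -{2}[tzrown g m]trmxCK => /schur_posdef[_].
by rewrite /schur trmxCK.
Qed.

Lemma tz_detSR m : posdef (tz g m) ->
  \det (tz g m.+1) = \det (tz g m) * \det (tzR g m).
Proof.
move=> pT; rewrite tz_recr // det_cast -{2}[tzrown g m]trmxCK.
by rewrite schur_det ?posdef_unit ?pT.1 // /schur trmxCK.
Qed.

(** Both sides are $\det T_m/\det T_{m-1}$. Thus left and right normalizations contribute the same
    power to the Jacobian. *)
Lemma tz_det_LR m : posdef (tz g m) -> \det (tzL g m) = \det (tzR g m).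
Proof.
move=> pT; have := tz_detS pT; rewrite tz_detSR //.
have u : \det (tz g m) != 0 by rewrite gt_eqF // posdef_det_gt0.
by move=> /(mulfI u).
Qed.

(** [schur_quad] applied to $T_m$ split along its last block, where the Schur complement is $R_m$
    and the unpredicted part of $\Gamma_{m+1}$ is $\Gamma_{m+1}-M_m$. *)
Lemma tzL_rec m : posdef (tz g m.+1) ->
  tzL g m.+1 = tzL g m -
    (g m.+1%:Z - tzM g m) *m invmx (tzR g m) *m (g m.+1%:Z - tzM g m)^H.
Proof.
move=> pT; rewrite /tzL -addrA -opprD; congr (_ - _).
move: pT; rewrite tzrow_recr tz_recr // posdef_cast.
(* The lower left block is written as a double adjoint, so that the off-diagonal blocks have the
   shape [B], [B^H] that [schur_quad] expects. *)
rewrite /tzR /tzM; have e := trmxCK (tzrown g m).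
set h := (tzrown g m)^H in e *; rewrite -{}e => pT.
have sq a b (e : a = b) (r : 'M[C]_(p, a)) (K : 'M[C]_a) :
    castmx (erefl, e) r *m invmx (castmx (e, e) K) *m (castmx (erefl, e) r)^H =
    r *m invmx K *m r^H.
  by case: b / e; rewrite !castmx_id.
by rewrite sq schur_quad // /schur trmxCK.
Qed.

End Herm.

End BlockToeplitz.

(** * Triangular factors as products of row operations *)

Section GramSchmidt.
Context {C : numClosedFieldType} {p : nat}.
Implicit Types (A B L : 'M[C]_p) (w : 'rV[C]_p).

Definition set_row_id (k : 'I_p) w : 'M[C]_p :=
  \matrix_(u, v) if u == k then w 0 v else (u == v)%:R.

(** Lower triangular matrices with positive diagonal, presented as products of operations that
    change one row: a change of variables can then be carried out by induction, one row at a
    time. *)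
Inductive rowprod : 'M[C]_p -> Prop :=
| Rowprod1 : rowprod 1%:M
| RowprodM k w B : 0 < w 0 k -> (forall v : 'I_p, (k < v)%N -> w 0 v = 0) ->
    rowprod B -> rowprod (set_row_id k w *m B).

Lemma det_set_row_id (k : 'I_p) w :
  (forall v : 'I_p, (k < v)%N -> w 0 v = 0) -> \det (set_row_id k w) = w 0 k.
Proof.
move=> hw; rewrite det_trig; last first.
  apply/is_trig_mxP => i j ij; rewrite mxE; case: eqP => [ik|_].
    by apply: hw; rewrite -ik.
  by rewrite -val_eqE ltn_eqF.
rewrite (bigD1 k) //= mxE eqxx big1 ?mulr1 // => i ik.
by rewrite mxE (negbTE ik) eqxx.
Qed.

Lemma rowprod_det_gt0 B : rowprod B -> 0 < \det B.
Proof.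
elim=> [|k w {}B w0 hw _ IH]; first by rewrite det1.
by rewrite det_mulmx det_set_row_id // mulr_gt0.
Qed.

Lemma row_set_row_id k w u :
  row u (set_row_id k w) = if u == k then w else delta_mx 0 u.
Proof.
apply/rowP => v; rewrite !mxE; case: ifP => // _.
by rewrite mxE eqxx /= eq_sym.
Qed.

Lemma congr_entry (E N : 'M[C]_p) u v :
  (E *m N *m E^H) u v = (row u E *m N *m (row v E)^H) 0 0.
Proof.
transitivity (row u (E *m N *m E^H) 0 v); first by rewrite [RHS]mxE.
rewrite 2!row_mul !mxE; apply: eq_bigr => j _.
by rewrite !mxE.
Qed.

(** Gram-Schmidt for the form [L]: after [k] steps the Gram matrix of the rows of [B] is the
    identity in its upper left corner of size [k]. *)
Lemma rowprod_orthonormal L :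
  posdef L -> exists2 B, rowprod B & B *m L *m B^H = 1%:M.
Proof.
move=> pL.
suff H k : (k <= p)%N -> exists2 B, rowprod B &
    forall u v : 'I_p, (u < k)%N -> (v < k)%N -> (B *m L *m B^H) u v = (u == v)%:R.
  have [B rB hB] := H p (leqnn _); exists B => //.
  by apply/matrixP => u v; rewrite hB // mxE.
elim: k => [|k IH] kp; first by exists 1%:M => //; exact: Rowprod1.
have [B rB hB] := IH (ltnW kp); set N := B *m L *m B^H in hB.
pose K := Ordinal kp.
have uB : B \in unitmx by rewrite unitmxE unitfE gt_eqF // rowprod_det_gt0.
have pN : posdef N.
  have : posdef (B^H ^H *m L *m B^H) by apply/posdef_congrP => //; rewrite unitmx_trmxC.
  by rewrite trmxCK.
have NE : B *m L *m B^H = N by []; clearbody N.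
(* The basis vector of index [k] minus its projection, for the form [N], on the previous ones, which
   are already orthonormal. *)
pose w0 : 'rV[C]_p := \row_v if (v < k)%N then - N K v else (v == K)%:R.
have w0K : w0 0 K = 1 by rewrite mxE ltnn eqxx.
have w00 : w0^H != 0.
  apply/eqP => /matrixP/(_ K 0); rewrite mxE mxE w0K conjC1 mxE => /eqP.
  by rewrite oner_eq0.
have q0 : 0 < (w0 *m N *m w0^H) 0 0 by have := pN.2 _ w00; rewrite trmxCK.
set q := _ 0 0 in q0; pose t := (sqrtC q)^-1.
have t0 : 0 < t by rewrite invr_gt0 sqrtC_gt0.
have wv (v : 'I_p) : (k < v)%N -> w0 0 v = 0.
  by move=> kv; rewrite mxE ltnNge ltnW //= -val_eqE /= gtn_eqF.
exists (set_row_id K (t *: w0) *m B).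
  apply: RowprodM => //; first by rewrite mxE w0K mulr1.
  by move=> v kv; rewrite mxE wv // mulr0.
move=> u v; rewrite trmxC_mul !mulmxA -[set_row_id _ _ *m B *m L]mulmxA.
rewrite -[set_row_id _ _ *m (B *m L) *m B^H]mulmxA NE => uk vk.
have hKK : (t *: w0 *m N *m (t *: w0)^H) 0 0 = 1.
  rewrite linearZ /= map_mxZ -scalemxAl -scalemxAl -scalemxAr mxE [X in _ * X]mxE -/q.
  rewrite /= (conj_Creal (gtr0_real t0)) mulrA -expr2 exprVn sqrtCK.
  by rewrite mulVf // gt_eqF.
have hK (x : 'I_p) : (x < k)%N -> (t *: w0 *m N) 0 x = 0.
  move=> xk; rewrite -scalemxAl mxE.
  suff -> : (w0 *m N) 0 x = 0 by rewrite mulr0.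
  rewrite mxE (bigID (fun j : 'I_p => j < k)%N) /= (bigD1 x) //=.
  rewrite [X in _ + X + _]big1; last first.
    by move=> j /andP[jk jx]; rewrite hB // (negbTE jx) mulr0.
  rewrite [X in _ + X](bigD1 K) /= ?ltnn // [X in _ + (_ + X)]big1; last first.
    move=> j /andP[jk jK]; rewrite mxE (negbTE jk) (negbTE jK) mul0r //.
  by rewrite w0K hB // eqxx mxE xk !mulr1 mul1r !addr0 addNr.
rewrite congr_entry !row_set_row_id.
have [uK|uK] := eqVneq u K; have [vK|vK] := eqVneq v K.
- by rewrite hKK uK vK eqxx.
- have vk' : (v < k)%N by move: vk; rewrite ltnS leq_eqVlt -(inj_eq val_inj) /= in vK *; rewrite (negbTE vK).
  have -> : (delta_mx 0 v : 'rV[C]_p)^H = delta_mx v 0.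
    by apply/matrixP => a b; rewrite !mxE conjC_nat andbC.
  by rewrite -colE mxE hK // uK eq_sym (negbTE vK).
- have uk' : (u < k)%N by move: uk; rewrite ltnS leq_eqVlt -(inj_eq val_inj) /= in uK *; rewrite (negbTE uK).
  have -> : (delta_mx 0 u : 'rV[C]_p) *m N *m (t *: w0)^H =
      (t *: w0 *m N *m (delta_mx 0 u : 'rV[C]_p)^H)^H.
    by rewrite !trmxC_mul trmxCK pN.1 mulmxA.
  have -> : (delta_mx 0 u : 'rV[C]_p)^H = delta_mx u 0.
    by apply/matrixP => a b; rewrite !mxE conjC_nat andbC.
  by rewrite mxE mxE -colE mxE hK // conjC0 vK (negbTE uK).
have vk' : (v < k)%N by move: vk; rewrite ltnS leq_eqVlt -(inj_eq val_inj) /= in vK *; rewrite (negbTE vK).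
have uk' : (u < k)%N by move: uk; rewrite ltnS leq_eqVlt -(inj_eq val_inj) /= in uK *; rewrite (negbTE uK).
have -> : (delta_mx 0 v : 'rV[C]_p)^H = delta_mx v 0.
  by apply/matrixP => a b; rewrite !mxE conjC_nat andbC.
by rewrite -rowE -colE !mxE hB.
Qed.

End GramSchmidt.

Section NextMoment.
Context {C : numClosedFieldType} {p : nat}.

Lemma tz_herm (g : int -> 'M[C]_p) m : hermseq g -> (tz g m)^H = tz g m.
Proof.
by move=> [_ gN]; apply/matrixP => a b; rewrite !mxE -opprB gN !mxE conjCK.
Qed.

Lemma tz_ext m (g g' : int -> 'M[C]_p) :
  (forall j : int, (absz j <= m)%N -> g j = g' j) ->
  [/\ tz g m.+1 = tz g' m.+1, tzL g m = tzL g' m, tzR g m = tzR g' m &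
      tzM g m = tzM g' m].
Proof.
move=> h.
have e1 : tz g m.+1 = tz g' m.+1.
  apply: eq_mxblock => i j; apply: h.
  by have := ltn_ord i; have := ltn_ord j; lia.
have e2 : tz g m = tz g' m.
  apply: eq_mxblock => i j; apply: h.
  by have := ltn_ord i; have := ltn_ord j; lia.
have e3 : tzrow g m = tzrow g' m.
  by apply: eq_mxrow => j; apply: h; have := ltn_ord j; lia.
have e4 : tzrown g m = tzrown g' m.
  by apply: eq_mxrow => j; apply: h; have := ltn_ord j; lia.
by rewrite /tzL /tzR /tzM e2 e3 e4.
Qed.

(* B and D are inverse Cholesky factors of L_m and R_m; the matrix A below is
   the next canonical moment up to unitary factors on both sides. *)
Lemma tz_next (g : int -> 'M[C]_p) m : hermseq g -> posdef (tz g m.+1) ->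
  exists B D : 'M[C]_p,
  [/\ rowprod B, rowprod D, (\det B)^-1 ^+ 2 = \det (tzL g m),
      (\det D)^-1 ^+ 2 = \det (tzL g m) &
      forall g', hermseq g' -> (forall j : int, (absz j <= m)%N -> g' j = g j) ->
        let A := B *m (g' m.+1%:Z - tzM g m) *m D^H in
        (posdef (tz g' m.+2) <-> posdef (1%:M - A *m A^H)) /\
        \det (tzL g' m.+1) = \det (tzL g m) * \det (1%:M - A *m A^H)].
Proof.
move=> hg O; have [pT pL] := (tz_posdefS hg m).1 O.
have pR := tzR_posdef hg O.
have [B rB hB] := rowprod_orthonormal pL.
have [D rD hD] := rowprod_orthonormal pR.
have detrp (E L : 'M[C]_p) : rowprod E -> E *m L *m E^H = 1%:M ->
    \det L = (\det E)^-1 ^+ 2.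
  move=> rE hE; have d0 := rowprod_det_gt0 rE.
  have := congr1 determinant hE; rewrite !det_mulmx det_trmxC det1.
  rewrite (conj_Creal (gtr0_real d0)) => e.
  apply: (mulIf (x := \det E ^+ 2)); first by rewrite sqrf_eq0 gt_eqF.
  rewrite exprVn mulVf ?sqrf_eq0 ?gt_eqF // -e expr2; ring.
have LR := tz_det_LR hg pT.
exists B, D; split; [exact: rB|exact: rD| | |].
- by rewrite (detrp _ _ rB hB).
- by rewrite LR (detrp _ _ rD hD).
move=> g' hg' gg' A.
have [e1 e2 e3 e4] := tz_ext gg'.
have O' : posdef (tz g' m.+1) by rewrite e1.
have := tzL_rec hg' O'; rewrite e2 e3 e4 => eL.
have uB : B \in unitmx by rewrite unitmxE unitfE gt_eqF // rowprod_det_gt0.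
have uD : D \in unitmx by rewrite unitmxE unitfE gt_eqF // rowprod_det_gt0.
have uR := posdef_unit pR.
have iR : invmx (tzR g m) = D^H *m D.
  apply: (can_inj (mulKmx uR)); rewrite mulmxV // mulmxA.
  by apply/esym/mulmx1C; rewrite mulmxA.
have eA : B *m tzL g' m.+1 *m B^H = 1%:M - A *m A^H.
  rewrite eL mulmxBr mulmxBl hB iR; congr (_ - _).
  by rewrite /A !trmxC_mul trmxCK !mulmxA.
split.
  rewrite -eA -{1}[B]trmxCK posdef_congrP ?unitmx_trmxC //.
  by rewrite tz_posdefS //; split=> [[]//|].
rewrite -eA !det_mulmx det_trmxC (detrp _ _ rB hB).
have d0 := rowprod_det_gt0 rB; rewrite (conj_Creal (gtr0_real d0)).
have b0 : \det B != 0 by rewrite gt_eqF.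
by field.
Qed.

End NextMoment.

(** * Iterated integrals *)

Section Marginals.
Context {R : realType} {K : choiceType}.
Local Notation RR := (measurableTypeR R).
Local Open Scope ereal_scope.

(** Points may have infinitely many coordinates. They carry a $\sigma$-algebra but no measure:
    integrals are iterated over a finite list of coordinates while all others stay frozen. *)
Definition cylinders : set (set (K -> R)) :=
  [set A | exists c (B : set RR), measurable B /\ A = (fun x => x c) @^-1` B].

Local Notation T := (g_sigma_algebraType cylinders).
Implicit Types (F G : T -> \bar R) (x : T) (s : seq K).

Lemma measurable_coord c : measurable_fun setT (fun x : T => x c : RR).
Proof.
move=> _ B mB; rewrite setTI; apply: sub_gen_smallest.
by exists c, B.
Qed.

Lemma measurable_pt d (S : measurableType d) (f : S -> T) :
  (forall c, measurable_fun setT (fun w => f w c : RR)) -> measurable_fun setT f.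
Proof.
move=> mf; apply: (@measurability _ _ S T setT f cylinders erefl) => // _ [_ [c [B [mB ->]]] <-].
by rewrite setTI -[_ @^-1` _]setTI; exact: mf.
Qed.

Definition upd x c (y : R) : T := fun c' => if c' == c then y else x c'.

Definition nice F := measurable_fun setT F /\ forall x, 0 <= F x.

Definition J c F x : \bar R := \int[@lebesgue_measure R]_y F (upd x c y).
Definition Js s F : T -> \bar R := foldr J F s.

Lemma measurable_upd c : measurable_fun setT (fun z : T * RR => upd z.1 c z.2).
Proof.
apply: measurable_pt => c'; rewrite /upd; case: eqP => _.
  exact: measurable_snd.
exact: (measurableT_comp (measurable_coord c') measurable_fst).
Qed.

Lemma nice_upd F c : nice F -> measurable_fun setT (fun z : T * RR => F (upd z.1 c z.2)).
Proof. by move=> [mF _]; exact: (measurableT_comp mF (measurable_upd c)). Qed.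

Lemma measurable_slice F x c : nice F -> measurable_fun setT (fun y : RR => F (upd x c y)).
Proof.
move=> [mF _]; apply: (measurableT_comp mF); apply: measurable_pt => c'.
by rewrite /upd; case: eqP => _; [exact: measurable_id|exact: measurable_cst].
Qed.

Lemma nice_J c F : nice F -> nice (J c F).
Proof.
move=> nF; split; last by move=> x; apply: integral_ge0 => y _; exact: nF.2.
apply: (measurable_fun_fubini_tonelli_F (m2 := @lebesgue_measure R)
  (fun z : T * RR => F (upd z.1 c z.2))) => [|z]; last exact: nF.2.
exact: nice_upd.
Qed.

Lemma nice_Js s F : nice F -> nice (Js s F).
Proof. by move=> nF; elim: s => //= c s; exact: nice_J. Qed.

Lemma Js_cat s1 s2 F : Js (s1 ++ s2) F = Js s1 (Js s2 F).
Proof. by rewrite /Js foldr_cat. Qed.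

Lemma upd_comm x c c' y y' : c != c' ->
  upd (upd x c y) c' y' = upd (upd x c' y') c y.
Proof.
move=> cc'; apply/funext => e; rewrite /upd.
by have [->|//] := eqVneq e c'; rewrite eq_sym (negbTE cc').
Qed.

Lemma J_comm c c' F : nice F -> J c (J c' F) = J c' (J c F).
Proof.
move=> nF; have [->//|cc'] := eqVneq c c'; apply/funext => x.
rewrite /J (fubini_tonelli (m1 := @lebesgue_measure R) (m2 := @lebesgue_measure R)
  (fun z : RR * RR => F (upd (upd x c z.1) c' z.2))).
- by apply: eq_integral => y _; apply: eq_integral => y' _; rewrite upd_comm.
- apply: (measurableT_comp nF.1); apply: measurable_pt => e; rewrite /upd.
  by case: eqP => _; [exact: measurable_snd|case: eqP => _;
    [exact: measurable_fst|exact: measurable_cst]].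
- by move=> z; exact: nF.2.
Qed.

Lemma Js_rot c s F : nice F -> Js s (J c F) = J c (Js s F).
Proof.
move=> nF; elim: s => //= e s ->.
by rewrite J_comm //; exact: nice_Js.
Qed.

Lemma Js_perm s1 s2 F : nice F -> perm_eq s1 s2 -> Js s1 F = Js s2 F.
Proof.
move=> nF; elim: s1 s2 => [|c s1 IH] s2 h.
  by move: h; rewrite perm_sym => /perm_nilP ->.
have : c \in s2 by rewrite -(perm_mem h) mem_head.
move=> /splitPr hs; case: hs h => a b h.
rewrite Js_cat /= (Js_rot c a (nice_Js b nF)).
have := perm_catCA a [:: c] b; rewrite /= => h'; rewrite perm_sym h' perm_sym in h.
by rewrite perm_cons in h; rewrite (IH _ h) Js_cat.
Qed.

(** The two base points may differ, so this also shows that an iterated integral does not depend on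
    frozen coordinates that the integrand ignores. *)
Lemma Js_eq s F G x x' :
  (forall y y' : T, (forall c, c \in s -> y c = y' c) ->
     (forall c, c \notin s -> y c = x c) -> (forall c, c \notin s -> y' c = x' c) ->
     F y = G y') ->
  Js s F x = Js s G x'.
Proof.
elim: s x x' => [|c s IH] x x' h /=.
  by apply: h.
apply: eq_integral => t _; apply: IH => y y' e1 e2 e3; apply: h => e.
- rewrite inE; have [es _|es] := boolP (e \in s); first exact: e1.
  by rewrite orbF => /eqP ?; rewrite e2 // e3 // /upd; case: eqP.
- by rewrite inE negb_or => /andP[ec es]; rewrite e2 // /upd (negbTE ec).
- by rewrite inE negb_or => /andP[ec es]; rewrite e3 // /upd (negbTE ec).
Qed.

Lemma Js_ext s F G x :
  (forall y : T, (forall c, c \notin s -> y c = x c) -> F y = G y) ->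
  Js s F x = Js s G x.
Proof.
move=> h; apply: Js_eq => y y' e1 e2 e3.
have -> : y = y' by apply/funext => c; case: (boolP (c \in s)) => [/e1//|cs]; rewrite e2 // e3.
exact: h.
Qed.

(** The integral of a nonnegative function is a supremum over simple functions below it, so the
    comparison covers all nonnegative functions, in particular slices of the indicator of the moment
    space. *)
Lemma ge0_integral_mono (f g : RR -> \bar R) :
  (forall t, 0 <= f t) -> (forall t, f t <= g t) ->
  \int[@lebesgue_measure R]_t f t <= \int[@lebesgue_measure R]_t g t.
Proof.
move=> f0 fg; rewrite !ge0_integralTE //; last first.
  by move=> t; exact: le_trans (f0 t) (fg t).
apply: ge_ereal_sup => _ [h /= hf <-]; apply: ereal_sup_ubound.
by exists h => // t; exact: le_trans (hf t) (fg t).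
Qed.

Lemma Js_ge0 s F x : (forall y, 0 <= F y) -> 0 <= Js s F x.
Proof.
by move=> F0; elim: s x => //= c s IH x; apply: integral_ge0 => t _.
Qed.

Lemma Js_le s F G x : (forall y, 0 <= F y) ->
  (forall y : T, (forall c, c \notin s -> y c = x c) -> F y <= G y) ->
  Js s F x <= Js s G x.
Proof.
move=> F0; elim: s x => [|c s IH] x h /=; first by apply: h.
apply: ge0_integral_mono => t; first exact: Js_ge0.
apply: IH => y e; apply: h => e'; rewrite inE negb_or => /andP[e1 e2].
by rewrite e // /upd (negbTE e1).
Qed.

Lemma Js_scale s F x (k : \bar R) : nice F -> 0 <= k ->
  Js s (fun y => k * F y) x = k * Js s F x.
Proof.
move=> nF k0; elim: s x => //= c s IH x; rewrite /J.
under eq_integral do rewrite IH.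
rewrite ge0_integralZl //=.
- by apply: measurable_slice; exact: nice_Js.
- by move=> t _; exact: (nice_Js _ nF).2.
Qed.

Lemma Js0 s x : Js s (fun=> 0) x = 0.
Proof. by elim: s x => //= c s IH x; apply: integral0_eq => t _; exact: IH. Qed.

Definition affmap s (a : R) (b : K -> R) x : T :=
  fun c => if c \in s then (a * x c + b c)%R else x c.

Lemma measurable_affine (a b : R) : measurable_fun setT (fun t : RR => a * t + b : RR)%R.
Proof.
have ma : measurable_fun setT (fun t : R => a * t + b)%R.
  by apply: measurable_funD; [apply: measurable_funM|].
exact: ma.
Qed.

(** Rescaled by [a], the pushforward gives half-open intervals their length, and Lebesgue measure is
    the only measure that does. *)
Lemma lebesgue_affine (a b : R) (A : set RR) : (0 < a)%R -> measurable A ->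
  pushforward (@lebesgue_measure R) (fun t : RR => a * t + b : RR)%R A =
  (a^-1)%:E * lebesgue_measure A.
Proof.
move=> a0 mA; have maff := measurable_affine a b.
pose mu : {measure set RR -> \bar R} := mscale (NngNum (ltW a0))
  (pushforward (@lebesgue_measure R) (fun t : RR => a * t + b : RR)%R).
have -> : lebesgue_measure A = mu maff A.
  apply: lebesgue_measure_unique => // _ [[u v]] _ <-.
  change (lebesgue_measure [set` `]u, v]] = a%:E * lebesgue_measure
    ((fun t : RR => a * t + b : RR)%R @^-1` [set` `]u, v]])).
  rewrite (_ : _ @^-1` _ = [set` `](a^-1 * (u - b))%R, (a^-1 * (v - b))%R]]); last first.
    apply/seteqP; split=> t /=.
      by rewrite !in_itv /= ltr_pdivrMl // ler_pdivlMl // ltrBlDr lerBrDr.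
    by rewrite !in_itv /= ltr_pdivrMl // ler_pdivlMl // ltrBlDr lerBrDr.
  rewrite !lebesgue_measure_itv /= !lte_fin ltr_pM2l ?invr_gt0 // ltrBlDr subrK.
  case: ifP => _; last by rewrite mule0.
  rewrite -!EFinD -EFinM; congr _%:E.
  by rewrite -mulrBr mulrA divff ?gt_eqF // mul1r opprB addrA subrK.
rewrite /mu /= /mscale /= muleA -EFinM mulVf ?gt_eqF // mul1e.
by [].
Qed.

Lemma integral_affine (f : RR -> \bar R) (a b : R) : (0 < a)%R ->
  measurable_fun setT f -> (forall t, 0 <= f t) ->
  \int[@lebesgue_measure R]_t f (a * t + b)%R =
  (a^-1)%:E * \int[@lebesgue_measure R]_t f t.
Proof.
move=> a0 mf f0; have maff := measurable_affine a b.
have := @ge0_integral_pushforward _ _ RR RR R _ maff (@lebesgue_measure R) setT f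
  measurableT mf (fun t _ => f0 t).
rewrite preimage_setT => <-.
have ai : (0 <= a^-1)%R by rewrite invr_ge0 ltW.
rewrite -[(a^-1)%:E]/((NngNum ai)%:num%:E) -ge0_integral_mscale //.
by apply: eq_measure_integral => A mA _; exact: lebesgue_affine.
Qed.

Lemma Js_affine s F x (a : R) b : (0 < a)%R -> uniq s -> nice F ->
  Js s (F \o affmap s a b) x = ((a^-1) ^+ size s)%:E * Js s F x.
Proof.
move=> a0 us nF; elim: s us x => [|c s IH] /=.
  by move=> _ x; rewrite mul1e; congr F; apply/funext.
move=> /andP[cs us] x.
transitivity (J c (fun y => ((a^-1) ^+ size s)%:E * Js s F (upd y c (a * y c + b c))) x).
  apply: eq_integral => t _; rewrite -[in RHS]IH //; apply: Js_eq => y y' e1 e2 e3 /=.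
  congr F; apply/funext => e; rewrite /affmap inE.
  have [->|ec] := eqVneq e c.
    by rewrite (negbTE cs) e2 // e3 // /upd eqxx.
  rewrite /=; case: ifPn => es; first by rewrite e1.
  by rewrite e2 // e3 // /upd (negbTE ec).
rewrite /J.
transitivity (\int[@lebesgue_measure R]_t
    (((a^-1) ^+ size s)%:E * Js s F (upd x c (a * t + b c)))).
  apply: eq_integral => t _; congr (_ * Js s F _); apply/funext => e.
  by rewrite /upd; case: (e == c) => //; rewrite eqxx.
have nJ := nice_Js s nF.
rewrite (integral_affine (f := fun t => ((a^-1) ^+ size s)%:E * Js s F (upd x c t))) //.
- rewrite ge0_integralZl ?lee_fin ?exprn_ge0 ?invr_ge0 ?(ltW a0) //.
  + by rewrite muleA -EFinM exprS.
  + by apply: measurable_slice.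
  + by move=> t _; exact: nJ.2.
- by apply: measurable_funeM; exact: measurable_slice.
- by move=> t; rewrite mule_ge0 ?lee_fin ?exprn_ge0 ?invr_ge0 ?(ltW a0) //; exact: nJ.2.
Qed.

(** The integrand dominates [k] times the indicator of a cube of side [2e], which is integrated one
    side at a time. *)
Lemma Js_box s F x (k e : R) (z : K -> R) : (0 <= k)%R -> (0 < e)%R ->
  (forall y, 0 <= F y) ->
  (forall y : T, (forall c, c \in s -> (`|y c - z c| < e)%R) ->
    (forall c, c \notin s -> y c = x c) -> k%:E <= F y) ->
  (k * (e *+ 2) ^+ size s)%:E <= Js s F x.
Proof.
move=> k0 e0 F0; elim: s x => [|c s IH] x h /=.
  by rewrite expr0 mulr1; apply: h.
have ee : (0 <= e *+ 2)%R by rewrite mulrn_wge0 // ltW.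
have m0 : (0 <= k * (e *+ 2) ^+ size s)%R by rewrite mulr_ge0 // exprn_ge0.
have mB : @measurable _ RR [set` `]z c - e, z c + e[%R] by exact: measurable_itv.
have vol : \int[@lebesgue_measure R]_t ((k * (e *+ 2) ^+ size s)%:E *
     (\1_[set` `]z c - e, z c + e[%R] t)%:E) = (k * (e *+ 2) ^+ (size s).+1)%:E.
  rewrite ge0_integralZl //=; last first.
    by apply/measurable_EFinP; exact: measurable_indic.
  rewrite integral_indic // setIT.
  rewrite -[_ _ [set` _]]/(lebesgue_measure [set` `]z c - e, z c + e[%R]).
  rewrite lebesgue_measure_itv /= lte_fin.
  rewrite ltrBlDr -addrA ltrDl addr_gt0 // -EFinD -EFinM; congr _%:E.
  by rewrite opprB [(e - z c)%R]addrC addrACA subrr add0r exprSr mulrA mulr2n.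
rewrite -vol; apply: ge0_integral_mono => t.
  by rewrite mule_ge0 ?lee_fin.
rewrite indicE; case: (boolP (t \in _)) => [/set_mem|_] /=; last by rewrite mule0; apply: Js_ge0.
rewrite mule1 => ht; apply: IH => y h1 h2; apply: h => c'.
  rewrite inE; have [cs' _|cs'] := boolP (c' \in s); first exact: h1.
  rewrite orbF => /eqP cc; rewrite h2 // /upd cc eqxx.
  by move: ht => /=; rewrite in_itv /= => /andP[a1 a2]; rewrite ltr_distl a1 a2.
by rewrite inE negb_or => /andP[a1 a2]; rewrite h2 // /upd (negbTE a1).
Qed.

Lemma lebesgue_tuple_ge0 m (A : set (m.-tuple R)) : 0 <= lebesgue_tuple A.
Proof. by elim: m A => //= m IH A; apply: integral_ge0 => t _. Qed.

Lemma lebesgue_tupleE m (s : m.-tuple K) (A : set (m.-tuple R)) x : uniq s ->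
  lebesgue_tuple A = Js s (fun y => (\1_A (map_tuple y s))%:E) x.
Proof.
elim: m s A x => [|m IH] s A x us.
  by rewrite /= [s]tuple0 /= diracE indicE [map_tuple _ _]tuple0.
case/tupleP: s us => c s /= /andP[cs us]; apply: eq_integral => t _.
rewrite (IH s _ (upd x c t)) //; apply: Js_ext => y hy.
rewrite !indicE; congr (_%:R)%:E; congr (nat_of_bool _); apply/asbool_equiv_eq => /=.
suff -> : map_tuple y (cons_tuple c s) = cons_tuple t (map_tuple y s) by [].
by apply: val_inj => /=; rewrite hy // /upd eqxx.
Qed.

End Marginals.

(** * Measurable and convergent matrix functions *)

Section FunctionAlgebras.
Context {R : realType}.
Local Notation C := R[i].
Local Notation Re := (@complex.Re R).
Local Notation Im := (@complex.Im R).

Lemma ReM (x y : C) : Re (x * y) = Re x * Re y - Im x * Im y.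
Proof. by case: x; case: y. Qed.

Lemma ImM (x y : C) : Im (x * y) = Re x * Im y + Im x * Re y.
Proof. by case: x => a b; case: y => c d. Qed.

Lemma ReD (x y : C) : Re (x + y) = Re x + Re y.
Proof. by case: x; case: y. Qed.

Lemma ImD (x y : C) : Im (x + y) = Im x + Im y.
Proof. by case: x; case: y. Qed.

Lemma ReN (x : C) : Re (- x) = - Re x.
Proof. by case: x. Qed.

Lemma ImN (x : C) : Im (- x) = - Im x.
Proof. by case: x. Qed.

Lemma ReJ (x : C) : Re (Num.conj x) = Re x.
Proof. by case: x. Qed.

Lemma ImJ (x : C) : Im (Num.conj x) = - Im x.
Proof. by case: x. Qed.

Lemma complexP (x y : C) : Re x = Re y -> Im x = Im y -> x = y.
Proof. by case: x => a b; case: y => c d /= -> ->. Qed.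

Lemma complex_gt0 (x : C) : (0 < x) = (Im x == 0) && (0 < Re x).
Proof. by rewrite ltcE /= eq_sym. Qed.

(* Used both for measurability and for convergence along a filter: determinants,
   products and conjugates of matrices are then handled once. *)
Record function_algebra (T : Type) (Q : (T -> R) -> Prop) : Prop := FunctionAlgebra {
  falg_cst : forall a, Q (fun=> a) ;
  falg_opp : forall f, Q f -> Q (fun t => - f t) ;
  falg_add : forall f g, Q f -> Q g -> Q (fun t => f t + g t) ;
  falg_mul : forall f g, Q f -> Q g -> Q (fun t => f t * g t) }.

Section Closure.
Context {T : Type} {Q : (T -> R) -> Prop} (hQ : function_algebra Q).
Implicit Types f g : T -> C.

Definition complex_in f := Q (fun t => Re (f t)) /\ Q (fun t => Im (f t)).

Lemma complex_in_ext f g : (forall t, f t = g t) -> complex_in f -> complex_in g.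
Proof. by move=> /funext ->. Qed.

Lemma complex_in_cst a : complex_in (fun=> a).
Proof. by split; apply: falg_cst. Qed.

Lemma complex_in_add f g : complex_in f -> complex_in g -> complex_in (fun t => f t + g t).
Proof.
move=> [f1 f2] [g1 g2]; split.
  by under eq_fun do rewrite ReD; apply: falg_add.
by under eq_fun do rewrite ImD; apply: falg_add.
Qed.

Lemma complex_in_opp f : complex_in f -> complex_in (fun t => - f t).
Proof.
move=> [f1 f2]; split.
  by under eq_fun do rewrite ReN; apply: falg_opp.
by under eq_fun do rewrite ImN; apply: falg_opp.
Qed.

Lemma complex_in_mul f g : complex_in f -> complex_in g -> complex_in (fun t => f t * g t).
Proof.
move=> [f1 f2] [g1 g2]; split.
  under eq_fun do rewrite ReM; apply: falg_add => //; first exact: falg_mul.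
  by apply: falg_opp => //; exact: falg_mul.
under eq_fun do rewrite ImM; apply: falg_add => //; exact: falg_mul.
Qed.

Lemma complex_in_conj f : complex_in f -> complex_in (fun t => Num.conj (f t)).
Proof.
move=> [f1 f2]; split; first by under eq_fun do rewrite ReJ.
by under eq_fun do rewrite ImJ; apply: falg_opp.
Qed.

Lemma complex_in_sum (I : Type) (r : seq I) (P : pred I) (F : I -> T -> C) :
  (forall i, P i -> complex_in (F i)) -> complex_in (fun t => \sum_(i <- r | P i) F i t).
Proof.
move=> h; elim: r => [|i r IH].
  by under eq_fun do rewrite big_nil; exact: complex_in_cst.
under eq_fun do rewrite big_cons; case: (boolP (P i)) => [Pi|_]; last exact: IH.
by apply: complex_in_add => //; exact: h.
Qed.

Lemma complex_in_prod (I : Type) (r : seq I) (P : pred I) (F : I -> T -> C) :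
  (forall i, P i -> complex_in (F i)) -> complex_in (fun t => \prod_(i <- r | P i) F i t).
Proof.
move=> h; elim: r => [|i r IH].
  by under eq_fun do rewrite big_nil; exact: complex_in_cst.
under eq_fun do rewrite big_cons; case: (boolP (P i)) => [Pi|_]; last exact: IH.
by apply: complex_in_mul => //; exact: h.
Qed.

Definition matrix_in m n (A : T -> 'M[C]_(m, n)) :=
  forall i j, complex_in (fun t => A t i j).

Lemma matrix_in_cst m n (A : 'M[C]_(m, n)) : matrix_in (fun=> A).
Proof. by move=> i j; exact: complex_in_cst. Qed.

Lemma matrix_in_add m n (A B : T -> 'M[C]_(m, n)) :
  matrix_in A -> matrix_in B -> matrix_in (fun t => A t + B t).
Proof.
move=> hA hB i j; under eq_fun do rewrite mxE.
by apply: complex_in_add; [exact: hA|exact: hB].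
Qed.

Lemma matrix_in_opp m n (A : T -> 'M[C]_(m, n)) :
  matrix_in A -> matrix_in (fun t => - A t).
Proof. by move=> hA i j; under eq_fun do rewrite mxE; apply: complex_in_opp. Qed.

Lemma matrix_in_mul m n q (A : T -> 'M[C]_(m, n)) (B : T -> 'M[C]_(n, q)) :
  matrix_in A -> matrix_in B -> matrix_in (fun t => A t *m B t).
Proof.
move=> hA hB i j; under eq_fun do rewrite mxE.
by apply: complex_in_sum => k _; apply: complex_in_mul; [exact: hA|exact: hB].
Qed.

Lemma matrix_in_tr m n (A : T -> 'M[C]_(m, n)) :
  matrix_in A -> matrix_in (fun t => (A t)^T).
Proof. by move=> hA i j; under eq_fun do rewrite mxE; exact: hA. Qed.

Lemma matrix_in_trC m n (A : T -> 'M[C]_(m, n)) :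
  matrix_in A -> matrix_in (fun t => (A t)^H).
Proof.
move=> hA i j; under eq_fun do rewrite mxE mxE.
by apply: complex_in_conj; exact: hA.
Qed.

Lemma complex_in_det n (A : T -> 'M[C]_n) :
  matrix_in A -> complex_in (fun t => \det (A t)).
Proof.
move=> hA; rewrite /determinant.
apply: complex_in_sum => s _; apply: complex_in_mul; first exact: complex_in_cst.
by apply: complex_in_prod => i _; exact: hA.
Qed.

Lemma falg_pow (f : T -> R) n : Q f -> Q (fun t => f t ^+ n).
Proof.
move=> hf; elim: n => [|n IH]; first by under eq_fun do rewrite expr0; exact: falg_cst.
by under eq_fun do rewrite exprS; apply: falg_mul.
Qed.

End Closure.

Lemma hermitian_det_gt0 n (A : 'M[C]_n) : A^H = A ->
  (0 < \det A) = (0 < Re (\det A)).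
Proof.
move=> hA; rewrite complex_gt0; have /(congr1 Im) := det_trmxC A.
rewrite hA ImJ => h; have -> // : Im (\det A) == 0.
by rewrite -[_ == 0](mulrn_eq0 _ 2) mulr2n {1}h addNr.
Qed.

Lemma posdef_det_real n (A : 'M[C]_n) : posdef A -> \det A = (Re (\det A))%:C%C.
Proof.
move=> /posdef_det_gt0; rewrite complex_gt0 => /andP[/eqP h _].
exact: complexP.
Qed.

Lemma posdef_Re_det_gt0 n (A : 'M[C]_n) : posdef A -> 0 < Re (\det A).
Proof. by move=> /posdef_det_gt0; rewrite complex_gt0 => /andP[]. Qed.

Lemma drsub_hermitian n (A : 'M[C]_(1 + n)) : A^H = A ->
  (drsubmx A)^H = drsubmx A.
Proof. by move=> hA; rewrite -[in RHS]hA -map_drsubmx -trmx_drsub. Qed.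

Section MeasurableAlgebra.
Context d (T : measurableType d).

Lemma measurable_falg : function_algebra (fun f : T -> R => measurable_fun setT f).
Proof.
split=> [a|f mf|f g mf mg|f g mf mg]; first exact: measurable_cst.
- by have := @measurable_funN _ _ _ setT f mf.
- by apply: measurable_funD.
- by apply: measurable_funM.
Qed.

Lemma measurable_gt0 (f : T -> R) : measurable_fun setT f -> measurable [set t | 0 < f t].
Proof.
move=> mf; have -> : [set t | 0 < f t] = setT `&` f @^-1` `]0, +oo[%classic.
  by apply/seteqP; split=> t /=; rewrite in_itv /= andbT => // -[].
exact: mf.
Qed.

Lemma measurable_posdef n (A : T -> 'M[C]_n) :
  (forall t, (A t)^H = A t) ->
  matrix_in (Q := fun f : T -> R => measurable_fun setT f) A ->
  measurable [set t | posdef (A t)].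
Proof.
elim: n A => [|n IH] A hA mA.
  rewrite (_ : [set t | _] = setT); first exact: measurableT.
  apply/seteqP; split=> // t _ /=; split=> // v.
  by rewrite [v]flatmx0 eqxx.
pose D t := drsubmx (A t : 'M[C]_(1 + n)).
have -> : [set t | posdef (A t)] =
    [set t | posdef (D t)] `&` [set t | 0 < Re (\det (A t))].
  by apply/seteqP; split=> t /=; rewrite -hermitian_det_gt0 // =>
    /(posdef_sylvester (A := A t : 'M[C]_(1 + n)) (hA t)).
apply: measurableI; last first.
  by apply: measurable_gt0; exact: (complex_in_det measurable_falg mA).1.
apply: IH => [t|i j]; first exact: drsub_hermitian.
apply: (complex_in_ext (f := fun t => A t (rshift 1 i) (rshift 1 j))) => [t|].
  by rewrite /D !mxE.
exact: mA.
Qed.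

End MeasurableAlgebra.

Section ContinuousAlgebra.
Context {T : Type} (F : set_system T) {FF : Filter F} (t0 : T).

(** The limit is required to be the value at [t0], a point that need not be tied to [F]: on
    [option nat], the extra point [None] can hold the limit of a sequence. *)
Definition converges (f : T -> R) := f t @[t --> F] --> f t0.

Lemma converges_falg : function_algebra converges.
Proof.
split=> [a|f mf|f g mf mg|f g mf mg]; rewrite /converges; first exact: cvg_cst.
- exact: cvgN.
- exact: cvgD.
- exact: cvgM.
Qed.

Lemma converges_gt0 f : converges f -> 0 < f t0 -> \forall t \near F, 0 < f t.
Proof. by move=> hf f0; apply: (cvgr_gt _ hf). Qed.

Lemma near_posdef n (A : T -> 'M[C]_n) :
  (forall t, (A t)^H = A t) -> matrix_in (Q := converges) A ->
  posdef (A t0) -> \forall t \near F, posdef (A t).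
Proof.
elim: n A => [|n IH] A hA mA p0.
  by apply: nearW => t; split=> // v; rewrite [v]flatmx0 eqxx.
pose D t := drsubmx (A t : 'M[C]_(1 + n)).
have [pD det0] := (posdef_sylvester (A := A t0 : 'M[C]_(1 + n)) (hA t0)).1 p0.
have h1 : \forall t \near F, posdef (D t).
  apply: IH => // [t|i j]; first exact: drsub_hermitian.
  apply: (complex_in_ext (f := fun t => A t (rshift 1 i) (rshift 1 j))) => [t|].
    by rewrite /D !mxE.
  exact: mA.
have h2 : \forall t \near F, 0 < Re (\det (A t)).
  apply: converges_gt0; first exact: (complex_in_det converges_falg mA).1.
  by rewrite -hermitian_det_gt0.
near=> t; apply/(posdef_sylvester (A := A t : 'M[C]_(1 + n)) (hA t)).
rewrite hermitian_det_gt0 //; split; near: t; [exact: h1|exact: h2].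
Unshelve. all: by end_near. Qed.

Lemma converges_inv f : converges f -> f t0 != 0 -> converges (fun t => (f t)^-1).
Proof. by move=> hf f0; exact: cvgV. Qed.

End ContinuousAlgebra.

End FunctionAlgebras.

(** * Volumes of fibres *)

Section MatrixIntegrals.
Context {R : realType} {p : nat}.
Local Notation C := R[i].
Local Notation Re := (@complex.Re R).
Local Notation Im := (@complex.Im R).

(* Block number, row, column, and real (false) or imaginary (true) part. *)
Definition coord : choiceType := (nat * 'I_p * 'I_p * bool)%type.

(* Moments of all orders share one space, so that the first k moments of a point
   do not depend on n. *)
Definition point := g_sigma_algebraType (@cylinders R coord).
Implicit Types (x y : point) (G : 'M[C]_p -> \bar R).

Definition mat (m : nat) (x : point) : 'M[C]_p :=
  \matrix_(a, b) (x (m, a, b, false) +i* x (m, a, b, true))%C.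

Definition block_coords (m : nat) : seq coord :=
  [seq ((m, c.1.1, c.1.2, c.2) : coord) | c <- enum {: 'I_p * 'I_p * bool}].

Definition row_coords (m : nat) (k : 'I_p) : seq coord :=
  [seq ((m, k, c.1, c.2) : coord) | c <- enum {: 'I_p * bool}].

Lemma mem_block_coords m (c : coord) : (c \in block_coords m) = (c.1.1.1 == m).
Proof.
apply/mapP/eqP => [[e _ ->]//|]; case: c => [[[m' a] b] e] /= ->.
by exists (a, b, e); rewrite ?mem_enum.
Qed.

Lemma mem_row_coords m k (c : coord) :
  (c \in row_coords m k) = (c.1.1.1 == m) && (c.1.1.2 == k).
Proof.
apply/mapP/andP => [[e _ ->]//|]; case: c => [[[m' a] b] e] /= [/eqP -> /eqP ->].
by exists (b, e); rewrite ?mem_enum.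
Qed.

Lemma uniq_block_coords m : uniq (block_coords m).
Proof.
rewrite map_inj_uniq ?enum_uniq // => -[[a b] e] [[a' b'] e'] /=.
by case=> -> -> ->.
Qed.

Lemma uniq_row_coords m k : uniq (row_coords m k).
Proof.
by rewrite map_inj_uniq ?enum_uniq // => -[b e] [b' e'] /= [-> ->].
Qed.

Lemma size_row_coords m k : size (row_coords m k) = (p * 2)%N.
Proof. by rewrite size_map -cardE card_prod card_ord card_bool. Qed.

Lemma perm_block_coords m k :
  perm_eq (block_coords m)
    ([seq c : coord <- block_coords m | c.1.1.2 != k] ++ row_coords m k).
Proof.
apply: uniq_perm; first exact: uniq_block_coords.
  rewrite cat_uniq filter_uniq ?uniq_block_coords // uniq_row_coords andbT /=.
  apply/hasPn => c; rewrite mem_row_coords mem_filter => /andP[_ /eqP ->].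
  by rewrite eqxx.
move=> c; rewrite mem_cat mem_filter mem_block_coords mem_row_coords.
by case: (_ == m); rewrite ?andbF ?andbT //=; case: eqP.
Qed.

Lemma mat_in (Q : (point -> R) -> Prop) m :
  (forall c : coord, c.1.1.1 = m -> Q (fun x => x c)) -> matrix_in (Q := Q) (mat m).
Proof.
move=> hQ a b; apply: (complex_in_ext
  (f := fun x : point => (x (m, a, b, false) +i* x (m, a, b, true))%C)) => [x|].
  by rewrite mxE.
by split; apply: hQ.
Qed.

Notation Qm := (fun f : point -> R => measurable_fun setT f).

Lemma measurable_mat m : matrix_in (Q := Qm) (mat m).
Proof. by apply: mat_in => c _; exact: measurable_coord. Qed.

Definition put (m : nat) (X : 'M[C]_p) (y : point) : point := fun c =>
  if c.1.1.1 == m then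
    (if c.2 then Im (X c.1.1.2 c.1.2) else Re (X c.1.1.2 c.1.2)) else y c.

Lemma mat_put m X y : mat m (put m X y) = X.
Proof. by apply/matrixP => a b; rewrite mxE /put /= eqxx; case: (X a b). Qed.

(** Measurability of a function of a matrix is read on real coordinates, by pulling back along
    [mat m]. *)
Definition nicemx m G := nice (fun x => G (mat m x)).

Lemma nice_mat_comp m G (A : point -> 'M[C]_p) :
  nicemx m G -> matrix_in (Q := Qm) A -> nice (fun x => G (A x)).
Proof.
move=> [mG G0] mA; split; last by move=> x; rewrite -(mat_put m (A x) x) G0.
have -> : (fun x => G (A x)) = (fun x => G (mat m x)) \o (fun x => put m (A x) x).
  by apply/funext => x /=; rewrite mat_put.
apply: (measurableT_comp mG); apply: measurable_pt => c; rewrite /put.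
case: (c.1.1.1 == m); last exact: measurable_coord.
by case: (c.2); [exact: (mA _ _).2|exact: (mA _ _).1].
Qed.

Definition IM m G x := Js (block_coords m) (fun y => G (mat m y)) x.

Lemma IM_const m G x x' : IM m G x = IM m G x'.
Proof.
apply: Js_eq => y y' h _ _; congr (G _); apply/matrixP => a b.
by rewrite !mxE !h // mem_block_coords.
Qed.

Lemma IM_ge0 m G x : (forall X, (0 <= G X)%E) -> (0 <= IM m G x)%E.
Proof. by move=> G0; apply: Js_ge0 => y. Qed.

Lemma IM_translate m G x (N : 'M[C]_p) : nicemx m G ->
  IM m (fun X => G (X - N)) x = IM m G x.
Proof.
move=> nG; pose b (c : coord) : R :=
  if c.2 then - Im (N c.1.1.2 c.1.2) else - Re (N c.1.1.2 c.1.2).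
rewrite /IM -[RHS]mul1e.
have := @Js_affine R coord (block_coords m) _ x 1 b ltr01 (uniq_block_coords m) nG.
rewrite invr1 expr1n => <-; apply: Js_ext => y _ /=; congr (G _).
apply/matrixP => i j; rewrite !mxE /affmap !mem_block_coords /= eqxx !mul1r.
by rewrite /b /=; case: (N i j).
Qed.

Lemma IM_set_row_id m G x (k : 'I_p) (w : 'rV[C]_p) (t : R) : 0 < t ->
  w 0 k = t%:C%C -> nicemx m G ->
  IM m (fun X => G (set_row_id k w *m X)) x =
  ((t^-1 ^+ (p * 2))%:E * IM m G x)%E.
Proof.
move=> t0 wk nG.
have nG' : nicemx m (fun X => G (set_row_id k w *m X)).
  apply: (nice_mat_comp nG); apply: (matrix_in_mul (measurable_falg point)).
    exact: (matrix_in_cst (measurable_falg point)).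
  exact: measurable_mat.
(* The coordinates of row [k] are moved to the innermost integrals, where the other rows are
   frozen. *)
rewrite /IM !(Js_perm _ (perm_block_coords m k)) // !Js_cat.
rewrite -Js_scale ?lee_fin ?exprn_ge0 ?invr_ge0 ?(ltW t0) //; last exact: nice_Js.
apply: Js_ext => y _.
pose rest (a : 'I_p) : C := \sum_(v < p | v != k) w 0 v * mat m y v a.
pose b (c : coord) : R := if c.2 then Im (rest c.1.2) else Re (rest c.1.2).
have := @Js_affine R coord (row_coords m k) _ y t b t0 (uniq_row_coords m k) nG.
rewrite size_row_coords => <-; apply: Js_ext => z hz /=; congr (G _).
apply/matrixP => i j; rewrite !mxE /affmap !mem_row_coords /= eqxx /=.
have [->|ik] := eqVneq i k; last first.
  rewrite (bigD1 i) //= big1 ?addr0; last first.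
    by move=> v vi; rewrite mxE (negbTE ik) eq_sym (negbTE vi) mul0r.
  by rewrite !mxE (negbTE ik) eqxx mul1r.
rewrite (bigD1 k) //= mxE eqxx wk.
rewrite [X in _ + X = _](_ : _ = rest j); last first.
  apply: eq_bigr => v vk; rewrite !mxE eqxx; congr (_ * _).
  by rewrite !hz // mem_row_coords /= (negbTE vk) andbF.
rewrite /b /= mxE; apply: complexP.
  by rewrite ReD ReM /= mul0r subr0.
by rewrite ImD ImM /= mul0r addr0.
Qed.

(** The real Jacobian of left multiplication by [B] is $|\det B|^{2p}$; it is multiplicative along
    the row operations, whose determinants are positive. *)
Lemma IM_rowprod m G x (B : 'M[C]_p) : rowprod B -> nicemx m G ->
  IM m (fun X => G (B *m X)) x = (((Re (\det B))^-1 ^+ (p * 2))%:E * IM m G x)%E.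
Proof.
move=> rB; elim: rB G => [|k w {}B w0 hw rB IH] G nG.
  rewrite det1 /= invr1 expr1n mul1e.
  by apply: Js_ext => y _; rewrite mul1mx.
have := w0; rewrite complex_gt0 => /andP[/eqP wI wR].
have wk : w 0 k = (Re (w 0 k))%:C%C by exact: complexP.
have nG' : nicemx m (fun X => G (set_row_id k w *m X)).
  apply: (nice_mat_comp nG); apply: (matrix_in_mul (measurable_falg point)).
    exact: (matrix_in_cst (measurable_falg point)).
  exact: measurable_mat.
transitivity (IM m (fun X => G (set_row_id k w *m (B *m X))) x).
  by apply: Js_ext => y _; rewrite mulmxA.
rewrite (IH (fun X => G (set_row_id k w *m X))) // (IM_set_row_id x wR wk nG).
rewrite muleA -EFinM; congr (_%:E * _)%E.
rewrite -exprMn -invfM det_mulmx det_set_row_id // ReM wI mul0r subr0.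
by rewrite mulrC.
Qed.

Definition swap_coord (c : coord) : coord := (c.1.1.1, c.1.2, c.1.1.2, c.2).

Lemma swap_coordK : involutive swap_coord.
Proof. by move=> [[[m a] b] e]. Qed.

Lemma Js_swap s (F : point -> \bar R) x :
  Js s (fun y => F (y \o swap_coord)) x = Js (map swap_coord s) F (x \o swap_coord).
Proof.
elim: s x => //= c s IH x; apply: eq_integral => t _.
rewrite IH; congr (Js _ F _); apply/funext => e; rewrite /upd /=.
by rewrite -(inj_eq (inv_inj swap_coordK)) swap_coordK.
Qed.

(** Transposition only permutes the real coordinates, so right multiplications reduce to left
    ones. *)
Lemma IM_tr m G x : nicemx m G -> IM m (fun X => G X^T) x = IM m G x.
Proof.
move=> nG; rewrite -(IM_const m G (x \o swap_coord)) /IM.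
transitivity (Js (block_coords m) (fun y => G (mat m (y \o swap_coord))) x).
  by apply: Js_ext => y _; congr (G _); apply/matrixP => a b; rewrite !mxE.
rewrite (Js_swap _ (fun y => G (mat m y))); congr (_ _); apply: Js_perm => //.
apply: uniq_perm; rewrite ?uniq_block_coords //.
  by rewrite map_inj_uniq ?uniq_block_coords //; exact: inv_inj swap_coordK.
move=> c; rewrite -{1}(swap_coordK c) mem_map; last exact: inv_inj swap_coordK.
by rewrite !mem_block_coords.
Qed.

Lemma rowprod_conj (B : 'M[C]_p) : rowprod B -> rowprod (map_mx Num.conj B).
Proof.
elim=> [|k w {}B w0 hw rB IH]; first by rewrite map_mx1; exact: Rowprod1.
rewrite map_mxM.
have -> : map_mx Num.conj (set_row_id k w) = set_row_id k (map_mx Num.conj w).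
  by apply/matrixP => i j; rewrite !mxE; case: ifP; rewrite ?mxE // conjC_nat.
apply: RowprodM => //; first by rewrite mxE complex_gt0 ImJ ReJ oppr_eq0 -complex_gt0.
by move=> v kv; rewrite mxE hw // conjC0.
Qed.

Lemma IM_rowprod_r m G x (B : 'M[C]_p) : rowprod B -> nicemx m G ->
  IM m (fun X => G (X *m B^H)) x = (((Re (\det B))^-1 ^+ (p * 2))%:E * IM m G x)%E.
Proof.
move=> rB nG.
have nT : nicemx m (fun X => G X^T).
  by apply: (nice_mat_comp nG); apply: matrix_in_tr; exact: measurable_mat.
have := IM_rowprod x (rowprod_conj rB) nT.
rewrite IM_tr // det_map_mx ReJ => <-.
rewrite -[RHS]IM_tr; last first.
  apply: (nice_mat_comp nT); apply: (matrix_in_mul (measurable_falg point)).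
    exact: (matrix_in_cst (measurable_falg point)).
  exact: measurable_mat.
apply: Js_ext => y _; congr (G _).
by rewrite trmx_mul trmxK map_trmx.
Qed.

End MatrixIntegrals.

Lemma measurable_invr (R : realType) : measurable_fun setT (fun t : R => t^-1).
Proof.
have -> : [set: R] = [set 0] `|` ~` [set 0] by rewrite setUv.
have o : open (~` [set (0 : R)]) by apply: closed_openC; exact: closed_eq.
apply/measurable_funU; [exact: measurable_set1|exact: open_measurable|split].
  exact: measurable_fun_set1.
apply: open_continuous_measurable_fun => // t; rewrite inE /= => /eqP t0.
exact: inv_continuous.
Qed.

(** * Toeplitz positivity as a property of points *)

Section ToeplitzPoints.
Context {R : realType} {p : nat}.
Local Notation C := R[i].
Local Notation Re := (@complex.Re R).
Local Notation Im := (@complex.Im R).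
Local Notation point := (@point R p).
Implicit Types (x y : point).

(** Blocks are counted from 0: block [m] stores $\Gamma_{m+1}$, and [Negz m] stands for $-(m+1)$. *)
Definition gam x (j : int) : 'M[C]_p :=
  match j with
  | Posz 0 => 1%:M
  | Posz m.+1 => mat m x
  | Negz m => (mat m x)^H
  end.

Lemma gam_herm x : hermseq (gam x).
Proof.
split=> // -[[|m]|m]; [by rewrite /= trmxC1| by []|].
by rewrite /= trmxCK.
Qed.

Lemma gam_eq m x y : (forall c : coord, (c.1.1.1 < m)%N -> x c = y c) ->
  forall j : int, (absz j <= m)%N -> gam x j = gam y j.
Proof.
move=> h; have hm k : (k < m)%N -> mat k x = mat k y.
  by move=> km; apply/matrixP => a b; rewrite !mxE !h.
by case=> [[|k]|k] //= km; rewrite hm.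
Qed.

Lemma gam_in (Q : (point -> R) -> Prop) m : function_algebra Q ->
  (forall c : coord, (c.1.1.1 < m)%N -> Q (fun x => x c)) ->
  forall j : int, (absz j <= m)%N -> matrix_in (Q := Q) (fun x => gam x j).
Proof.
move=> hQ h; have hm k : (k < m)%N -> matrix_in (Q := Q) (mat k).
  by move=> km; apply: mat_in => c ck; apply: h; rewrite ck.
case=> [[|k]|k] km /=; first exact: matrix_in_cst.
  exact: hm.
by apply: matrix_in_trC => //; exact: hm.
Qed.

Lemma tz_in (Q : (point -> R) -> Prop) m : function_algebra Q ->
  (forall c : coord, (c.1.1.1 < m)%N -> Q (fun x => x c)) ->
  matrix_in (Q := Q) (fun x => tz (gam x) m.+1).
Proof.
move=> hQ h a b; pose i := tagnat.sig1 a; pose j := tagnat.sig1 b.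
apply: (complex_in_ext
  (f := fun x => gam x (j%:Z - i%:Z) (tagnat.sig2 a) (tagnat.sig2 b))) => [x|].
  by rewrite /tz mxE.
apply: (gam_in hQ h); have := ltn_ord i; have := ltn_ord j; lia.
Qed.

(** $T_m>0$: the first [m] moments of [x] are interior. *)
Definition Opos m x := posdef (tz (gam x) m.+1).
Definition detT m x : R := Re (\det (tz (gam x) m)).
(** A quotient of real parts of Toeplitz determinants, hence a measurable real function on all
    points; it agrees with $\det L_m$ where [Opos m] holds. *)
Definition detL m x : R := detT m.+1 x / detT m x.

Lemma Opos0 x : Opos 0 x.
Proof.
apply/tz_posdefS; first exact: gam_herm.
split; first exact: tz0_posdef.
by have [-> _ _] := tz_initial (gam x); exact: posdef1.
Qed.

Lemma OposW m x : Opos m.+1 x -> Opos m x.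
Proof. by move=> /(tz_posdefS (gam_herm x))[]. Qed.

Lemma Opos_leq k m x : (k <= m)%N -> Opos m x -> Opos k x.
Proof.
move=> km; rewrite -(subnK km); elim: (m - k)%N => // d IH /OposW; exact: IH.
Qed.

Lemma Opos_tz m x : Opos m x -> posdef (tz (gam x) m).
Proof. by move=> /(tz_posdefS (gam_herm x))[]. Qed.

Lemma tzL_posdef m x : Opos m x -> posdef (tzL (gam x) m).
Proof. by move=> /(tz_posdefS (gam_herm x))[]. Qed.

Lemma detLE m x : Opos m x -> (detL m x)%:C%C = \det (tzL (gam x) m).
Proof.
move=> O; have pT := Opos_tz O; have d0 := posdef_Re_det_gt0 pT.
have := tz_detS (gam_herm x) pT.
rewrite (posdef_det_real O) (posdef_det_real pT) (posdef_det_real (tzL_posdef O)).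
rewrite -rmorphM => /complexI; rewrite /detL /detT => ->.
by rewrite mulrAC divff ?mul1r // gt_eqF.
Qed.

Lemma detL_gt0 m x : Opos m x -> 0 < detL m x.
Proof.
move=> O; apply: divr_gt0; first exact: posdef_Re_det_gt0 O.
exact: posdef_Re_det_gt0 (Opos_tz O).
Qed.

Lemma detL0 x : detL 0 x = 1.
Proof.
have := detLE (Opos0 x); have [-> _ _] := tz_initial (gam x).
by rewrite det1 => /complexI.
Qed.

Lemma Opos_eq m x y : (forall c : coord, (c.1.1.1 < m)%N -> x c = y c) ->
  Opos m x = Opos m y.
Proof. by move=> /gam_eq/tz_ext[e _ _ _]; rewrite /Opos e. Qed.

Lemma detL_eq m x y : (forall c : coord, (c.1.1.1 < m)%N -> x c = y c) ->
  detL m x = detL m y.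
Proof.
move=> /gam_eq h; have [e _ _ _] := tz_ext h; rewrite /detL /detT e; congr (_ / _).
congr (Re (\det _)); apply: eq_mxblock => i j; apply: h.
by have := ltn_ord i; have := ltn_ord j; lia.
Qed.

Lemma measurable_Opos m : measurable [set x | Opos m x].
Proof.
apply: measurable_posdef => [x|]; first by apply: tz_herm; exact: gam_herm.
by apply: tz_in => [|c _]; [exact: measurable_falg|exact: measurable_coord].
Qed.

Lemma measurable_detT m : measurable_fun setT (detT m : point -> R).
Proof.
case: m => [|m].
  rewrite (_ : detT 0 = cst 1); first exact: measurable_cst.
  by apply/funext => x; rewrite /detT tz0_det.
refine (complex_in_det (measurable_falg point) _).1.
by apply: tz_in => [|c _]; [exact: measurable_falg|exact: measurable_coord].
Qed.

Lemma measurable_detL m : measurable_fun setT (detL m : point -> R).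
Proof.
apply: measurable_funM; first exact: measurable_detT.
by apply: (measurableT_comp (@measurable_invr R)); exact: measurable_detT.
Qed.

(** [B], [D] and [N] are fixed by the first [m] moments, so they are constants when block [m] is
    integrated over the fibre above them. *)
Lemma Opos_next m x : Opos m x -> exists B D N : 'M[C]_p,
  [/\ rowprod B, rowprod D,
      (Re (\det B))^-1 ^+ 2 = detL m x, (Re (\det D))^-1 ^+ 2 = detL m x &
      forall y, (forall c : coord, (c.1.1.1 < m)%N -> y c = x c) ->
        let A := B *m (mat m y - N) *m D^H in
        (Opos m.+1 y <-> posdef (1%:M - A *m A^H)) /\
        (Opos m.+1 y -> detL m.+1 y = detL m x * Re (\det (1%:M - A *m A^H)))].
Proof.
move=> O; have [B [D [rB rD dB dD h]]] := tz_next (gam_herm x) O.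
have rp (E : 'M[C]_p) : rowprod E -> (\det E)^-1 ^+ 2 = \det (tzL (gam x) m) ->
    (Re (\det E))^-1 ^+ 2 = detL m x.
  move=> rE; have := rowprod_det_gt0 rE; rewrite complex_gt0 => /andP[/eqP i0 r0].
  have -> : \det E = (Re (\det E))%:C%C by exact: complexP.
  rewrite -(detLE O) -fmorphV -rmorphXn => /complexI.
  exact.
exists B, D, (tzM (gam x) m); split.
- exact: rB.
- exact: rD.
- exact: rp rB dB.
- exact: rp rD dD.
move=> y yx A; have [posE detE] := h (gam y) (gam_herm y) (gam_eq yx).
split; first exact: posE.
move=> Oy; suff: (detL m.+1 y)%:C%C =
    (detL m x)%:C%C * (Re (\det (1%:M - A *m A^H)))%:C%C.
  by rewrite -rmorphM => /complexI.
by rewrite (detLE Oy) (detLE O) -(posdef_det_real (posE.1 Oy)) -detE.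
Qed.

End ToeplitzPoints.

Section FibreVolume.
Context {R : realType} {p : nat}.
Local Notation C := R[i].
Local Notation Re := (@complex.Re R).
Local Notation point := (@point R p).
Local Open Scope ereal_scope.
Implicit Types (x y : point).

Lemma nice_if (D : set point) (f : point -> R) : measurable D ->
  measurable_fun setT f -> (forall x, D x -> (0 <= f x)%R) ->
  nice (fun x => if `[<D x>] then (f x)%:E else 0).
Proof.
move=> mD mf f0; split; last by move=> x; case: asboolP => // Dx; rewrite lee_fin f0.
apply: measurable_fun_ifT.
- apply: (measurable_fun_bool true); rewrite setTI.
  rewrite (_ : _ @^-1` _ = D) //.
  by apply/seteqP; split=> x /=; [move/asboolP|move=> ?; apply/asboolP].
- exact/measurable_EFinP.
- exact: measurable_cst.
Qed.

Definition ballw (A : 'M[C]_p) : R := Re (\det (1%:M - A *m A^H)%R).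

Definition ball_density (s : nat) (A : 'M[C]_p) : \bar R :=
  if `[<posdef (1%:M - A *m A^H)%R>] then (ballw A ^+ s)%:E else 0.

Definition dens (m s : nat) x : \bar R :=
  if `[<Opos m x>] then (detL m x ^+ s)%:E else 0.

Lemma sub_adj_herm (A : 'M[C]_p) : (1%:M - A *m A^H)%R^H = (1%:M - A *m A^H)%R.
Proof. by rewrite trmxC_sub trmxC1 trmxC_mul trmxCK. Qed.

Lemma nice_ball_density m s : nicemx m (ball_density s).
Proof.
have mA : matrix_in (Q := fun f : point -> R => measurable_fun setT f)
    (fun x => 1%:M - mat m x *m (mat m x)^H)%R.
  apply: (matrix_in_add (measurable_falg point)).
    exact: (matrix_in_cst (measurable_falg point)).
  apply: (matrix_in_opp (measurable_falg point)).
  apply: (matrix_in_mul (measurable_falg point)); first exact: measurable_mat.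
  apply: (matrix_in_trC (measurable_falg point)); exact: measurable_mat.
apply: (@nice_if [set x | posdef (1%:M - mat m x *m (mat m x)^H)%R]
  (fun x => ballw (mat m x) ^+ s)%R).
- by apply: measurable_posdef => // x; exact: sub_adj_herm.
- apply: (falg_pow (measurable_falg point)).
  exact: (complex_in_det (measurable_falg point) mA).1.
- move=> x /= pA; rewrite exprn_ge0 // ltW //; exact: posdef_Re_det_gt0 pA.
Qed.

Lemma ball_density_ge0 s A : 0 <= ball_density s A.
Proof.
rewrite -(mat_put 0 A ((fun=> 0%R) : point)).
exact: (nice_ball_density 0 s).2.
Qed.

Lemma nice_dens m s : nice (dens m s).
Proof.
apply: (@nice_if [set x | Opos m x] (fun x => detL m x ^+ s)%R).
- exact: measurable_Opos.
- by apply: (falg_pow (measurable_falg point)); exact: measurable_detL.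
- by move=> x O; rewrite exprn_ge0 // ltW //; exact: detL_gt0 O.
Qed.

Lemma dens_step m s x : Js (block_coords m) (dens m.+1 s) x =
  IM m (ball_density s) x * dens m (s + p * 2)%N x.
Proof.
rewrite [in RHS]/dens; case: asboolP => O; last first.
  rewrite mule0 -[RHS](@Js0 R coord (block_coords m) x); apply: Js_ext => y hy.
  rewrite /dens; case: asboolP => [hO|_]; last by [].
  case: O.
  suff -> : Opos m x = Opos m y by exact: OposW hO.
  apply/esym/Opos_eq => c cm; apply: hy.
  by rewrite mem_block_coords ltn_eqF.
have [B [D [N [rB rD dB dD h]]]] := Opos_next O.
pose G1 X := ball_density s (X *m D^H).
pose G2 X := ball_density s (B *m X *m D^H).
have nG1 : nicemx m G1.
  apply: (nice_mat_comp (nice_ball_density m s)).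
  apply: (matrix_in_mul (measurable_falg point)); first exact: measurable_mat.
  exact: (matrix_in_cst (measurable_falg point)).
have nG2 : nicemx m G2.
  apply: (nice_mat_comp nG1).
  apply: (matrix_in_mul (measurable_falg point)); last exact: measurable_mat.
  exact: (matrix_in_cst (measurable_falg point)).
have d0 := detL_gt0 O.
transitivity ((detL m x ^+ s)%:E * IM m (fun X => G2 (X - N)%R) x).
  rewrite -Js_scale; last 2 first.
  - apply: (nice_mat_comp nG2).
    apply: (matrix_in_add (measurable_falg point)); first exact: measurable_mat.
    exact: (matrix_in_cst (measurable_falg point)).
  - by rewrite lee_fin exprn_ge0 // ltW.
  apply: Js_ext => y hy.
  have {}hy : forall c : coord, (c.1.1.1 < m)%N -> y c = x c.
    by move=> c cm; apply: hy; rewrite mem_block_coords ltn_eqF.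
  have [posE detE] := h y hy; rewrite /dens /G2 /ball_density.
  case: asboolP => O1; case: asboolP => O2; last by rewrite mule0.
  - by rewrite (detE O1) exprMn EFinM.
  - by case: O2; exact: (posE.1 O1).
  - by case: O1; exact: (posE.2 O2).
have e1 : IM m (fun X => G2 (X - N)%R) x = IM m G2 x by exact: IM_translate.
have e2 : IM m G2 x = ((Re (\det B))^-1 ^+ (p * 2))%:E * IM m G1 x.
  exact: IM_rowprod.
have e3 : IM m G1 x =
    ((Re (\det D))^-1 ^+ (p * 2))%:E * IM m (ball_density s) x.
  exact: (IM_rowprod_r x rD (nice_ball_density m s)).
transitivity ((detL m x ^+ s)%:E * (((Re (\det B))^-1 ^+ (p * 2))%:E *
    (((Re (\det D))^-1 ^+ (p * 2))%:E * IM m (ball_density s) x))).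
  congr (_ * _); apply: (etrans e1); apply: (etrans e2); congr (_ * _).
  exact: e3.
rewrite !muleA -!EFinM muleC; congr (_ * _%:E).
(* Each side contributes [detL m x ^+ p], since the inverse determinant of either factor has square
   [detL m x]. *)
rewrite [(p * 2)%N]mulnC !exprM dB dD -!exprD.
by congr (_ ^+ _)%R; lia.
Qed.

(** Blocks [k] to [k + d - 1], the last one innermost, so that the highest moment is integrated
    first. *)
Fixpoint fib (k d : nat) : seq (@coord p) :=
  if d is d'.+1 then fib k d' ++ block_coords (k + d')%N else [::].

Lemma mem_fib k d (c : coord) : (c \in fib k d) = (k <= c.1.1.1 < k + d)%N.
Proof.
elim: d => [|d IH] /=; first by rewrite in_nil addn0; lia.
rewrite mem_cat IH mem_block_coords addnS ltnS [(c.1.1.1 <= k + d)%N]leq_eqVlt.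
have [->|_] := eqVneq c.1.1.1 (k + d)%N; rewrite ?orbF //=.
by rewrite orbT leq_addr.
Qed.

Lemma uniq_fib k d : uniq (fib k d).
Proof.
elim: d => //= d IH; rewrite cat_uniq IH uniq_block_coords andbT.
apply/hasPn => c; rewrite mem_block_coords => /eqP h.
by rewrite mem_fib h ltnn andbF.
Qed.

Lemma fib_cat k d : fib 0 (k + d)%N = fib 0 k ++ fib k d.
Proof.
elim: d => [|d IH]; first by rewrite addn0 cats0.
by rewrite addnS /= IH add0n catA.
Qed.

(* Integrating out the last d moments of the domain of positivity leaves a
   power of det L_k. *)
Lemma dens_fib k d s : exists2 c : \bar R, 0 <= c &
  forall x, Js (fib k d) (dens (k + d)%N s) x = c * dens k (s + d * (p * 2))%N x.
Proof.
elim: d s => [|d IH] s.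
  by exists 1 => // x; rewrite mul0n !addn0 mul1e.
pose x0 : point := fun=> 0%R.
have [c c0 hc] := IH (s + p * 2)%N; exists (IM (k + d)%N (ball_density s) x0 * c).
  by rewrite mule_ge0 //; apply: IM_ge0 => X; exact: ball_density_ge0.
move=> x; rewrite addnS /= Js_cat.
transitivity (Js (fib k d) (fun y => IM (k + d)%N (ball_density s) x0 *
    dens (k + d)%N (s + p * 2)%N y) x).
  by apply: Js_ext => y _; rewrite dens_step; congr (_ * _); exact: IM_const.
rewrite Js_scale ?hc; last 2 first.
- exact: nice_dens.
- by apply: IM_ge0 => X; exact: ball_density_ge0.
by rewrite muleA; congr (_ * dens _ _ _); lia.
Qed.

End FibreVolume.

(** * Moments and positive Toeplitz matrices *)

Section ChargeRiemannSums.
Context {R : realType}.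
Local Notation RR := (measurableTypeR R).
Implicit Types (f : RR -> R) (nu : {charge set RR -> \bar R}).

Lemma bounded_integrable (m : {finite_measure set RR -> \bar R}) (D : set RR) f (c : R) :
  measurable D -> measurable_fun setT f -> (forall x, `|f x| <= c) ->
  m.-integrable D (EFin \o f).
Proof.
move=> mD mf fc; apply/integrableP; split.
  by apply/measurable_EFinP; exact: measurable_funTS.
have mDfin : (m D < +oo)%E by rewrite -ge0_fin_numE // fin_num_measure.
apply: (@le_lt_trans _ _ (\int[m]_(x in D) c%:E)%E); last first.
  by rewrite integral_cst // lte_mul_pinfty // lee_fin (le_trans _ (fc 0)).
apply: ge0_le_integral => //.
- apply: measurableT_comp => //; apply/measurable_EFinP; exact: measurable_funTS.
- by move=> x _ /=; rewrite lee_fin.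
Qed.

(** On each cell [f] stays within [delta] of the sample value, and the errors add up over disjoint
    cells. *)
Lemma measure_cells (m : {finite_measure set RR -> \bar R}) f (c delta : R)
    (E : nat -> set RR) (theta : nat -> R) K :
  measurable_fun setT f -> (forall x, `|f x| <= c) ->
  (forall l, measurable (E l)) -> trivIset setT E ->
  (forall l x, E l x -> `|f x - theta l| <= delta) ->
  `|\int[m]_(x in \big[setU/set0]_(l < K) E l) f x -
    \sum_(l < K) theta l * fine (m (E l))| <=
  delta * fine (m (\big[setU/set0]_(l < K) E l)).
Proof.
move=> mf fc mE tE h; elim: K => [|K IH].
  by rewrite !big_ord0 Rintegral_set0 measure0 mulr0 subrr normr0.
have mU : measurable (\big[setU/set0]_(l < K) E l) by apply: bigsetU_measurable.
have dis : \big[setU/set0]_(l < K) E l `&` E K = set0.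
  rewrite big_distrl /= big1 // => l _.
  apply: contrapT => /eqP/set0P h'; have := tE l K I I h'.
  by move=> lK; move: (ltn_ord l); rewrite {1}lK ltnn.
rewrite !big_ord_recr /=.
have mint D : measurable D -> m.-integrable D (EFin \o f).
  by move=> mD; exact: (bounded_integrable m mD mf fc).
rewrite Rintegral_setU //; last 2 first.
- by apply: mint; exact: measurableU.
- by apply/disj_setPS; rewrite dis.
rewrite measureU // fineD ?fin_num_measure // mulrDr opprD addrACA.
apply: le_trans (ler_normD _ _) _; apply: lerD => //.
rewrite -Rintegral_cst // -RintegralB //; last 2 first.
- exact: mint.
- by apply: (@bounded_integrable _ _ _ `|theta K|).
apply: le_trans (le_normr_Rintegral _ _) _ => //.
  apply: (@bounded_integrable _ _ _ (c + `|theta K|)) => //.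
    by apply: measurable_funB.
  by move=> x; apply: le_trans (ler_normB _ _) _; rewrite lerD2r.
rewrite -Rintegral_cst //; apply: le_Rintegral => //.
- apply: (@bounded_integrable _ _ _ (c + `|theta K|)) => //.
    by apply: measurableT_comp => //; apply: measurable_funB.
  by move=> x; rewrite normr_id; apply: le_trans (ler_normB _ _) _; rewrite lerD2r.
- by apply: (@bounded_integrable _ _ _ `|delta|).
- by move=> x; exact: h.
Qed.

(** Half-open cells of length $1/(M+1)$ counted from $-\pi$, cut down to [angles]; [cell_count] is
    large enough for them to cover the interval of length $2\pi$. *)
Definition cell (M l : nat) : set RR :=
  angles `&` [set x | l%:R <= M.+1%:R * (x + pi) < l.+1%:R].
Definition cell_point (M l : nat) : R := l%:R / M.+1%:R - pi.
Definition cell_count (M : nat) : nat := (Num.truncn (M.+1%:R * (pi + pi) : R)).+1.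

Lemma measurable_cell M l : measurable (cell M l).
Proof.
apply: measurableI; first exact: measurable_itv.
rewrite (_ : [set x | _] = [set` `[(l%:R / M.+1%:R - pi : R), l.+1%:R / M.+1%:R - pi[]).
  exact: measurable_itv.
apply/seteqP; split=> x /=; rewrite in_itv /= lerBlDr ltrBrDr;
  by rewrite ler_pdivrMr ?ltr_pdivlMr ?ltr0n // ![_ * M.+1%:R]mulrC.
Qed.

Lemma trivIset_cell M : trivIset setT (cell M).
Proof.
move=> l l' _ _ [x [[_ /= /andP[h1 h2]] [_ /= /andP[h3 h4]]]].
have := le_lt_trans h1 h4; have := le_lt_trans h3 h2; rewrite !ltr_nat !ltnS.
by move=> a b; apply/eqP; rewrite eqn_leq a b.
Qed.

Lemma bigsetU_cell M : \big[setU/set0]_(l < cell_count M) cell M l = angles.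
Proof.
apply/seteqP; split=> [x|x ax].
  by rewrite -bigcup_mkord => -[l _ []].
rewrite -bigcup_mkord; move: (ax); rewrite /angles /= in_itv /= => /andP[h1 h2].
have x0 : 0 <= M.+1%:R * (x + pi) by rewrite mulr_ge0 // -lerBlDr sub0r ltW.
exists (Num.truncn (M.+1%:R * (x + pi))) => /=.
  rewrite ltnS truncn_ge_nat; last by rewrite mulr_ge0 // addr_ge0 // pi_ge0.
  apply: le_trans (_ : M.+1%:R * (x + pi) <= _).
    by have /andP[] := truncn_itv x0.
  by rewrite ler_pM2l ?ltr0n // lerD2r.
by split=> //; exact: truncn_itv.
Qed.

Lemma cell_dist M l x : cell M l x -> `|x - cell_point M l| <= M.+1%:R^-1.
Proof.
move=> [_ /= /andP[h1 h2]]; have M0 : 0 < M.+1%:R :> R by rewrite ltr0n.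
rewrite /cell_point opprB addrA ger0_norm; last first.
  by rewrite subr_ge0 ler_pdivrMr // mulrC.
have e : M.+1%:R^-1 + l%:R / M.+1%:R = l.+1%:R / M.+1%:R :> R.
  by rewrite -[l.+1%:R]natr1 mulrDl mul1r addrC.
by rewrite lerBlDr e ler_pdivlMr // mulrC ltW.
Qed.

Definition riemann M nu f : R :=
  \sum_(l < cell_count M) f (cell_point M l) * fine (nu (cell M l)).

(** The error constant is the total mass on [angles] of the two Jordan parts, chosen before [f]. The
    Riemann sum itself mentions only values of [nu], so later arguments never look into the Hahn
    decomposition. *)
Lemma charge_riemann nu : exists2 c : R, 0 <= c &
  forall f (b L : R), measurable_fun setT f -> (forall x, `|f x| <= b) ->
    0 <= L -> (forall x y, `|f x - f y| <= L * `|x - y|) ->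
  forall M, `|charge_integral nu angles f - riemann M nu f| <= L * M.+1%:R^-1 * c.
Proof.
rewrite /charge_integral; set HP := cid _; set HN := cid _; set nuPN := projT2 HN.
have fp : 0 <= fine (jordan_pos nuPN angles) by rewrite fine_ge0.
have fn : 0 <= fine (jordan_neg nuPN angles) by rewrite fine_ge0.
exists (fine (jordan_pos nuPN angles) + fine (jordan_neg nuPN angles)).
  exact: addr_ge0.
move=> f b L mf fb L0 fL M.
have hc l x : cell M l x -> `|f x - f (cell_point M l)| <= L * M.+1%:R^-1.
  by move=> /cell_dist h; apply: le_trans (fL _ _) _; rewrite ler_wpM2l.
have := @measure_cells (jordan_pos nuPN) f b _ (cell M) (fun l => f (cell_point M l))
  (cell_count M) mf fb (measurable_cell M) (@trivIset_cell M) hc.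
have := @measure_cells (jordan_neg nuPN) f b _ (cell M) (fun l => f (cell_point M l))
  (cell_count M) mf fb (measurable_cell M) (@trivIset_cell M) hc.
rewrite !bigsetU_cell; set Ip := Rintegral _ _ _; set In := Rintegral _ _ _.
move=> h1 h2.
have -> : riemann M nu f =
    \sum_(l < cell_count M) f (cell_point M l) * fine (jordan_pos nuPN (cell M l)) -
    \sum_(l < cell_count M) f (cell_point M l) * fine (jordan_neg nuPN (cell M l)).
  rewrite -sumrB; apply: eq_bigr => l _; rewrite -mulrBr; congr (_ * _).
  have mC := measurable_cell M l.
  rewrite (jordan_decomp nuPN mC) /cadd /cscale fineD ?fineM ?fin_numM ?fin_num_measure //.
  by rewrite /= mulN1r.
have e (a b' u v : R) : a - b' - (u - v) = (a - u) - (b' - v) by ring.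
rewrite e; apply: le_trans (ler_normB _ _) _; rewrite mulrDr.
by rewrite lerD.
Qed.

End ChargeRiemannSums.

(** * Unitary extensions and spectral representation of Toeplitz matrices *)

Section UnitaryExtension.
Context {C : numClosedFieldType}.

Lemma unitary_square m n (e : m = n) (W : 'M[C]_(m, n)) :
  W *m W^H = 1%:M -> W^H *m W = 1%:M.
Proof. by case: n / e W => W; exact: mulmx1C. Qed.

(** The rows of [Q] are an orthonormal basis of the orthogonal complement of the rows of [V]. *)
Lemma unitary_complement m n (V : 'M[C]_(m, n)) : V *m V^H = 1%:M ->
  exists Q : 'M[C]_(n - m, n),
    [/\ Q *m Q^H = 1%:M, V *m Q^H = 0 & V^H *m V + Q^H *m Q = 1%:M].
Proof.
move=> hV; have rV : \rank V = m by apply: mxrank_unitary; exact/unitarymxP.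
have mn : (m <= n)%N by rewrite -{1}rV rank_leq_col.
pose K := kermx V^H.
have rK : \rank K = (n - m)%N by rewrite mxrank_ker mxrank_map mxrank_tr rV.
have : exists Q : 'M[C]_(\rank K, n), Q *m Q^H = 1%:M /\ Q *m V^H = 0.
  exists (schmidt (row_base K)); split.
    by apply/unitarymxP; apply: schmidt_unitarymx; exact: rank_leq_col.
  apply/eqP; rewrite -sub_kermx -/K.
  by rewrite (eqmx_schmidt_free (row_base_free K)) eq_row_base.
rewrite rK => -[Q [hQ QV]].
have VQ : V *m Q^H = 0.
  by rewrite -[V]trmxCK -trmxC_mul QV trmxC0.
exists Q; split=> //.
have := @unitary_square _ _ (subnKC mn) (col_mx V Q).
rewrite trmxC_col mul_col_row hV hQ VQ QV -scalar_mx_block mul_row_col.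
exact.
Qed.

(** Two families of rows with the same Gram matrix are orthonormalized by the same [D]; the unitary
    maps one orthonormal family to the other and one orthogonal complement to the other. *)
Lemma unitary_extension m n (A B : 'M[C]_(m, n)) :
  A *m A^H = B *m B^H -> posdef (A *m A^H) ->
  exists2 U : 'M[C]_n, U *m U^H = 1%:M & A *m U = B.
Proof.
move=> AB pA; have [D rD hD] := rowprod_orthonormal pA.
have hA : (D *m A) *m (D *m A)^H = 1%:M by rewrite trmxC_mul !mulmxA -hD !mulmxA.
have hB : (D *m B) *m (D *m B)^H = 1%:M.
  by rewrite trmxC_mul !mulmxA -hD AB !mulmxA.
have [P [PP AP APP]] := unitary_complement hA.
have [Q [QQ BQ BQQ]] := unitary_complement hB.
have uD : D \in unitmx by rewrite unitmxE unitfE gt_eqF // rowprod_det_gt0.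
set V := D *m A in hA AP APP; set W := D *m B in hB BQ BQQ.
have eV : D *m A = V by []; have eW : D *m B = W by []; clearbody V W.
have PV : P *m V^H = 0 by rewrite -[P]trmxCK -trmxC_mul AP trmxC0.
have QW : Q *m W^H = 0 by rewrite -[Q]trmxCK -trmxC_mul BQ trmxC0.
exists (V^H *m W + P^H *m Q).
  rewrite trmxC_add !trmxC_mul !trmxCK mulmxDl !mulmxDr !mulmxA.
  rewrite -[V^H *m W *m W^H]mulmxA hB -[V^H *m W *m Q^H]mulmxA BQ.
  rewrite -[P^H *m Q *m W^H]mulmxA QW -[P^H *m Q *m Q^H]mulmxA QQ.
  by rewrite !mulmx1 !mulmx0 !mul0mx addr0 add0r.
apply: (can_inj (mulKmx uD)); rewrite mulmxA eV eW mulmxDr !mulmxA hA AP.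
by rewrite mul1mx mul0mx addr0.
Qed.

Lemma diag_mx_pow_mul n (d : 'rV[C]_n) k :
  diag_mx (\row_l d 0 l ^+ k) *m diag_mx d = diag_mx (\row_l d 0 l ^+ k.+1).
Proof.
by apply/matrixP => i j; rewrite mul_diag_mx !mxE exprSr mulrnAr.
Qed.

(** Write $T_n=AA^*$ with block rows $a_0,\dots,a_n$. Since $T_n$ is Toeplitz, $(a_0,\dots,a_{n-1})$
    and $(a_1,\dots,a_n)$ have the same Gram matrix, so a unitary $U$ maps each $a_i$ to $a_{i+1}$.
    Diagonalizing $U$ in $\Gamma_k=a_0(a_0U^k)^*$ yields the sum. *)
Lemma toeplitz_spectral p n (g : int -> 'M[C]_p) :
  hermseq g -> posdef (tz g n.+1) ->
  exists N (d : 'I_N -> C) (q : 'I_N -> 'cV[C]_p),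
    (forall l, `|d l| = 1) /\
    forall k : nat, (k <= n)%N ->
      g k%:Z = \sum_l d l ^+ k *: (q l *m (q l)^H).
Proof.
move=> hg pT; have [D rD hD] := rowprod_orthonormal pT.
have uD : D \in unitmx by rewrite unitmxE unitfE gt_eqF // rowprod_det_gt0.
pose N := (\sum_(i < n.+1) p)%N; pose A : 'M[C]_(N, N) := invmx D.
have TA : tz g n.+1 = A *m A^H.
  rewrite /A trmxC_inv; apply: (can_inj (mulKmx uD)); rewrite mulmxA mulmxV // mul1mx.
  by rewrite -[LHS](mulmxK (_ : D^H \in unitmx)) ?unitmx_trmxC // hD mul1mx.
pose a (k : 'I_n.+1) := submxcol (p_ := fun=> p) A k.
have aE (i k : 'I_n.+1) : g (k%:Z - i%:Z) = a i *m (a k)^H.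
  have : tz g n.+1 = \mxblock_(i < n.+1, k < n.+1) (a i *m (a k)^H).
    rewrite TA -mul_mxcol_mxrow -{1}[A](submxcolK (p_ := fun=> p)); congr (_ *m _).
    by rewrite -{1}[A](submxcolK (p_ := fun=> p)); apply/matrixP => x y; rewrite !mxE.
  by rewrite /tz => /eq_mxblockP; apply.
pose w := widen_ord (leqnSn n).
pose X := \mxcol_(i < n) a (w i); pose Y := \mxcol_(i < n) a (lift ord0 i).
have XX : X *m X^H = tz g n.
  have -> : X^H = \mxrow_(i < n) (a (w i))^H by apply/matrixP => x y; rewrite !mxE.
  by rewrite mul_mxcol_mxrow; apply: eq_mxblock => i k; rewrite -aE.
have YY : Y *m Y^H = tz g n.
  have -> : Y^H = \mxrow_(i < n) (a (lift ord0 i))^H.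
    by apply/matrixP => x y; rewrite !mxE.
  rewrite mul_mxcol_mxrow; apply: eq_mxblock => i k; rewrite -aE.
  by rewrite !lift0 !intS opprD addrACA subrr add0r.
have pX : posdef (X *m X^H) by rewrite XX; have [] := (tz_posdefS hg n).1 pT.
have [U UU XU] := unitary_extension (etrans XX (esym YY)) pX.
have UU' := mulmx1C UU.
have /orthomx_spectralP US : U \is normalmx by apply/normalmxP; rewrite UU UU'.
set P := spectralmx U in US; set d := spectral_diag U in US.
have PU : P \is unitarymx by exact: spectral_unitarymx.
have PP : P *m P^H = 1%:M by exact/unitarymxP.
rewrite (invmx_unitary PU) in US.
have dE : diag_mx d = P *m U *m P^H.
  by rewrite US !mulmxA PP mul1mx -mulmxA PP mulmx1.
have d1 l : `|d 0 l| = 1.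
  have : diag_mx d *m (diag_mx d)^H = 1%:M.
    rewrite dE !trmxC_mul trmxCK !mulmxA -[P *m U *m P^H *m P]mulmxA (mulmx1C PP).
    by rewrite mulmx1 -[P *m U *m U^H]mulmxA UU mulmx1 PP.
  move=> /matrixP/(_ l l); rewrite mul_diag_mx !mxE eqxx !mulr1n => h.
  by apply/eqP; rewrite -(@pexpr_eq1 _ _ 2) // normCK h.
pose q := a ord0 *m P^H; have qE : a ord0 *m P^H = q by []; clearbody q.
have aS (i : 'I_n) : a (w i) *m U = a (lift ord0 i).
  have := congr1 (fun M => submxcol (p_ := fun=> p) M i) XU.
  by rewrite -submxcol_mul !mxcolK.
have ak k (kn : (k < n.+1)%N) :
    a (Ordinal kn) = q *m diag_mx (\row_l d 0 l ^+ k) *m P.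
  elim: k kn => [|k IH] kn.
    have -> : diag_mx (\row_l d 0 l ^+ 0) = 1%:M.
      by apply/matrixP => i j; rewrite !mxE expr0.
    rewrite mulmx1 -qE -mulmxA (mulmx1C PP) mulmx1; congr a; exact: val_inj.
  have kn' : (k < n)%N by [].
  have -> : Ordinal kn = lift ord0 (Ordinal kn') by exact: val_inj.
  rewrite -aS; have -> : w (Ordinal kn') = Ordinal (ltnW kn) by exact: val_inj.
  rewrite IH {1}US !mulmxA -[_ *m P *m P^H]mulmxA PP mulmx1.
  by rewrite -[_ *m diag_mx d]mulmxA diag_mx_pow_mul.
(* The adjoint in $a_0a_k^*$ conjugates the eigenvalues of $U$. *)
exists N, (fun l => (d 0 l)^*), (fun l => col l q); split.
  by move=> l; rewrite norm_conjC.
move=> k kn; have := aE ord0 (Ordinal (kn : (k < n.+1)%N)).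
rewrite subr0 /= => ->; rewrite ak !trmxC_mul !mulmxA qE.
apply/matrixP => x y; rewrite mxE summxE; apply: eq_bigr => l _.
rewrite tr_diag_mx map_diag_mx mul_mx_diag !mxE big_ord1 !mxE rmorphXn /=; ring.
Qed.

End UnitaryExtension.

(** * Lipschitz bounds and points of the circle *)

Section Trigonometry.
Context {R : realType}.
Local Notation RR := (measurableTypeR R).

Lemma derive_lipschitz (f df : R -> R) (L : R) :
  (forall x : R, is_derive x 1 f (df x)) -> (forall x, `|df x| <= L) ->
  forall x y, `|f x - f y| <= L * `|x - y|.
Proof.
move=> fd dL x y; wlog xy : x y / y <= x.
  by move=> h; case: (leP y x) => [|/ltW] /h //; rewrite distrC [`|y - x|]distrC.
have cf : {within `[y, x], continuous f}.
  apply: continuous_subspaceT => z; apply: differentiable_continuous.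
  by apply/derivable1_diffP; exact: ex_derive.
have [c _ ->] := MVT_segment xy (fun z _ => fd z) cf.
by rewrite normrM ler_wpM2r.
Qed.

Lemma cos_lipschitz (j x y : R) : `|cos (j * x) - cos (j * y)| <= `|j| * `|x - y|.
Proof.
rewrite -normrM mulrBr -[X in _ <= X]mul1r.
apply: (@derive_lipschitz cos (fun x => - sin x)) => z.
by rewrite normrN sin_max.
Qed.

Lemma sin_lipschitz (j x y : R) : `|sin (j * x) - sin (j * y)| <= `|j| * `|x - y|.
Proof.
rewrite -normrM mulrBr -[X in _ <= X]mul1r.
apply: (@derive_lipschitz sin cos) => z; exact: cos_max.
Qed.

Lemma measurable_cosM (j : R) : measurable_fun setT (fun x : RR => cos (j * x) : RR).
Proof.
apply: (measurableT_comp (f := cos)).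
  by apply: continuous_measurable_fun; exact: continuous_cos.
by have := @measurable_affine R j 0; under eq_fun do rewrite addr0.
Qed.

Lemma measurable_sinM (j : R) : measurable_fun setT (fun x : RR => sin (j * x) : RR).
Proof.
apply: (measurableT_comp (f := sin)).
  by apply: continuous_measurable_fun; exact: continuous_sin.
by have := @measurable_affine R j 0; under eq_fun do rewrite addr0.
Qed.

Definition cis (t : R) : R[i] := (cos t +i* sin t)%C.

Lemma cisB s t : cis (s - t) = cis s * Num.conj (cis t).
Proof.
apply: complexP; rewrite ?ReM ?ImM ReJ ImJ /=.
  by rewrite cosB mulrN opprK.
by rewrite sinB mulrN addrC mulrC addrC.
Qed.

Lemma cisMn t k : cis (k%:R * t) = cis t ^+ k.
Proof.
elim: k => [|k IH]; first by rewrite mul0r expr0 /cis cos0 sin0.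
rewrite exprSr -IH -natr1 mulrDl mul1r; apply: complexP; rewrite ?ReM ?ImM /=.
  exact: cosD.
by rewrite sinD addrC.
Qed.

Lemma cis_surjective (d : R[i]) : `|d| = 1 ->
  exists2 t, (angles : set RR) t & d = cis t.
Proof.
move=> d1; have : (complex.Re d) ^+ 2 + (complex.Im d) ^+ 2 = 1.
  by have := add_Re2_Im2 d; rewrite d1 expr1n => /complexI.
case: d {d1} => a b /= ab.
have a1 : a \in `[(-1), 1].
  rewrite in_itv /= -ler_norml -(@expr_le1 _ 2) // real_normK ?num_real // -ab.
  by rewrite lerDl sqr_ge0.
have a1' : -1 <= a <= 1 by move: a1; rewrite in_itv.
have sa : sin (acos a) = `|b|.
  by rewrite sin_acos // -ab [a ^+ 2 + _]addrC addrK sqrtr_sqr.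
have ca : cos (acos a) = a by exact: acosK.
case: (leP 0 b) => b0.
  exists (acos a); last by rewrite /cis ca sa ger0_norm.
  rewrite /angles /= in_itv /= acos_lepi // andbT.
  by apply: (lt_le_trans _ (acos_ge0 a1')); rewrite oppr_lt0 pi_gt0.
exists (- acos a); last by rewrite /cis cosN sinN ca sa ltr0_norm // opprK.
rewrite /angles /= in_itv /= ltrN2; apply/andP; split; last first.
  by apply: le_trans (pi_ge0 R); rewrite oppr_le0 acos_ge0.
(* The excluded angle $-\pi$ is not hit: a negative imaginary part forces the real part to differ
   from $-1$. *)
apply: acos_ltpi; have /andP[h1 ->] := a1'; rewrite andbT lt_neqAle h1 andbT.
apply/eqP => e; move: ab; rewrite -e sqrrN expr1n -[RHS]addr0 => /addrI /eqP.
by rewrite sqrf_eq0 lt_eqF.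
Qed.

End Trigonometry.

(** * Finite sums of point masses *)

Section PointCharges.
Context {R : realType}.
Local Notation RR := (measurableTypeR R).
Implicit Types (s : seq (R * R)) (f : RR -> R).

(** Pairs of a weight and an angle. Weights are signed, as they will be real and imaginary parts of
    matrix entries. *)
Fixpoint point_charge s : {charge set RR -> \bar R} :=
  if s is wt :: s' then
    cadd (cscale wt.1 (charge_of_finite_measure (\d_(wt.2 : RR)))) (point_charge s')
  else czero.

Lemma point_chargeE s (A : set RR) :
  point_charge s A = (\sum_(wt <- s) wt.1 * ((wt.2 : RR) \in A)%:R)%:E.
Proof.
elim: s => [|wt s IH]; first by rewrite big_nil.
by rewrite /= /cadd /= IH /cscale /charge_of_finite_measure /= diracE big_cons.
Qed.

Lemma archimedean_eq0 (x a : R) : (forall M : nat, `|x| <= M.+1%:R^-1 * a) -> x = 0.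
Proof.
move=> h; apply/eqP; rewrite -normr_eq0 eq_le normr_ge0 andbT leNgt.
apply/negP => x0; have a0 : 0 < a.
  by have := lt_le_trans x0 (h 0%N); rewrite invr1 mul1r.
have := h (Num.truncn (a / `|x|)); rewrite mulrC ler_pdivlMr ?ltr0n // leNgt.
by rewrite -ltr_pdivrMl // mulrC truncnS_gt.
Qed.

(** The Riemann sum is close to the integral by [charge_riemann] and to the weighted sum of values
    by [measure_cells] for each Dirac mass; both errors are of order $1/(M+1)$. *)
Lemma charge_integral_point s f (b L : R) :
  (forall wt, wt \in s -> (angles : set RR) wt.2) ->
  measurable_fun setT f -> (forall x, `|f x| <= b) ->
  0 <= L -> (forall x y, `|f x - f y| <= L * `|x - y|) ->
  charge_integral (point_charge s) angles f = \sum_(wt <- s) wt.1 * f wt.2.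
Proof.
move=> sa mf fb L0 fL; have [c c0 hc] := charge_riemann (point_charge s).
apply/eqP; rewrite -subr_eq0; apply/eqP.
apply: (@archimedean_eq0 _ (L * c + L * \sum_(wt <- s) `|wt.1|)) => M.
have h1 := hc f b L mf fb L0 fL M.
have h2 : `|riemann M (point_charge s) f - \sum_(wt <- s) wt.1 * f wt.2| <=
    M.+1%:R^-1 * (L * \sum_(wt <- s) `|wt.1|).
  have -> : riemann M (point_charge s) f = \sum_(wt <- s) wt.1 *
      \sum_(l < @cell_count R M) f (cell_point M l) *
        fine (@dirac _ RR (wt.2 : RR) R (cell M l)).
    rewrite /riemann; under eq_bigr do rewrite point_chargeE /= mulr_sumr.
    rewrite exchange_big /=; apply: eq_bigr => wt _; rewrite mulr_sumr.
    by apply: eq_bigr => l _; rewrite /dirac /= indicE mulrCA.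
  rewrite -sumrB; apply: le_trans (ler_norm_sum _ _ _) _.
  rewrite mulrA mulr_sumr big_seq [X in _ <= X]big_seq; apply: ler_sum => wt /sa ta.
  rewrite -mulrBr normrM [X in _ <= X]mulrC ler_wpM2l // distrC.
  have hcell l x : cell M l x -> `|f x - f (cell_point M l)| <= L * M.+1%:R^-1.
    by move=> /cell_dist h; apply: le_trans (fL _ _) _; rewrite ler_wpM2l.
  have := @measure_cells R (@dirac _ RR (wt.2 : RR) R) f b _ (cell M) (fun l => f (cell_point M l))
    (@cell_count R M) mf fb (measurable_cell M) (@trivIset_cell R M) hcell.
  have dA : @dirac _ RR (wt.2 : RR) R angles = 1%E by rewrite /dirac indicE mem_set.
  rewrite bigsetU_cell => h3.
  have -> : M.+1%:R^-1 * L = L * M.+1%:R^-1 * fine (@dirac _ RR (wt.2 : RR) R angles).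
    by rewrite dA /= mulr1 mulrC.
  have -> : f wt.2 = \int[@dirac _ RR (wt.2 : RR) R]_(x in angles) f x.
    rewrite /Rintegral integral_dirac.
    - by rewrite [X in fine (X * _)%E](_ : _ = 1%E) ?mul1e // -[RHS]dA.
    - exact: measurable_itv.
    - by apply/measurable_EFinP; exact: measurable_funTS.
  exact: h3.
apply: le_trans (_ : L * M.+1%:R^-1 * c + M.+1%:R^-1 * (L * \sum_(wt <- s) `|wt.1|) <= _).
  apply: le_trans (lerD h1 h2); apply: le_trans (ler_normD _ _).
  by rewrite addrA subrK.
by rewrite mulrDr [L * _]mulrC -mulrA.
Qed.

End PointCharges.

(** * Moments and positivity of Toeplitz matrices *)

Section Moments.
Context {R : realType} {p : nat}.
Local Notation RR := (measurableTypeR R).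
Local Notation C := R[i].
Local Notation Re := (@complex.Re R).
Local Notation Im := (@complex.Im R).
Local Notation point := (@point R p).
Implicit Types (mu : matrix_charge (R := R) p) (x : point).

Lemma charge_cells_sum (nu : {charge set RR -> \bar R}) M :
  \sum_(l < @cell_count R M) fine (nu (cell M l)) = fine (nu angles).
Proof.
rewrite -(bigsetU_cell M); elim: (cell_count M) => [|K IH].
  by rewrite !big_ord0 charge0.
have mU : measurable (\big[setU/set0]_(l < K) (cell M l : set RR)).
  by apply: bigsetU_measurable => l _; exact: measurable_cell.
have mK := measurable_cell M K.
have dis : \big[setU/set0]_(l < K) (cell M l : set RR) `&` cell M K = set0.
  rewrite big_distrl /= big1 // => l _.
  apply: contrapT => /eqP/set0P h'; have := @trivIset_cell R M l K I I h'.
  by move=> lK; move: (ltn_ord l); rewrite {1}lK ltnn.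
have f1 : nu (\big[setU/set0]_(l < K) (cell M l : set RR)) \is a fin_num.
  exact: fin_num_measure.
have f2 : nu (cell M K) \is a fin_num by exact: fin_num_measure.
rewrite !big_ord_recr /= IH -(fineD f1 f2); congr fine.
by apply/esym; apply: chargeU; [exact: mU|exact: mK|exact: dis].
Qed.

(* None stands for the limit of the Riemann sums. *)
Definition moment_approx mu x (t : option nat) (j : int) : 'M[C]_p :=
  if t is Some M then
    \sum_(l < @cell_count R M) cis (j%:~R * cell_point M l) *: mc_val mu (cell M l)
  else gam x j.

Local Notation F := (Some @ \oo).

Lemma cvg_scaled_inv (u : nat -> R) (l a : R) :
  (forall M, `|l - u M| <= M.+1%:R^-1 * a) -> u M @[M --> \oo] --> l.
Proof.
move=> h; apply/cvgrPdist_le => e e0.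
have : (fun M : nat => M.+1%:R^-1 * a) @ \oo --> (0 * a : R).
  by apply: cvgMl; exact: cvg_harmonic.
rewrite mul0r => /cvgrPdist_le /(_ e e0); apply: filterS => M.
rewrite sub0r normrN => hM; apply: le_trans (h M) _.
exact: le_trans (ler_norm _) hM.
Qed.

Lemma riemann_cvg_trig (nu : {charge set RR -> \bar R}) (j : R) :
  (riemann M nu (fun t : RR => cos (j * t)) @[M --> \oo] -->
     charge_integral nu angles (fun t : RR => cos (j * t))) /\
  (riemann M nu (fun t : RR => sin (j * t)) @[M --> \oo] -->
     charge_integral nu angles (fun t : RR => sin (j * t))).
Proof.
have [c c0 hc] := charge_riemann nu; split;
  apply: (@cvg_scaled_inv _ _ (`|j| * c)) => M; rewrite mulrA [_ * `|j|]mulrC.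
  apply: (hc _ 1 _ (measurable_cosM j)) => //; first by move=> t; exact: cos_max.
  exact: cos_lipschitz.
apply: (hc _ 1 _ (measurable_sinM j)) => //; first by move=> t; exact: sin_max.
exact: sin_lipschitz.
Qed.

(** For $j=0$ the sum is exactly $\mu(\mathbb T)=I_p$. Negative indices follow from positive ones by
    adjunction, because the masses of cells are Hermitian. *)
Lemma moment_approx_cvg mu x n : circle_measure mu ->
  (forall j : nat, (j < n)%N -> mat j x = moment mu j.+1) ->
  forall j : int, (absz j <= n)%N ->
  matrix_in (Q := converges F None) (fun t => moment_approx mu x t j).
Proof.
move=> [psdmu _ mu1] hx j jn.
have hpos k : (k <= n)%N ->
    matrix_in (Q := converges F None) (fun t => moment_approx mu x t k%:Z).
  case: k => [_|k kn] a b.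
    apply: (complex_in_ext (f := fun=> (1%:M : 'M[C]_p) a b)); last first.
      by apply: complex_in_cst; exact: converges_falg.
    move=> [M|] //=; rewrite -mu1 summxE !mxE.
    under eq_bigr do rewrite mul0r mxE mxE.
    apply: complexP; rewrite raddf_sum [LHS]/=.
      rewrite -(charge_cells_sum _ M); apply: eq_bigr => l _.
      by rewrite /= cos0 sin0 mul1r mul0r subr0.
    rewrite -(charge_cells_sum _ M); apply: eq_bigr => l _.
    by rewrite /= cos0 sin0 mul1r mul0r addr0.
  have [c1 s1] := riemann_cvg_trig (mcRe mu a b) k.+1%:R.
  have [c2 s2] := riemann_cvg_trig (mcIm mu a b) k.+1%:R.
  have eR : (fun M => Re (moment_approx mu x (Some M) k.+1%:Z a b)) = (fun M =>
      riemann M (mcRe mu a b) (fun t : RR => cos (k.+1%:R * t)) -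
      riemann M (mcIm mu a b) (fun t : RR => sin (k.+1%:R * t))).
    apply/funext => M; rewrite summxE raddf_sum -sumrB; apply: eq_bigr => l _.
    by rewrite /= !mxE /=.
  have eI : (fun M => Im (moment_approx mu x (Some M) k.+1%:Z a b)) = (fun M =>
      riemann M (mcIm mu a b) (fun t : RR => cos (k.+1%:R * t)) +
      riemann M (mcRe mu a b) (fun t : RR => sin (k.+1%:R * t))).
    apply/funext => M; rewrite summxE raddf_sum -big_split; apply: eq_bigr => l _.
    by rewrite /= !mxE /=.
  have hm : moment_approx mu x None k.+1%:Z a b = moment mu k.+1 a b.
    by rewrite /= (hx _ kn).
  split; rewrite /converges hm mxE.
    suff : (fun M => Re (moment_approx mu x (Some M) k.+1%:Z a b)) @ \oo -->
      charge_integral (mcRe mu a b) angles (fun t : RR => cos (k.+1%:R * t)) -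
      charge_integral (mcIm mu a b) angles (fun t : RR => sin (k.+1%:R * t)) by [].
    by rewrite eR; apply: cvgB; [exact: c1|exact: s2].
  suff : (fun M => Im (moment_approx mu x (Some M) k.+1%:Z a b)) @ \oo -->
      charge_integral (mcIm mu a b) angles (fun t : RR => cos (k.+1%:R * t)) +
      charge_integral (mcRe mu a b) angles (fun t : RR => sin (k.+1%:R * t)) by [].
  by rewrite eI; apply: cvgD; [exact: c2|exact: s1].
case: j jn => [k|k] kn; first exact: hpos.
move=> a b; apply: (complex_in_ext
  (f := fun t => Num.conj (moment_approx mu x t k.+1%:Z b a))); last first.
  by apply: complex_in_conj; [exact: converges_falg|exact: hpos].
move=> [M|] /=; last by rewrite !mxE.
rewrite !summxE rmorph_sum; apply: eq_bigr => l _.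
have [hE _] := psdmu (cell M l) (measurable_cell M l).
rewrite [in RHS]mxE -[in RHS]hE !mxE rmorphM; congr (_ * _).
by rewrite NegzE rmorphN mulNr; apply: complexP; rewrite ?ReJ ?ImJ /= ?cosN ?sinN.
Qed.

(** The Toeplitz matrix of the Riemann sums is a sum of congruences of the nonnegative masses
    [mc_val mu (cell M l)]; the quadratic form passes to the limit. *)
Lemma moment_toeplitz_psd mu x n : circle_measure mu ->
  (forall j : nat, (j < n)%N -> mat j x = moment mu j.+1) ->
  psdmx (tz (gam x) n.+1).
Proof.
move=> cmu hx; have hT := tz_herm n.+1 (gam_herm x); split; first exact: hT.
move=> v; set z := _ 0 0.
have zJ : Num.conj z = z.
  rewrite -[in RHS](_ : ((v^H *m tz (gam x) n.+1 *m v)^H) 0 0 = z).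
    by rewrite [RHS]mxE [in RHS]mxE.
  by rewrite !trmxC_mul trmxCK hT mulmxA.
have zI : Im z = 0.
  have := congr1 Im zJ; rewrite ImJ => h; apply/eqP.
  by rewrite -[_ == 0](mulrn_eq0 _ 2) mulr2n -{1}h addNr.
rewrite lecE zI eqxx /=.
have FF : Filter F by exact: fmap_filter.
have hQ : function_algebra (@converges R _ F None) by exact: converges_falg.
pose T t : 'M[C]_(\sum_(i < n.+1) p) := tz (moment_approx mu x t) n.+1.
pose u : 'M[C]_(1, \sum_(i < n.+1) p) := v^H.
have mT : matrix_in (Q := converges F None) (fun t => u *m T t *m v).
  apply: (matrix_in_mul hQ); last exact: (matrix_in_cst hQ).
  apply: (matrix_in_mul hQ); first exact: (matrix_in_cst hQ).
  move=> a b; pose i := tagnat.sig1 a; pose j := tagnat.sig1 b.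
  apply: (complex_in_ext (f := fun t => moment_approx mu x t (j%:Z - i%:Z)
    (tagnat.sig2 a) (tagnat.sig2 b))) => [t|].
    by rewrite /T /tz mxE.
  apply: (moment_approx_cvg cmu hx); have := ltn_ord i; have := ltn_ord j; lia.
have [cz _] := mT 0 0.
have lim : limn (fun M => Re ((u *m T (Some M) *m v) 0 0))
   = Re z by exact: (cvg_lim (@Rhausdorff R) cz).
rewrite -lim; apply: limr_ge; first by apply/cvg_ex; exists (Re z); exact: cz.
apply: nearW => M.
(* Block $(i,k)$ carries $e^{\mathrm i(k-i)\theta}$, which factors as $\overline{e^{\mathrm i
   i\theta}}\,e^{\mathrm i k\theta}$; hence each cell contributes $V_l^*\mu V_l$. *)
pose V l := \mxrow_(k < n.+1) ((cis (k%:R * cell_point M l))%:M : 'M[C]_p).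
have -> : T (Some M) =
    \sum_(l < @cell_count R M) (V l)^H *m mc_val mu (cell M l) *m V l.
  have VH l : (V l)^H = \mxcol_(k < n.+1) (Num.conj (cis (k%:R * cell_point M l)))%:M.
    by apply/matrixP => a b; rewrite !mxE; rewrite rmorphMn eq_sym.
  transitivity (\sum_(l < @cell_count R M) \mxblock_(i < n.+1, k < n.+1)
     (cis ((k%:Z - i%:Z)%:~R * cell_point M l) *: mc_val mu (cell M l))).
    apply/matrixP => a b; rewrite summxE !mxE summxE.
    by apply: eq_bigr => l _; rewrite [RHS]mxE.
  apply: eq_bigr => l _; rewrite VH mxcol_mul mul_mxcol_mxrow.
  apply: eq_mxblock => i k; rewrite mul_scalar_mx mul_mx_scalar scalerA.
  congr (_ *: _); rewrite -cisB rmorphB mulrBl.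
  by [].
rewrite mulmx_sumr mulmx_suml summxE raddf_sum; apply: sumr_ge0 => l _.
have [psdmu _ _] := cmu; have [_ /(_ (V l *m v))] := psdmu _ (measurable_cell M l).
rewrite lecE => /andP[_]; rewrite trmxC_mul /u !mulmxA.
exact.
Qed.

(** The representing measure has mass $q_lq_l^*$ at the angle of the eigenvalue [d l]; its total
    mass is $\Gamma_0=I_p$. *)
Lemma moment_of_Opos n x : Opos n x ->
  exists2 mu, circle_measure mu &
    forall j : nat, (j < n)%N -> mat j x = moment mu j.+1.
Proof.
move=> hO; have [N [d [q [d1 hq]]]] := toeplitz_spectral (gam_herm x) hO.
have ex l : exists s : R, (angles : set RR) s /\ d l = cis s.
  by have [s h1 h2] := cis_surjective (d1 l); exists s.
have [t ht] := choice ex.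
pose W l : 'M[C]_p := q l *m (q l)^H.
pose sR a b := [seq (Re (W l a b), t l) | l <- index_enum 'I_N].
pose sI a b := [seq (Im (W l a b), t l) | l <- index_enum 'I_N].
pose mu := MatrixCharge (fun a b => point_charge (sR a b))
  (fun a b => point_charge (sI a b)).
have muE E : mc_val mu E = \sum_l ((t l : RR) \in E)%:R *: W l.
  apply/matrixP => a b; rewrite mxE summxE /= !point_chargeE /= !big_map /=.
  apply: complexP; rewrite raddf_sum; apply: eq_bigr => l _;
    rewrite [in RHS]mxE.
    by case: (_ \in E); rewrite ?mulr1 ?mulr0 ?mul1r ?mul0r.
  by case: (_ \in E); rewrite ?mulr1 ?mulr0 ?mul1r ?mul0r.
have tin l : (t l : RR) \in (angles : set RR) by rewrite inE; exact: (ht l).1.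
have W1 : \sum_l W l = 1%:M.
  have := hq 0%N (leq0n _); rewrite [gam x 0%:Z]/= => ->.
  by apply: eq_bigr => l _; rewrite expr0 scale1r.
exists mu.
  split; last 2 first.
  - rewrite muE big1 // => l _.
    by rewrite memNset ?scale0r // => /(_ (ht l).1).
  - by rewrite muE -W1; apply: eq_bigr => l _; rewrite tin scale1r.
  move=> E _; rewrite muE; split.
    have WH l a b : Num.conj (W l b a) = W l a b.
      have /matrixP/(_ a b) : (W l)^H = W l by rewrite /W trmxC_mul trmxCK.
      by rewrite mxE mxE.
    apply/matrixP => a b; rewrite mxE mxE !summxE rmorph_sum; apply: eq_bigr => l _.
    by rewrite [in RHS]mxE -[in RHS]WH mxE rmorphM rmorph_nat.
  move=> v; rewrite mulmx_sumr mulmx_suml summxE; apply: sumr_ge0 => l _.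
  rewrite -scalemxAr -scalemxAl mxE mulr_ge0 ?ler0n // /W.
  have := trmxC_dot_ge0 ((q l)^H *m v); rewrite trmxC_mul trmxCK !mulmxA.
  exact.
move=> j jn; have hj : mat j x = \sum_l d l ^+ j.+1 *: W l := hq j.+1 jn.
apply/matrixP => a b; rewrite hj summxE [RHS]mxE /=.
have trig (s : seq (R * R)) : (forall wt, wt \in s -> (angles : set RR) wt.2) ->
    charge_integral (point_charge s) angles (fun u : RR => cos (j.+1%:R * u)) =
      \sum_(wt <- s) wt.1 * cos (j.+1%:R * wt.2) /\
    charge_integral (point_charge s) angles (fun u : RR => sin (j.+1%:R * u)) =
      \sum_(wt <- s) wt.1 * sin (j.+1%:R * wt.2).
  move=> hs; split.
    apply: (@charge_integral_point _ _ _ 1 `|j.+1%:R : R| hs (measurable_cosM _)) => //.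
    - by move=> u; exact: cos_max.
    - exact: cos_lipschitz.
  apply: (@charge_integral_point _ _ _ 1 `|j.+1%:R : R| hs (measurable_sinM _)) => //.
  - by move=> u; exact: sin_max.
  - exact: sin_lipschitz.
have hR wt : wt \in sR a b -> (angles : set RR) wt.2.
  by move=> /mapP[l _ ->]; exact: (ht l).1.
have hI wt : wt \in sI a b -> (angles : set RR) wt.2.
  by move=> /mapP[l _ ->]; exact: (ht l).1.
have [-> ->] := trig _ hR; have [-> ->] := trig _ hI.
rewrite !big_map /= -sumrB -big_split /=.
apply: complexP; rewrite raddf_sum; apply: eq_bigr => l _;
  rewrite [in LHS]mxE (ht l).2 -cisMn.
  by rewrite /= ReM /= [cos _ * _]mulrC [sin _ * _]mulrC.
by rewrite /= ImM /= [cos _ * _]mulrC [sin _ * _]mulrC.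
Qed.

End Moments.

(** * Topology of matrix tuples *)

(** If $s^2|U^*v|^2\le|v|^2$ with $s>1$ and $v\ne0$, then $|U^*v|<|v|$. *)
Lemma posdef_sub_dilation (C : numClosedFieldType) p (s : C) (U : 'M[C]_p) :
  1 < s -> (forall v : 'cV[C]_p, 0 <= (v^H *m (1%:M - (s *: U) *m (s *: U)^H) *m v) 0 0) ->
  posdef (1%:M - U *m U^H).
Proof.
move=> s1 hv; have s0 : 0 < s by exact: lt_trans ltr01 s1.
split; first by rewrite trmxC_sub trmxC1 trmxC_mul trmxCK.
move=> v v0; have vv := trmxC_dot_gt0 v0; have := hv v.
rewrite linearZ /= map_mxZ /= (conj_Creal (gtr0_real s0)) -scalemxAl -scalemxAr.
rewrite scalerA -expr2 !mulmxBr !mulmxBl mulmx1 -scalemxAr -scalemxAl.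
have entB (a b : 'M[C]_1) : (a - b) 0 0 = a 0 0 - b 0 0 by rewrite !mxE.
have entZ (k : C) (a : 'M[C]_1) : (k *: a) 0 0 = k * a 0 0 by rewrite !mxE.
rewrite !entB entZ !subr_ge0 subr_gt0 => h.
rewrite -(ltr_pM2l (exprn_gt0 2 s0)); apply: le_lt_trans h _.
rewrite -[X in X < _]mul1r ltr_pM2r //.
by rewrite exprn_egt1.
Qed.

Section ComplexMatrixTopology.
Context {R : realType}.
Local Notation C := R[i].
Local Notation Re := (@complex.Re R).
Local Notation Im := (@complex.Im R).

Lemma normc_Re_Im_lt (z : C) (e : R) :
  `|Re z| < e -> `|Im z| < e -> `|z| < (e + e)%:C%C.
Proof.
case: z => a b /= ha hb; have e0 : 0 < e by apply: le_lt_trans ha.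
rewrite normc_def ltcR /= -(@ltr_pXn2r _ 2) ?nnegrE ?sqrtr_ge0 ?addr_ge0 ?ltW //.
rewrite sqr_sqrtr ?addr_ge0 ?sqr_ge0 // -[a ^+ 2]real_normK ?num_real //.
rewrite -[b ^+ 2]real_normK ?num_real // sqrrD.
apply: (@lt_le_trans _ _ (e ^+ 2 + e ^+ 2)).
  by rewrite ltrD // ltr_pXn2r ?nnegrE ?normr_ge0 ?ltW.
by rewrite -addrA addrCA lerDr mulrn_wge0 // mulr_ge0 ?ltW.
Qed.

Lemma Re_le_normc (z : C) (e : R) : `|z| < e%:C%C -> `|Re z| < e /\ `|Im z| < e.
Proof.
case: z => a b; rewrite normc_def ltcR /= => h.
have ha : `|a| <= Num.sqrt (a ^+ 2 + b ^+ 2).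
  by rewrite -sqrtr_sqr ler_wsqrtr // lerDl sqr_ge0.
have hb : `|b| <= Num.sqrt (a ^+ 2 + b ^+ 2).
  by rewrite -sqrtr_sqr ler_wsqrtr // lerDr sqr_ge0.
by split; [exact: le_lt_trans ha h|exact: le_lt_trans hb h].
Qed.

Lemma nbhs_complexP (z : C) (A : set C) : nbhs z A <->
  exists2 e : R, 0 < e & forall w : C, `|Re w - Re z| < e -> `|Im w - Im z| < e -> A w.
Proof.
split=> [/(@nbhs_normP _ (R[i]^o) z A)[e /= e0 he]|[e e0 he]].
  move: e0; rewrite complex_gt0 => /andP[/eqP eI eR].
  have eE : e = (Re e)%:C%C by exact: complexP.
  exists (Re e / 2); first by rewrite divr_gt0.
  move=> w h1 h2; apply: he => /=; rewrite distrC eE [Re e]splitr.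
  by apply: normc_Re_Im_lt; [rewrite ReD ReN|rewrite ImD ImN].
apply/(@nbhs_normP _ (R[i]^o) z A); exists e%:C%C => /=; first by rewrite ltcR.
move=> w /=; rewrite distrC => /Re_le_normc[]; rewrite ReD ReN ImD ImN.
exact: he.
Qed.

Lemma nbhs_mxP m n (M : 'M[C]_(m, n)) (A : set 'M[C]_(m, n)) : nbhs M A <->
  exists2 e : R, 0 < e & forall N : 'M[C]_(m, n),
    (forall i j, `|Re (N i j) - Re (M i j)| < e /\ `|Im (N i j) - Im (M i j)| < e) -> A N.
Proof.
split=> [[P hP PA]|[e e0 he]].
  have h (ij : 'I_m * 'I_n) : exists e : R, 0 < e /\ forall w : C,
      `|Re w - Re (M ij.1 ij.2)| < e -> `|Im w - Im (M ij.1 ij.2)| < e -> P ij.1 ij.2 w.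
    by have [e e0 he] := (nbhs_complexP _ _).1 (hP ij.1 ij.2); exists e.
  have [g hg] := choice h; pose f i j := g (i, j).
  have f0 i j : 0 < f i j by have [] := hg (i, j).
  exists (\big[Num.min/1]_i \big[Num.min/1]_j f i j).
    by apply: lt_bigmin => // i _; apply: lt_bigmin => // j _.
  move=> N hN; apply: PA => i j.
  have fle : \big[Num.min/1]_i \big[Num.min/1]_j f i j <= f i j.
    apply: (@le_trans _ _ (\big[Num.min/1]_j0 f i j0)).
      exact: (@bigmin_le _ R _ 1 i (fun i0 => \big[Num.min/1]_j0 f i0 j0)).
    exact: (@bigmin_le _ R _ 1 j (f i)).
  have [h1 h2] := hN i j; have [_] := hg (i, j); apply.
    exact: lt_le_trans h1 fle.
  exact: lt_le_trans h2 fle.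
exists (fun i j => [set w : C | `|Re w - Re (M i j)| < e /\ `|Im w - Im (M i j)| < e]).
  by move=> i j; apply/nbhs_complexP; exists e.
by move=> N hN; apply: he => i j; exact: hN.
Qed.

Lemma converges_mx m n (M : 'M[C]_(m, n)) :
  matrix_in (Q := @converges R _ (nbhs M) M) (fun N => N).
Proof.
move=> i j; split; apply/cvgrPdist_lt => e e0; apply/nbhs_mxP; exists e => // N hN;
  by have [h1 h2] := hN i j; rewrite distrC.
Qed.

(** An interior point stays in the ball after a dilation by some factor above 1, which makes the
    inequality strict; conversely strict positivity is stable under small perturbations. *)
Lemma interior_Dball p (U : 'M[C]_p) :
  (Dball p)^° U <-> posdef (1%:M - U *m U^H).
Proof.
split=> [/nbhs_mxP[e e0 he]|pU].
  pose S : R := \sum_i \sum_j (`|Re (U i j)| + `|Im (U i j)|).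
  have S0 : 0 <= S by do 2 apply: sumr_ge0 => ? _; rewrite addr_ge0.
  have hS i j : `|Re (U i j)| <= S /\ `|Im (U i j)| <= S.
    suff h : `|Re (U i j)| + `|Im (U i j)| <= S.
      by split; apply: le_trans h; rewrite ?lerDl ?lerDr.
    rewrite /S (bigD1 i) //= (bigD1 j) //= -addrA lerDl addr_ge0 //.
      by apply: sumr_ge0 => ? _; rewrite addr_ge0.
    by do 2 apply: sumr_ge0 => ? _; rewrite addr_ge0.
  (* [S] bounds the real and imaginary part of every entry of [U], so dilating by [1 + dl] moves
     each of them by less than [e]. *)
  pose dl := e / (S + 1); have S1 : 0 < S + 1 by rewrite ltr_wpDl.
  have d0 : 0 < dl by rewrite divr_gt0.
  have dS : dl * S < e.
    by rewrite /dl mulrAC ltr_pdivrMr // ltr_pM2l // ltrDl.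
  clearbody dl; pose s := 1 + dl; have s1 : 1 < s by rewrite ltrDl.
  have : Dball p (s%:C%C *: U).
    apply: he => i j; have [h1 h2] := hS i j; rewrite !mxE ReM ImM /= !mul0r subr0 addr0.
    have e1 (a : R) : s * a - a = dl * a by rewrite /s mulrDl mul1r addrAC subrr add0r.
    rewrite !e1 ![`|dl * _|]normrM (ger0_norm (ltW d0)).
    by split; apply: le_lt_trans dS; rewrite ler_wpM2l // ltW.
  move=> [_ hv]; apply: (@posdef_sub_dilation C p (s%:C%C)) => //.
  by rewrite -(rmorph1 (real_complex R)) ltcR.
have hQ : function_algebra (@converges R _ (nbhs U) U) by exact: converges_falg.
pose A (V : 'M[C]_p) : 'M[C]_p := 1%:M - V *m V^H.
have hA : matrix_in (Q := @converges R _ (nbhs U) U) A.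
  apply: (matrix_in_add hQ); first exact: (matrix_in_cst hQ).
  apply: (matrix_in_opp hQ); apply: (matrix_in_mul hQ); first exact: converges_mx.
  by apply: (matrix_in_trC hQ); exact: converges_mx.
have nA : \forall V \near U, posdef (A V).
  exact: (@near_posdef R _ (nbhs U) _ U p A (@sub_adj_herm R p) hA pU).
have sub : [set V | posdef (A V)] `<=` Dball p.
  by move=> V pV; split; [exact: pV.1|move=> v; exact: (posdef_ge0 v pV)].
exact: (filterS sub nA).
Qed.

End ComplexMatrixTopology.

Section RowsAndPoints.
Context {R : realType} {p : nat}.
Local Notation C := R[i].
Local Notation Re := (@complex.Re R).
Local Notation Im := (@complex.Im R).
Local Notation point := (@point R p).
Local Notation row n := 'rV['M[C]_p]_n.

(** Padding with zeros places tuples of all lengths in the same space of points. *)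
Definition ptof n (Z : row n) : point := fun c =>
  if insub c.1.1.1 is Some j then
    (if c.2 then Im (Z 0 j c.1.1.2 c.1.2) else Re (Z 0 j c.1.1.2 c.1.2))
  else 0.

Definition rowof n (x : point) : row n := \row_(j < n) mat j x.

Lemma ptof_in n (Z : row n) (j : 'I_n) a b e :
  ptof Z (j : nat, a, b, e) = if e then Im (Z 0 j a b) else Re (Z 0 j a b).
Proof. by rewrite /ptof /= valK. Qed.

Lemma ptof_out n (Z : row n) (c : coord) : (n <= c.1.1.1)%N -> ptof Z c = 0.
Proof. by move=> h; rewrite /ptof insubF // ltnNge h. Qed.

Lemma mat_ptof n (Z : row n) m :
  mat m (ptof Z) = if insub m is Some j then Z 0 j else 0.
Proof.
apply/matrixP => a b; rewrite mxE /ptof /=; case: insub => [j|].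
  by apply: complexP.
by rewrite mxE.
Qed.

Lemma Gam_ptof n (Z : row n) : Gam Z = gam (ptof Z).
Proof. by apply/funext => -[[|m]|m] //=; rewrite mat_ptof. Qed.

Lemma rowofK n (Z : row n) : rowof n (ptof Z) = Z.
Proof. by apply/rowP => j; rewrite mxE mat_ptof valK. Qed.

Lemma ptof_rowof n x (c : coord) : (c.1.1.1 < n)%N -> ptof (rowof n x) c = x c.
Proof.
case: c => [[[m a] b] e] /= mn; rewrite -[m]/(nat_of_ord (Ordinal mn)).
by rewrite ptof_in !mxE; case: e.
Qed.

Lemma nbhs_rowP n (Z : row n) (A : set (row n)) : nbhs Z A <->
  exists2 e : R, 0 < e &
    forall W : row n, (forall c : coord, `|ptof W c - ptof Z c| < e) -> A W.
Proof.
split=> [[P hP PA]|[e e0 he]].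
  have h (j : 'I_n) : exists e : R, 0 < e /\ forall N : 'M[C]_p,
      (forall a b, `|Re (N a b) - Re (Z 0 j a b)| < e /\
        `|Im (N a b) - Im (Z 0 j a b)| < e) -> P 0 j N.
    by have [e e0 he] := (nbhs_mxP _ _).1 (hP 0 j); exists e.
  have [f hf] := choice h.
  exists (\big[Num.min/1]_j f j).
    by apply: lt_bigmin => // j _; have [] := hf j.
  move=> W hW; apply: PA => i j; rewrite (ord1 i).
  have fle : \big[Num.min/1]_j f j <= f j by exact: (@bigmin_le _ R _ 1 j f).
  have [_] := hf j; apply => a b; split; apply: lt_le_trans fle.
    by have := hW (j : nat, a, b, false); rewrite !ptof_in.
  by have := hW (j : nat, a, b, true); rewrite !ptof_in.
exists (fun i j => [set N : 'M[C]_p | forall a b,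
    `|Re (N a b) - Re (Z 0 j a b)| < e /\ `|Im (N a b) - Im (Z 0 j a b)| < e]).
  by move=> i j; apply/nbhs_mxP; exists e => //; rewrite (ord1 i).
move=> W hW; apply: he => c; rewrite /ptof; case: insubP => [j _ _|_]; last first.
  by rewrite subrr normr0.
by have [h1 h2] := hW 0 j c.1.1.2 c.1.2; case: (c.2).
Qed.

Lemma open_rowP n (A : set (row n)) : open A <->
  forall Z, A Z -> exists2 e : R, 0 < e &
    forall W : row n, (forall c : coord, `|ptof W c - ptof Z c| < e) -> A W.
Proof.
rewrite openE; split=> h Z AZ; first by apply/nbhs_rowP; exact: h.
by apply/nbhs_rowP; exact: h.
Qed.

Lemma hausdorff_row n : hausdorff_space (row n).
Proof.
move=> Z W cl; rewrite -[Z]rowofK -[W]rowofK; congr rowof.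
apply/funext => c; apply/eqP; rewrite -subr_eq0 -normr_eq0 eq_le normr_ge0 andbT.
rewrite leNgt; apply/negP; set d := `|_| => d0.
have hb (V : row n) : nbhs V [set V' | forall c, `|ptof V' c - ptof V c| < d / 2].
  by apply/nbhs_rowP; exists (d / 2) => //; rewrite divr_gt0.
have [V [/= /(_ c) h1 /(_ c) h2]] := cl _ _ (hb Z) (hb W).
rewrite distrC in h1; have := ler_distD (ptof V c) (ptof Z c) (ptof W c).
by rewrite leNgt -/d [X in _ < X]splitr ltrD.
Qed.

Lemma ptof_first_coords n k (Z : row n) (c : coord) : (c.1.1.1 < k)%N ->
  ptof (first_coords k Z) c = ptof Z c.
Proof.
case: c => [[[m a] b] e] /= mk; rewrite -[in LHS]/(nat_of_ord (Ordinal mk)) ptof_in mxE /=.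
by rewrite /ptof /=; case: insub => // ; rewrite !mxE; case: e.
Qed.

Lemma first_coords_open n k (A : set (row k)) :
  open A -> open (@first_coords R p n k @^-1` A).
Proof.
move=> /open_rowP oA; apply/open_rowP => Z /oA[e e0 he]; exists e => // W hW.
apply: he => c; case: (ltnP c.1.1.1 k) => ck; last first.
  by rewrite !ptof_out // subrr normr0.
by rewrite !ptof_first_coords.
Qed.

Lemma compact_row_box n (r : R) : 0 <= r ->
  compact [set Z : row n | forall c, `|ptof Z c| <= r].
Proof.
move=> r0; pose T := coordinate n p; pose N := #|T|.
pose phi (t : 'rV[R]_N) : row n := \row_j \matrix_(a, b)
  (t 0 (enum_rank (j, a, b, false)) +i* t 0 (enum_rank (j, a, b, true)))%C.
have phiE t (j : 'I_n) a b e :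
    ptof (phi t) (j : nat, a, b, e) = t 0 (enum_rank (j, a, b, e)).
  by rewrite ptof_in !mxE; case: e.
have cphi : continuous phi.
  move=> t A /nbhs_rowP[e e0 he].
  exists (fun _ i => ball (t 0 i) e) => [i j|u hu].
    by rewrite (ord1 i); exact: nbhsx_ballx.
  apply: he => c; case: c => [[[m a] b] e']; case: (ltnP m n) => mn; last first.
    by rewrite !ptof_out // subrr normr0.
  by rewrite -[m]/(nat_of_ord (Ordinal mn)) !phiE distrC; exact: hu.
have -> : [set Z : row n | forall c, `|ptof Z c| <= r] =
    phi @` [set t : 'rV[R]_N | forall i, `[- r, r]%classic (t 0 i)].
  apply/seteqP; split=> [Z hZ|_ [t ht <-]] /=.
    pose key (c : T) : coord := (c.1.1.1 : nat, c.1.1.2, c.1.2, c.2).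
    exists (\row_(i < N) ptof Z (key (enum_val i))).
      by move=> i /=; rewrite in_itv /= mxE -ler_norml; exact: hZ.
    apply/rowP => j; apply/matrixP => a b; rewrite !mxE !enum_rankK /key /= !ptof_in.
    exact: complexP.
  move=> c; case: c => [[[m a] b] e']; case: (ltnP m n) => mn; last first.
    by rewrite ptof_out // normr0.
  rewrite -[m]/(nat_of_ord (Ordinal mn)) phiE ler_norml.
  by have := ht (enum_rank (Ordinal mn, a, b, e')); rewrite /= in_itv.
apply: continuous_compact; first exact: continuous_subspaceT.
apply: (@rV_compact _ _ (fun=> `[- r, r]%classic)) => _.
exact: segment_compact.
Qed.

End RowsAndPoints.

(** * The uniform distribution *)

Section MomentVolume.
Context {R : realType} {p : nat}.
Local Notation C := R[i].
Local Notation Re := (@complex.Re R).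
Local Notation point := (@point R p).
Local Notation row n := 'rV['M[C]_p]_n.
Implicit Types (x y : point).

Definition key n (c : coordinate n p) : @coord p := (c.1.1.1 : nat, c.1.1.2, c.1.2, c.2).

Definition keys n : #|coordinate n p|.-tuple (@coord p) :=
  map_tuple (@key n) (enum_tuple (coordinate n p)).

Lemma key_inj n : injective (@key n).
Proof.
by move=> [[[m a] b] e] [[[m' a'] b'] e'] [/val_inj -> -> -> ->].
Qed.

Lemma uniq_keys n : uniq (keys n).
Proof. by rewrite map_inj_uniq ?enum_uniq //; exact: key_inj. Qed.

Lemma mem_keys n (c : @coord p) : (c \in (keys n : seq (@coord p))) = (c.1.1.1 < n)%N.
Proof.
apply/mapP/idP => [[e _ ->]|cn]; first exact: ltn_ord.
exists (Ordinal cn, c.1.1.2, c.1.2, c.2); first by rewrite mem_enum.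
by case: c cn => [[[]]].
Qed.

Lemma perm_keys n : perm_eq (keys n) (fib 0 n).
Proof.
apply: uniq_perm; [exact: uniq_keys|exact: uniq_fib|move=> c].
by rewrite mem_keys mem_fib add0n.
Qed.

Lemma of_coordinates_keys n y : of_coordinates (map_tuple y (keys n)) = rowof n y.
Proof.
have h (c : coordinate n p) : tnth (map_tuple y (keys n)) (enum_rank c) = y (key c).
  by rewrite !tnth_map (tnth_nth c) /= nth_enum_rank.
by apply/rowP => j; apply/matrixP => a b; rewrite !mxE !h.
Qed.

Lemma lebesgue_mxE n (A : set (row n)) x :
  lebesgue_mx A = Js (keys n) (fun y => (\1_A (rowof n y))%:E) x.
Proof.
rewrite /lebesgue_mx (lebesgue_tupleE _ x (uniq_keys n)); apply: Js_ext => y _.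
by rewrite !indicE -of_coordinates_keys.
Qed.

(** Passing to the block order of [fib] permutes integrals by Tonelli, hence the measurable
    integrand [F]. *)
Lemma lebesgue_mx_fib n (A : set (row n)) (F : point -> \bar R) x : nice F ->
  (forall y, (\1_A (rowof n y))%:E = F y) -> lebesgue_mx A = Js (fib 0 n) F x.
Proof.
move=> nF h; rewrite (lebesgue_mxE A x) -(Js_perm nF (perm_keys n)).
by apply: Js_ext => y _; rewrite h.
Qed.

Lemma lebesgue_mx_ge0 n (A : set (row n)) : (0 <= lebesgue_mx A)%E.
Proof. exact: lebesgue_tuple_ge0. Qed.

Lemma le_lebesgue_mx n (A B : set (row n)) : A `<=` B ->
  (lebesgue_mx A <= lebesgue_mx B)%E.
Proof.
move=> AB; pose x0 : point := fun=> 0.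
rewrite (lebesgue_mxE A x0) (lebesgue_mxE B x0); apply: Js_le => [y|y _].
  by rewrite lee_fin indicE.
rewrite lee_fin !indicE; case: (boolP (_ \in A)) => [/set_mem/AB h|_].
  by rewrite mem_set.
exact: ler0n.
Qed.

Lemma nice_indic (S : set point) : measurable S -> nice (fun y => (\1_S y)%:E).
Proof.
move=> mS; split; last by move=> y; rewrite lee_fin indicE.
by apply/measurable_EFinP; exact: measurable_indic.
Qed.

(** All moments vanish, as for the uniform measure on the circle: every Toeplitz matrix is the
    identity and $\det L_m$ reaches its maximum 1. *)
Definition origin : point := fun=> 0.

Lemma mat_origin m : mat m origin = 0.
Proof. by apply/matrixP => a b; rewrite !mxE. Qed.

Lemma tzL_origin m : tzL (gam origin) m = 1%:M.
Proof.
rewrite /tzL; suff -> : tzrow (gam origin) m = 0 by rewrite !mul0mx subr0.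
have h j : gam origin j.+1%:Z = 0 by exact: mat_origin.
by apply/matrixP => a b; rewrite mxE h !mxE.
Qed.

Lemma Opos_origin m : Opos m origin.
Proof.
elim: m => [|m IH]; first exact: Opos0.
apply/(tz_posdefS (gam_herm origin)); split; first exact: IH.
by rewrite tzL_origin; exact: posdef1.
Qed.

Lemma detL_origin m : detL m origin = 1.
Proof.
by have := detLE (Opos_origin m); rewrite tzL_origin det1 => /complexI.
Qed.

Lemma posdef_convex m (A B : 'M[C]_m) (t : R) : psdmx A -> posdef B ->
  0 < t < 1 -> posdef (t%:C%C *: A + (1 - t)%:C%C *: B).
Proof.
move=> [hA pA] pB /andP[t0 t1].
have conjR (r : R) : Num.conj (r%:C%C) = r%:C%C.
  by apply: complexP; rewrite ?ReJ ?ImJ /= ?oppr0.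
have c0 : 0 < (1 - t)%:C%C :> C by rewrite ltcR subr_gt0.
have [hB pB'] := posdefZ c0 pB.
split; first by rewrite trmxC_add hB linearZ /= map_mxZ /= conjR hA.
move=> v v0; rewrite mulmxDr mulmxDl mxE; apply: ltr_wpDl; last exact: pB'.
rewrite -scalemxAr -scalemxAl mxE; apply: mulr_ge0; last exact: pA.
by rewrite ler0c ltW.
Qed.

Definition posrow n : set (row n) := [set Z | Opos n (ptof Z)].
Arguments posrow n : clear implicits.

Lemma posrow_rowof n y : posrow n (rowof n y) <-> Opos n y.
Proof.
by rewrite /posrow /= (@Opos_eq _ _ n _ y) // => c cn; rewrite ptof_rowof.
Qed.

Lemma lebesgue_posrow n x : lebesgue_mx (posrow n) = Js (fib 0 n) (dens n 0) x.
Proof.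
apply: lebesgue_mx_fib => [|y]; first exact: nice_dens.
rewrite /dens expr0 indicE; case: asboolP => h.
  have -> : (rowof n y \in posrow n) = true.
    by apply: mem_set; exact: ((posrow_rowof n y).2 h).
  by [].
have -> : (rowof n y \in posrow n) = false; last by [].
by apply: memNset => /posrow_rowof; exact: h.
Qed.

Lemma posrow_moment n : posrow n `<=` moment_space p n.
Proof.
move=> Z hO; have [mu cmu h] := moment_of_Opos hO; exists mu => // j.
by rewrite -h // mat_ptof valK.
Qed.

(** $T(t\Gamma)=tT(\Gamma)+(1-t)I$, a nonnegative matrix plus a positive one. *)
Lemma moment_dilate n x (t : R) : 0 < t < 1 -> moment_space p n (rowof n x) ->
  Opos n (affmap (keys n) t (fun=> 0) x).
Proof.
move=> t01 [mu cmu h]; have hx (j : nat) : (j < n)%N -> mat j x = moment mu j.+1.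
  by move=> jn; have := h (Ordinal jn); rewrite mxE.
have psd := moment_toeplitz_psd cmu hx.
have := posdef_convex psd (Opos_origin n) t01; rewrite /Opos.
set y := affmap _ _ _ _.
have e (j : int) : (absz j <= n)%N ->
    gam y j = t%:C%C *: gam x j + (1 - t)%:C%C *: gam origin j.
  have hm m : (m < n)%N -> mat m y = t%:C%C *: mat m x.
    move=> mn; apply/matrixP => a b; rewrite !mxE /y /affmap !mem_keys /= mn !addr0.
    by apply: complexP; rewrite ?ReM ?ImM /= !mul0r ?subr0 ?addr0.
  case: j => [[|m]|m] /= jn.
  - rewrite -scalerDl -rmorphD addrC subrK.
    by rewrite (rmorph1 (real_complex R)) scale1r.
  - by rewrite hm // mat_origin scaler0 addr0.
  - rewrite hm // mat_origin trmxC0 scaler0 addr0 linearZ /= map_mxZ /=.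
    congr (_ *: _); apply: complexP; rewrite ?ReJ ?ImJ //=.
    by rewrite oppr0.
suff -> : tz (gam y) n.+1 =
    t%:C%C *: tz (gam x) n.+1 + (1 - t)%:C%C *: tz (gam origin) n.+1 by [].
apply/matrixP => a b; rewrite !mxE e; first by rewrite !mxE.
have := ltn_ord (tagnat.sig1 a); have := ltn_ord (tagnat.sig1 b); lia.
Qed.

Lemma le_dilations (m o : \bar R) (N : nat) : (0 <= m)%E -> (0 <= o)%E ->
  (forall t : R, 0 < t < 1 -> (m <= (t^-1 ^+ N)%:E * o)%E) -> (m <= o)%E.
Proof.
move=> m0 o0 h; case: o o0 h => [r r0 h| |//]; last by move=> _ _; rewrite leey.
have h2 : 0 < (2^-1 : R) < 1 by apply/andP; split; lra.
case: m m0 h => [s s0 h| _ /(_ _ h2)|//]; last by rewrite -EFinM leye_eq.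
rewrite lee_fin leNgt; apply/negP => rs.
have : (t ^+ N * s) @[t --> (1 : R)] --> 1 ^+ N * s.
  by apply: cvgMl; exact: exprn_continuous.
rewrite expr1n mul1r => /cvgr_gt /(_ r rs) /nbhs_ballP[e /= e0 he].
(* A scale in []0, 1[] within distance [e] of 1, where [t ^+ N * s] still exceeds [r]. *)
pose t := 1 - Num.min (e / 2) 2^-1.
have m1 : 0 < Num.min (e / 2) 2^-1 by rewrite lt_min divr_gt0 //=; lra.
have m2 : Num.min (e / 2) 2^-1 <= 2^-1 by rewrite ge_min lexx orbT.
have m3 : Num.min (e / 2) 2^-1 <= e / 2 by rewrite ge_min lexx.
have t01 : 0 < t < 1 by rewrite /t; apply/andP; split; lra.
have := he t; rewrite /ball /= /t opprB addrC subrK ger0_norm ?ltW // => hh.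
have := h t t01; rewrite -EFinM lee_fin exprVn mulrC ler_pdivlMr; last first.
  by rewrite exprn_gt0 //; case/andP: t01.
rewrite leNgt mulrC => /negP; apply; apply: hh.
by apply: le_lt_trans m3 _; rewrite ltr_pdivrMr // ltr_pMr //; lra.
Qed.

(** The moment space contains the positive tuples, and its dilation by any $t<1$ lies in them. Its
    volume is thus at most $t^{-N}$ times theirs, and $t$ tends to 1. *)
Lemma moment_volume n : lebesgue_mx (moment_space p n) = lebesgue_mx (posrow n).
Proof.
apply: le_anti; apply/andP; split; last first.
  by apply: le_lebesgue_mx; exact: posrow_moment.
pose N := size (keys n).
apply: (@le_dilations _ _ N); [exact: lebesgue_mx_ge0|exact: lebesgue_mx_ge0|].
move=> t t01; have t0 : 0 < t by case/andP: t01.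
rewrite (lebesgue_posrow n origin) -(Js_perm (nice_dens n 0) (perm_keys n)).
rewrite -(Js_affine _ (fun=> 0) t0 (uniq_keys n) (nice_dens n 0)).
rewrite (lebesgue_mxE _ origin); apply: Js_le => [y|y _]; first by rewrite lee_fin indicE.
rewrite indicE; case: (boolP (_ \in moment_space p n)) => [/set_mem hM|_] /=; last first.
  exact: (nice_dens n 0).2.
rewrite /dens expr0; case: asboolP => // hn.
by case: hn; exact: moment_dilate.
Qed.

End MomentVolume.
Arguments posrow {R} p n.

Section UniformLaw.
Context {R : realType} {p n : nat}.
Local Notation C := R[i].
Local Notation row n := 'rV['M[C]_p]_n.
Variable Q : set (row n) -> \bar R.
Hypothesis hQ : uniform_on (moment_space p n) Q.
Hypothesis Q1 : Q setT = 1%E.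

(** Total mass 1 forces a finite positive volume: the quotient of a volume by itself is 0 in the
    extended reals when the volume is 0 or infinite. *)
Lemma posrow_volume : exists2 V : R, 0 < V & lebesgue_mx (posrow p n) = V%:E.
Proof.
have := hQ (measurableT : measurable (setT : set (Borel (row n)))).
rewrite Q1 setTI moment_volume.
have := lebesgue_mx_ge0 (@posrow R p n).
case: (lebesgue_mx (@posrow R p n)) => [V V0| _ |//]; last first.
  by rewrite /inve /= mule0 => -[] /eqP; rewrite oner_eq0.
have {}V0 : 0 <= V by rewrite -lee_fin.
rewrite inver; case: eqP => [->|V0' _].
  by rewrite mul0e => -[] /eqP; rewrite oner_eq0.
by exists V => //; rewrite lt_neqAle V0 andbT eq_sym; apply/eqP.
Qed.

Lemma law_posrow (A : set (row n)) (V : R) : open A -> A `<=` posrow p n ->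
  lebesgue_mx (posrow p n) = V%:E -> 0 < V ->
  Q A = (lebesgue_mx A * V^-1%:E)%E.
Proof.
move=> oA AO hV V0.
have mA : measurable (A : set (Borel (row n))) by exact: sub_sigma_algebra.
rewrite (hQ mA) moment_volume hV inver gt_eqF //.
by rewrite (setIidl (subset_trans AO (@posrow_moment R p n))).
Qed.

End UniformLaw.

(** * Square roots and canonical moments *)

Section SquareRoots.
Context {C : numClosedFieldType}.

(** Over [R[i]] this is convertible to [psdmx]; it is restated for an arbitrary closed field. *)
Definition psd n (A : 'M[C]_n) :=
  A^H = A /\ forall v : 'cV[C]_n, 0 <= (v^H *m A *m v) 0 0.

Lemma posdef_psd n (A : 'M[C]_n) : posdef A -> psd A.
Proof. by move=> pA; split; [exact: pA.1|move=> v; exact: posdef_ge0]. Qed.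

Lemma hermitian_spectral n (A : 'M[C]_n) : A^H = A ->
  exists (P : 'M[C]_n) (d : 'rV[C]_n),
    [/\ P *m P^H = 1%:M, P^H *m P = 1%:M, A = P^H *m diag_mx d *m P &
        forall l, d 0 l = (row l P *m A *m (row l P)^H) 0 0].
Proof.
move=> hA; have /orthomx_spectralP AE : A \is normalmx by apply/normalmxP; rewrite hA.
set P := spectralmx A in AE; set d := spectral_diag A in AE.
have PU : P \is unitarymx by exact: spectral_unitarymx.
have PP : P *m P^H = 1%:M by exact/unitarymxP.
rewrite (invmx_unitary PU) in AE; exists P, d; split=> //; first exact: mulmx1C.
move=> l; rewrite -congr_entry {1}AE !mulmxA PP mul1mx -mulmxA PP mulmx1.
by rewrite mxE eqxx mulr1n.
Qed.

Lemma psd_sqrt n (A : 'M[C]_n) : psd A -> exists B : 'M[C]_n, psd B /\ B *m B = A.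
Proof.
move=> [hA pA]; have [P [d [PP PP' AE dE]]] := hermitian_spectral hA.
have d0 l : 0 <= d 0 l by rewrite dE -{1}[row l P]trmxCK; exact: pA.
pose s : 'rV[C]_n := \row_l sqrtC (d 0 l).
have s0 l : 0 <= s 0 l by rewrite mxE sqrtC_ge0.
have hs : (diag_mx s)^H = diag_mx s.
  rewrite tr_diag_mx map_diag_mx; congr diag_mx; apply/rowP => l.
  by rewrite [LHS]mxE /= conj_Creal // ger0_real.
exists (P^H *m diag_mx s *m P); split; last first.
  rewrite AE !mulmxA -[P^H *m diag_mx s *m P *m P^H]mulmxA PP mulmx1.
  rewrite -[P^H *m diag_mx s *m diag_mx s]mulmxA; congr (_ *m _ *m _).
  apply/matrixP => i j; rewrite mul_diag_mx !mxE mulrnAr -expr2 sqrtCK.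
  by [].
split; first by rewrite !trmxC_mul trmxCK hs mulmxA.
move=> v; have -> : v^H *m (P^H *m diag_mx s *m P) *m v =
    (P *m v)^H *m diag_mx s *m (P *m v) by rewrite trmxC_mul !mulmxA.
move: (P *m v) => w.
rewrite mul_mx_diag mxE sumr_ge0 // => l _; rewrite !mxE mulrAC.
by rewrite mulr_ge0 ?sqrtC_ge0 ?d0 // mulrC mul_conjC_ge0.
Qed.

(* For an eigenvector v of B - D with eigenvalue a, both
   v^*(B^2 - D^2)v = a v^*(B + D)v and |a| <= v^*(B + D)v hold. *)
Lemma psd_sqrt_diff n (B D : 'M[C]_n) a b : psd B -> psd D ->
  `|(B - D) a b| ^+ 2 <= n%:R * \sum_c \sum_e `|(B *m B - D *m D) c e|.
Proof.
move=> [hB pB] [hD pD].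
have hH : (B - D)^H = B - D by rewrite trmxC_sub hB hD.
have [P [d [PP PP' HE dE]]] := hermitian_spectral hH.
set X := B *m B - D *m D.
have Pl l : row l P *m (row l P)^H = 1%:M.
  apply/matrixP => i j; rewrite !ord1 -{1}[row l P]mulmx1 -congr_entry mulmx1 PP.
  by rewrite !mxE eqxx.
have P1 l c : `|P l c| <= 1.
  rewrite -(@expr_le1 _ 2) // normCK.
  have <- : \sum_j P l j * (P l j)^* = 1.
    have /matrixP/(_ 0 0) := Pl l; rewrite [RHS]mxE eqxx mulr1n => <-.
    by rewrite [RHS]mxE; apply: eq_bigr => j _; rewrite !mxE.
  rewrite (bigD1 c) //= lerDl sumr_ge0 // => i _; exact: mul_conjC_ge0.
have eig l : row l P *m (B - D) = d 0 l *: row l P.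
  rewrite HE !mulmxA -row_mul PP row1 -rowE.
  by apply/rowP => j; rewrite row_diag_mx -scalemxAl -rowE !mxE.
have dR l : Num.conj (d 0 l) = d 0 l.
  rewrite dE; set r := row l P.
  have /matrixP/(_ 0 0) : (r *m (B - D) *m r^H)^H = r *m (B - D) *m r^H.
    by rewrite !trmxC_mul trmxCK hH mulmxA.
  by rewrite mxE mxE.
have eig' l : (B - D) *m (row l P)^H = d 0 l *: (row l P)^H.
  by rewrite -hH -trmxC_mul eig linearZ /= map_mxZ /= dR.
have lam l : `|d 0 l| ^+ 2 <= \sum_c \sum_e `|X c e|.
  set r := row l P.
  have XE : X = B *m (B - D) + (B - D) *m D.
    by rewrite mulmxBr mulmxBl addrA subrK.
  have e1 : (r *m X *m r^H) 0 0 = d 0 l * ((r *m B *m r^H) 0 0 + (r *m D *m r^H) 0 0).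
    rewrite XE mulmxDr mulmxDl [in LHS]mxE mulrDr; congr (_ + _).
      by rewrite -!mulmxA eig' -!scalemxAr mxE.
    by rewrite mulmxA eig -!scalemxAl mxE.
  have b0 : 0 <= (r *m B *m r^H) 0 0 by rewrite -{1}[r]trmxCK.
  have d0 : 0 <= (r *m D *m r^H) 0 0 by rewrite -{1}[r]trmxCK.
  have e2 : `|d 0 l| <= (r *m B *m r^H) 0 0 + (r *m D *m r^H) 0 0.
    rewrite dE mulmxBr mulmxBl [X in `|X|]mxE [X in `|_ + X|]mxE.
    by apply: le_trans (ler_normB _ _) _; rewrite !ger0_norm.
  apply: (@le_trans _ _ `|(r *m X *m r^H) 0 0|).
    rewrite e1 normrM expr2 ler_wpM2l // [X in _ <= X]ger0_norm //.
    exact: addr_ge0.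
  rewrite mxE; apply: le_trans (ler_norm_sum _ _ _) _.
  rewrite [X in _ <= X]exchange_big; apply: ler_sum => e _.
  rewrite normrM mxE; apply: (@le_trans _ _ `|\sum_j r 0 j * X j e|).
    by rewrite -[X in _ <= X]mulr1 ler_wpM2l // !mxE norm_conjC.
  apply: le_trans (ler_norm_sum _ _ _) _; apply: ler_sum => c _.
  by rewrite normrM -[X in _ <= X]mul1r ler_wpM2r // mxE.
have sq : `|(B - D) a b| ^+ 2 <= ((B - D)^H *m (B - D)) b b.
  rewrite [X in _ <= X]mxE (bigD1 a) //= [(_^H) b a]mxE [_^T b a]mxE.
  rewrite mulrC normCK lerDl sumr_ge0 // => i _.
  by rewrite [(_^H) b i]mxE [_^T b i]mxE mulrC mul_conjC_ge0.
apply: le_trans sq _; rewrite hH {1}HE.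
have -> : P^H *m diag_mx d *m P *m (B - D) = P^H *m (diag_mx d *m diag_mx d) *m P.
  by rewrite HE !mulmxA -[P^H *m diag_mx d *m P *m P^H]mulmxA PP mulmx1.
rewrite mxE; apply: (@le_trans _ _ (\sum_(l < n) `|d 0 l| ^+ 2)); last first.
  apply: le_trans (_ : \sum_(l < n) \sum_c \sum_e `|X c e| <= _).
    by apply: ler_sum => l _; exact: lam.
  by rewrite sumr_const card_ord mulr_natl.
apply: ler_sum => l _; rewrite mulmx_diag mul_mx_diag !mxE.
rewrite -{2}dR -normCK mulrAC mulrC -[X in _ <= X]mulr1 ler_wpM2l ?exprn_ge0 //.
by rewrite mulrC -normCK expr_le1.
Qed.

(** If $v^*Av=0$ then $A^{1/2}v=0$, hence $Av=0$. *)
Lemma psd_unit_posdef n (A : 'M[C]_n) : psd A -> A \in unitmx -> posdef A.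
Proof.
move=> pA uA; split; first exact: pA.1.
move=> v v0; rewrite lt_neqAle pA.2 andbT eq_sym; apply: contra v0 => /eqP e.
have [B [[hB _] eB]] := psd_sqrt pA.
have Bv : B *m v = 0.
  apply/eqP; apply: contraT => /trmxC_dot_gt0.
  by rewrite trmxC_mul hB mulmxA -(mulmxA v^H) eB e ltxx.
by rewrite -[v](mulKmx uA) -eB -mulmxA Bv !mulmx0.
Qed.

Lemma psd_ball_entry n (A : 'M[C]_n) a b : psd (1%:M - A *m A^H) -> `|A a b| ^+ 2 <= 1.
Proof.
move=> [_ pA]; have := pA (row a (1%:M : 'M[C]_n))^H.
rewrite trmxCK -congr_entry trmxC1 mul1mx mulmx1 mxE [X in X + _]mxE eqxx mulr1n.
rewrite mxE subr_ge0; apply: le_trans; rewrite mxE (bigD1 b) //= !mxE -normCK lerDl.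
by apply: sumr_ge0 => j _; rewrite !mxE mul_conjC_ge0.
Qed.

End SquareRoots.

Section CanonicalAlgebra.
Context {C : numClosedFieldType} {p : nat}.
Implicit Types (A L S : 'M[C]_p) (g : int -> 'M[C]_p).

Lemma sqrt_inv_unit L S : posdef L -> S *m S = invmx L -> S \in unitmx.
Proof.
move=> pL hS; have := unitmx_mul S S; rewrite hS unitmx_inv (posdef_unit pL).
by move=> /esym /andP[].
Qed.

Lemma sqrt_inv_congr L S : posdef L -> S *m S = invmx L -> S *m L *m S = 1%:M.
Proof.
move=> pL hS; have uS := sqrt_inv_unit pL hS.
have h : S *m (S *m L) = 1%:M by rewrite mulmxA hS mulVmx // posdef_unit.
by rewrite (mulmx1C h).
Qed.

(** The analogue of [tz_next] for Hermitian square roots: [tzL_rec] conjugated by [S] becomes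
    $I-AA^*$, because $SLS=I$ and $S'^2=R^{-1}$. *)
Lemma tz_canonical_step g i S S' : hermseq g -> posdef (tz g i.+1) ->
  psd S -> psd S' -> S *m S = invmx (tzL g i) -> S' *m S' = invmx (tzR g i) ->
  let A := S *m (g i.+1%:Z - tzM g i) *m S' in
  (posdef (tz g i.+2) <-> posdef (1%:M - A *m A^H)) /\
  \det (tzL g i.+1) = \det (tzL g i) * \det (1%:M - A *m A^H).
Proof.
move=> hg pT [hS _] [hS' _] SS SS' A; have [_ pL] := (tz_posdefS hg i).1 pT.
have pR := tzR_posdef hg pT; have uS := sqrt_inv_unit pL SS.
have SLS := sqrt_inv_congr pL SS.
have eA : 1%:M - A *m A^H = S *m tzL g i.+1 *m S^H.
  rewrite (tzL_rec hg pT) mulmxBr mulmxBl hS SLS -SS' /A !trmxC_mul hS hS'.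
  by rewrite !mulmxA.
split.
  rewrite eA -{1}[S]trmxCK posdef_congrP ?unitmx_trmxC //.
  by rewrite tz_posdefS //; split=> [[]//|].
have dS : \det S * \det S * \det (tzL g i) = 1.
  by have := congr1 determinant SLS; rewrite !det_mulmx det1 mulrAC.
rewrite eA !det_mulmx hS -[LHS]mul1r -dS; ring.
Qed.

(** The eigenvalues are values of the form $I-AA^*$ at unit vectors and lie between 0 and 1. *)
Lemma det_sub_adj_le1 A : posdef (1%:M - A *m A^H) -> \det (1%:M - A *m A^H) <= 1.
Proof.
move=> pA; have [P [d [PP PP' AE dE]]] := hermitian_spectral pA.1.
have -> : \det (1%:M - A *m A^H) = \prod_l d 0 l.
  rewrite {1}AE !det_mulmx det_diag mulrAC -det_mulmx PP' det1 mul1r.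
  by [].
apply: prodr_ile1 => l _; rewrite dE; set r := row l P.
have r1 : r *m r^H = 1%:M.
  apply/matrixP => i j; rewrite !ord1 -{1}[r]mulmx1 -congr_entry mulmx1 PP.
  by rewrite !mxE eqxx.
apply/andP; split; first by rewrite -{1}[r]trmxCK; exact: posdef_ge0.
rewrite mulmxBr mulmxBl mulmx1 r1.
have entB (a b : 'M[C]_1) : (a - b) 0 0 = a 0 0 - b 0 0 by rewrite !mxE.
rewrite entB [(1%:M : 'M[C]_1) 0 0]mxE eqxx mulr1n lerBlDr lerDl.
have := trmxC_dot_ge0 ((A^H *m r^H) : 'cV[C]_p).
by rewrite trmxC_mul !trmxCK !mulmxA.
Qed.

(** Both are the determinant of the block matrix with rows $(I,A)$ and $(A^*,I)$. This matches
    $I-Z^*Z$ in the rate function with $I-AA^*$ in the recursion. *)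
Lemma det_sub_adjC A : \det (1%:M - A^H *m A) = \det (1%:M - A *m A^H).
Proof.
have u1 : (1%:M : 'M[C]_p) \in unitmx by rewrite unitmx1.
have := schur_det A (1%:M : 'M[C]_p) u1 (@trmxC1 C p).
rewrite (schur_det_dr (1%:M : 'M[C]_p) A u1 (@trmxC1 C p)) /schur !invmx1.
by rewrite !mulmx1 trmxCK !det1 !mul1r => ->.
Qed.

Lemma canonical_cancel (S S' N W : 'M[C]_p) : S \in unitmx -> S' \in unitmx ->
  S *m (N + invmx S *m W *m invmx S' - N) *m S' = W.
Proof.
move=> uS uS'; rewrite addrC addKr.
by rewrite !mulmxA (mulmxV uS) mul1mx -mulmxA (mulVmx uS') mulmx1.
Qed.

End CanonicalAlgebra.

Section ConvergentMatrices.
Context {R : realType} {T : Type} {F : set_system T} {FF : Filter F} (t0 : T).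
Local Notation C := R[i].
Local Notation Re := (@complex.Re R).
Local Notation Im := (@complex.Im R).
Local Notation Q := (@converges R T F t0).

Let hQ : function_algebra Q := converges_falg t0.

Lemma converges_near (f g : T -> R) : (\forall t \near F, f t = g t) ->
  f t0 = g t0 -> Q f -> Q g.
Proof.
move=> fg e0; rewrite /converges -e0 => hf.
by move=> B /hf; apply: filterS2 fg => t /= <-.
Qed.

Lemma falg_sum (I : Type) (r : seq I) (f : I -> T -> R) :
  (forall i, Q (f i)) -> Q (fun t => \sum_(i <- r) f i t).
Proof.
move=> h; elim: r => [|i r IH].
  by under eq_fun do rewrite big_nil; exact: (falg_cst hQ).
by under eq_fun do rewrite big_cons; apply: (falg_add hQ).
Qed.

Lemma complex_in_inv (f : T -> C) : f t0 != 0 ->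
  complex_in (Q := Q) f -> complex_in (Q := Q) (fun t => (f t)^-1).
Proof.
move=> f0 [hR hI]; pose N t := Re (f t) ^+ 2 + Im (f t) ^+ 2.
have N0 : N t0 != 0.
  rewrite /N paddr_eq0 ?sqr_ge0 // !sqrf_eq0; apply: contra f0 => /andP[/eqP a /eqP b].
  by apply/eqP; exact: complexP.
have hN : Q (fun t => (N t)^-1).
  apply: converges_inv => //.
  apply: (falg_add hQ); first by have := falg_pow hQ 2 hR.
  by have := falg_pow hQ 2 hI.
split.
  have -> : (fun t => Re (f t)^-1) = (fun t => Re (f t) * (N t)^-1).
    by apply/funext => t; rewrite /N; case: (f t).
  exact: (falg_mul hQ).
have -> : (fun t => Im (f t)^-1) = (fun t => - Im (f t) * (N t)^-1).
  by apply/funext => t; rewrite /N; case: (f t) => a b /=; rewrite mulNr.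
by apply: (falg_mul hQ) => //; exact: (falg_opp hQ).
Qed.

Lemma complex_in_near (f g : T -> C) : (\forall t \near F, f t = g t) ->
  f t0 = g t0 -> complex_in (Q := Q) f -> complex_in (Q := Q) g.
Proof.
move=> fg e0 [h1 h2]; split.
  have near1 : \forall t \near F, Re (f t) = Re (g t) by apply: filterS fg => t ->.
  by apply: converges_near near1 _ h1; rewrite e0.
have near2 : \forall t \near F, Im (f t) = Im (g t) by apply: filterS fg => t ->.
by apply: converges_near near2 _ h2; rewrite e0.
Qed.

Lemma matrix_in_invmx n (A : T -> 'M[C]_n) : (\forall t \near F, A t \in unitmx) ->
  A t0 \in unitmx -> matrix_in (Q := Q) A -> matrix_in (Q := Q) (fun t => invmx (A t)).
Proof.
move=> nA u0 hA i j.
have d0 : \det (A t0) != 0 by rewrite -unitfE -unitmxE.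
have e t : A t \in unitmx -> (\det (A t))^-1 * \adj (A t) i j = invmx (A t) i j.
  by move=> ut; rewrite /invmx ut [RHS]mxE.
(* Cramer's formula describes [invmx] near [t0] only; on singular matrices [invmx] takes a default
   value. *)
apply: (complex_in_near _ (e t0 u0)); first by apply: filterS nA => t; exact: e.
apply: (complex_in_mul hQ).
  by apply: (complex_in_inv d0); exact: (complex_in_det hQ).
apply: (complex_in_ext (f := fun t => (-1) ^+ (j + i) *
    \det (row' j (col' i (A t))))) => [t|].
  by rewrite mxE.
apply: (complex_in_mul hQ); first exact: (complex_in_cst hQ).
apply: (complex_in_det hQ) => a b.
apply: (complex_in_ext (f := fun t => A t (lift j a) (lift i b))) => [t|].
  by rewrite !mxE.
exact: hA.
Qed.

Lemma sqrtmxP n (A : 'M[C]_n) : psdmx A ->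
  psdmx (sqrtmx A) /\ sqrtmx A *m sqrtmx A = A.
Proof.
move=> pA; have [B hB] := psd_sqrt (pA : psd A).
exact: (xgetPex 0 (ex_intro (fun B => psdmx B /\ B *m B = A) B hB)).
Qed.

Lemma norm_le_ReIm (z : C) : `|z| <= (`|Re z| + `|Im z|)%:C%C.
Proof.
rewrite normc_def lecR -[leRHS]ger0_norm ?addr_ge0 ?normr_ge0 // -sqrtr_sqr.
apply: ler_wsqrtr; rewrite sqrrD !real_normK ?num_real // lerD2r lerDl.
by rewrite mulrn_wge0 // mulr_ge0.
Qed.

Lemma sqr_Re_le (z : C) (w : R) : `|z| ^+ 2 <= w%:C%C ->
  Re z ^+ 2 <= w /\ Im z ^+ 2 <= w.
Proof.
rewrite -add_Re2_Im2 lecR => h.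
by split; apply: le_trans h; rewrite ?lerDl ?lerDr sqr_ge0.
Qed.

Lemma sqrtmx_diff n (A B : 'M[C]_n) a b : psdmx A -> psdmx B ->
  let w := n%:R * \sum_c \sum_e
    (`|Re (A c e) - Re (B c e)| + `|Im (A c e) - Im (B c e)|) in
  (Re (sqrtmx A a b) - Re (sqrtmx B a b)) ^+ 2 <= w /\
  (Im (sqrtmx A a b) - Im (sqrtmx B a b)) ^+ 2 <= w.
Proof.
move=> pA pB w; have [qA eA] := sqrtmxP pA; have [qB eB] := sqrtmxP pB.
have h := psd_sqrt_diff a b (qA : psd (sqrtmx A)) (qB : psd (sqrtmx B)).
have : `|(sqrtmx A - sqrtmx B) a b| ^+ 2 <= w%:C%C.
  apply: le_trans h _; rewrite eA eB /w rmorphM rmorph_nat ler_wpM2l ?ler0n //.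
  rewrite rmorph_sum; apply: ler_sum => c _; rewrite rmorph_sum; apply: ler_sum => e _.
  rewrite [X in `|X|]mxE [X in `|_ + X|]mxE -ReN -ImN -ReD -ImD.
  exact: norm_le_ReIm.
by move=> /sqr_Re_le; rewrite !mxE ReD ImD ReN ImN.
Qed.

(** By [sqrtmx_diff] the square of each entry's increment is at most a multiple of the increment of
    the matrix, so the square root is continuous, with exponent $1/2$. *)
Lemma matrix_in_sqrtmx n (A : T -> 'M[C]_n) : (\forall t \near F, psdmx (A t)) ->
  psdmx (A t0) -> matrix_in (Q := Q) A -> matrix_in (Q := Q) (fun t => sqrtmx (A t)).
Proof.
move=> nA p0 hA a b.
pose w t : R := n%:R * \sum_c \sum_e
    (`|Re (A t c e) - Re (A t0 c e)| + `|Im (A t c e) - Im (A t0 c e)|).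
have hw : Q w.
  apply: (falg_mul hQ); first exact: (falg_cst hQ).
  apply: falg_sum => c; apply: falg_sum => e; have [h1 h2] := hA c e.
  apply: (falg_add hQ).
    by apply: cvg_norm; apply: cvgB h1 _; exact: cvg_cst.
  by apply: cvg_norm; apply: cvgB h2 _; exact: cvg_cst.
have w0 : w t0 = 0.
  rewrite /w big1 ?mulr0 // => c _; rewrite big1 // => e _.
  by rewrite !subrr normr0 addr0.
have nw (e : R) : 0 < e -> \forall t \near F, w t < e ^+ 2.
  by move=> e0; apply: (cvgr_lt _ hw); rewrite w0 exprn_gt0.
split; apply/cvgrPdist_lt => e e0.
  apply: filterS2 (nw e e0) nA => t hwt pt.
  have [h _] := sqrtmx_diff a b pt p0.
  rewrite distrC -(@ltr_pXn2r _ 2) ?nnegrE ?normr_ge0 ?(ltW e0) //.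
  by rewrite real_normK ?num_real //; exact: le_lt_trans h hwt.
apply: filterS2 (nw e e0) nA => t hwt pt.
have [_ h] := sqrtmx_diff a b pt p0.
rewrite distrC -(@ltr_pXn2r _ 2) ?nnegrE ?normr_ge0 ?(ltW e0) //.
by rewrite real_normK ?num_real //; exact: le_lt_trans h hwt.
Qed.

End ConvergentMatrices.

(** * Canonical moments as functions of points *)

Section CanonicalPoints.
Context {R : realType} {p : nat}.
Local Notation C := R[i].
Local Notation Re := (@complex.Re R).
Local Notation point := (@point R p).
Implicit Types (x y : point) (W : nat -> 'M[C]_p).

(** [psi x i] is $A_{i+1}$. The same formula covers [i = 0], where $L_0=R_0=I_p$ and $M_0=0$. *)
Definition psi x (i : nat) : 'M[C]_p :=
  sqrtmx (invmx (tzL (gam x) i)) *m (mat i x - tzM (gam x) i)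
  *m sqrtmx (invmx (tzR (gam x) i)).

Lemma tzR_gam_posdef m x : Opos m x -> posdef (tzR (gam x) m).
Proof. by move=> /(tzR_posdef (gam_herm x)). Qed.

Lemma sqrtmx_invP n (L : 'M[C]_n) : posdef L ->
  psd (sqrtmx (invmx L)) /\ sqrtmx (invmx L) *m sqrtmx (invmx L) = invmx L.
Proof. move=> pL; apply: sqrtmxP; exact: posdef_psd (posdef_inv pL). Qed.

(** [psd_sqrt_diff] with equal squares shows that nonnegative square roots are unique. *)
Lemma sqrtmx1 n : sqrtmx (1%:M : 'M[C]_n) = 1%:M.
Proof.
have p1 : psd (1%:M : 'M[C]_n) by exact: posdef_psd (@posdef1 _ _).
have [p2 e2] := sqrtmxP (p1 : psdmx (1%:M : 'M[C]_n)).
apply/matrixP => a b; apply/eqP; rewrite -subr_eq0 -normr_eq0 -sqrf_eq0.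
rewrite eq_le exprn_ge0 // andbT.
have := psd_sqrt_diff a b p2 p1; rewrite e2 mulmx1 subrr.
rewrite [X in `|X|]mxE [X in `|_ + X|]mxE => h; apply: le_trans h _.
by rewrite big1 ?mulr0 // => c _; rewrite big1 // => e _; rewrite mxE normr0.
Qed.

Lemma canonical_momentsE n (Z : 'rV['M[C]_p]_n) (j : 'I_n) :
  canonical_moments Z 0 j = psi (ptof Z) j.
Proof.
rewrite mxE /canonical_moment /psi; case: (nat_of_ord j) => [|i] /=.
  have [-> -> ->] := tz_initial (gam (ptof Z)).
  by rewrite invmx1 sqrtmx1 mul1mx mulmx1 subr0 mat_ptof.
rewrite mat_ptof -Gam_ptof; reflexivity.
Qed.

Lemma psi_step i x : Opos i x ->
  (Opos i.+1 x <-> posdef (1%:M - psi x i *m (psi x i)^H)) /\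
  (Opos i.+1 x -> detL i.+1 x = detL i x * ballw (psi x i)).
Proof.
move=> Ox.
have [pS eS] := sqrtmx_invP (tzL_posdef Ox).
have [pS' eS'] := sqrtmx_invP (tzR_gam_posdef Ox).
have [h1 h2] := tz_canonical_step (gam_herm x) Ox pS pS' eS eS'.
split=> [|Ox1]; first exact: h1.
have e : (detL i.+1 x)%:C%C = (detL i x)%:C%C * (ballw (psi x i))%:C%C.
  rewrite (detLE Ox1) (detLE Ox) h2 /ballw -posdef_det_real; first by [].
  exact: h1.1 Ox1.
by move: e; rewrite -rmorphM => /complexI.
Qed.

Lemma psi_ball i x : Opos i.+1 x -> posdef (1%:M - psi x i *m (psi x i)^H).
Proof. move=> Ox; exact: (psi_step (OposW Ox)).1.1 Ox. Qed.

Lemma detL_prod k x : Opos k x -> detL k x = \prod_(i < k) ballw (psi x i).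
Proof.
elim: k => [|k IH] Ox; first by rewrite detL0 big_ord0.
rewrite big_ord_recr /= -(IH (OposW Ox)).
exact: (psi_step (OposW Ox)).2 Ox.
Qed.

Lemma ballw_gt0 (A : 'M[C]_p) : posdef (1%:M - A *m A^H) -> 0 < ballw A.
Proof. exact: posdef_Re_det_gt0. Qed.

Lemma ballw_le1 (A : 'M[C]_p) : posdef (1%:M - A *m A^H) -> ballw A <= 1.
Proof.
move=> pA; have := det_sub_adj_le1 pA.
by rewrite (posdef_det_real pA) -lecR.
Qed.

Lemma detL_le1 k x : Opos k x -> detL k x <= 1.
Proof.
move=> Ox; rewrite (detL_prod Ox); apply: prodr_ile1 => i _.
have pA := psi_ball (Opos_leq (ltn_ord i) Ox).
rewrite (ballw_le1 pA) andbT; exact: ltW (ballw_gt0 pA).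
Qed.

Lemma mat_eq i x y : (forall c : coord, c.1.1.1 = i -> x c = y c) ->
  mat i x = mat i y.
Proof. by move=> h; apply/matrixP => a b; rewrite !mxE !h. Qed.

Lemma psi_ext i x y : (forall c : coord, (c.1.1.1 <= i)%N -> x c = y c) ->
  psi x i = psi y i.
Proof.
move=> h; rewrite /psi (@mat_eq i x y); last by move=> c ci; apply: h; rewrite ci.
have [_ -> -> ->] := tz_ext (gam_eq (fun c (ci : (c.1.1.1 < i)%N) => h c (ltnW ci))).
by [].
Qed.

(** Once the first [k] moments are built, the next one is $M_k+S^{-1}W_kS'^{-1}$; putting it in
    block [k] leaves the earlier canonical moments unchanged. *)
Lemma psi_surjective k W :
  (forall i, (i < k)%N -> posdef (1%:M - W i *m (W i)^H)) ->
  exists x, Opos k x /\ forall i, (i < k)%N -> psi x i = W i.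
Proof.
elim: k => [|k IH] hW.
  by exists (fun=> 0); split; [exact: Opos0|].
have [x [Ox hx]] := IH (fun i ik => hW i (ltnW ik)).
have [pS eS] := sqrtmx_invP (tzL_posdef Ox).
have [pS' eS'] := sqrtmx_invP (tzR_gam_posdef Ox).
have uS := sqrt_inv_unit (tzL_posdef Ox) eS.
have uS' := sqrt_inv_unit (tzR_gam_posdef Ox) eS'.
pose X := tzM (gam x) k + invmx (sqrtmx (invmx (tzL (gam x) k))) *m W k *m
   invmx (sqrtmx (invmx (tzR (gam x) k))).
pose y := put k X x.
have yx (c : coord) : (c.1.1.1 < k)%N -> y c = x c.
  by move=> ck; rewrite /y /put ltn_eqF.
have psiy : psi y k = W k.
  rewrite /psi mat_put; have [_ -> -> ->] := tz_ext (gam_eq yx).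
  exact: canonical_cancel uS uS'.
have Oy : Opos k y by rewrite (Opos_eq yx).
exists y; split.
  apply/(psi_step Oy).1; rewrite psiy; exact: hW.
move=> i; rewrite ltnS leq_eqVlt => /orP[/eqP ->|ik]; first exact: psiy.
rewrite -(hx i ik); apply: psi_ext => c ci; apply: yx.
exact: leq_ltn_trans ci ik.
Qed.

(** Neighbourhoods that constrain the first [k] blocks only, so that estimates transfer from [k]
    moments to [n]. *)
Definition near_coords k x0 : set_system point :=
  [set A | exists2 e : R, 0 < e &
    forall x, (forall c : coord, (c.1.1.1 < k)%N -> `|x c - x0 c| < e) -> A x].

Global Instance near_coords_filter k x0 : Filter (near_coords k x0).
Proof.
split=> [|A B [a a0 hA] [b b0 hB]|A B AB [a a0 hA]].
- by exists 1.
- exists (Num.min a b); first by rewrite lt_min a0.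
  move=> x hx; split; [apply: hA|apply: hB] => c ck;
    by have := hx c ck; rewrite lt_min => /andP[].
- by exists a => // x hx; apply: AB; exact: hA.
Qed.

Section Continuity.
Variables (k : nat) (x0 : point).
Local Notation F := (near_coords k x0).
Local Notation Q := (@converges R _ F x0).
Let hQ : function_algebra Q := converges_falg x0.

Lemma converges_coord (c : coord) : (c.1.1.1 < k)%N -> Q (fun x => x c).
Proof.
move=> ck; apply/cvgrPdist_lt => e e0; exists e => // x /(_ c ck).
by rewrite distrC.
Qed.

Lemma converges_tz m : (m <= k.+1)%N -> matrix_in (Q := Q) (fun x => tz (gam x) m).
Proof.
case: m => [|m] mk.
  by move=> a; move: (ltn_ord a); rewrite {2}big_ord0.
by apply: tz_in => // c cm; apply: converges_coord; exact: leq_trans cm mk.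
Qed.

Lemma converges_detL m : (m <= k)%N -> Opos m x0 -> Q (detL m).
Proof.
move=> mk O0.
have hT i : (i <= k.+1)%N -> Q (detT i).
  by move=> ik; have [] := complex_in_det hQ (converges_tz ik).
have h1 := hT _ (mk : (m.+1 <= k.+1)%N); have h2 := hT _ (leqW mk).
apply: (falg_mul hQ h1); apply: (converges_inv h2).
rewrite gt_eqF //; exact: posdef_Re_det_gt0 (Opos_tz O0).
Qed.

Lemma near_Opos m : (m <= k)%N -> Opos m x0 -> \forall x \near F, Opos m x.
Proof.
move=> mk O0; have hT := converges_tz (mk : (m.+1 <= k.+1)%N).
have hh x : (tz (gam x) m.+1)^H = tz (gam x) m.+1 by apply: tz_herm; exact: gam_herm.
exact: near_posdef hh hT O0.
Qed.

Lemma converges_psi m : (m < k)%N -> Opos m x0 ->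
  matrix_in (Q := Q) (fun x => psi x m).
Proof.
move=> mk O0; have nO := near_Opos (ltnW mk) O0.
have hg (j : int) : (absz j <= k)%N -> matrix_in (Q := Q) (fun x => gam x j).
  by move=> jk; apply: (gam_in hQ converges_coord).
have hp : matrix_in (Q := Q) (fun x => tzrow (gam x) m).
  move=> a b; apply: (complex_in_ext (f := fun x =>
    gam x ((tagnat.sig1 b).+1%:Z) a (tagnat.sig2 b))) => [x|]; first by rewrite [RHS]mxE.
  by apply: hg; have := ltn_ord (tagnat.sig1 b); lia.
have hn : matrix_in (Q := Q) (fun x => tzrown (gam x) m).
  move=> a b; apply: (complex_in_ext (f := fun x =>
    gam x ((tagnat.sig1 b)%:Z - m%:Z) a (tagnat.sig2 b))) => [x|]; first by rewrite [RHS]mxE.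
  by apply: hg; have := ltn_ord (tagnat.sig1 b); lia.
have hT : matrix_in (Q := Q) (fun x => invmx (tz (gam x) m)).
  apply: matrix_in_invmx; last exact: converges_tz (leqW (ltnW mk)).
    by apply: filterS nO => x Ox; exact: posdef_unit (Opos_tz Ox).
  exact: posdef_unit (Opos_tz O0).
have sub n q (A B : point -> 'M[C]_(n, q)) : matrix_in (Q := Q) A ->
    matrix_in (Q := Q) B -> matrix_in (Q := Q) (fun x => A x - B x).
  by move=> hA hB; apply: (matrix_in_add hQ hA); exact: (matrix_in_opp hQ hB).
have hS (L : point -> 'M[C]_p) : (forall x, Opos m x -> posdef (L x)) ->
    matrix_in (Q := Q) L -> matrix_in (Q := Q) (fun x => sqrtmx (invmx (L x))).
  move=> pL hL; apply: matrix_in_sqrtmx.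
  - apply: filterS nO => x Ox; exact: posdef_psd (posdef_inv (pL x Ox)).
  - exact: posdef_psd (posdef_inv (pL x0 O0)).
  apply: matrix_in_invmx hL; last exact: posdef_unit (pL x0 O0).
  by apply: filterS nO => x Ox; exact: posdef_unit (pL x Ox).
apply: (matrix_in_mul hQ); last first.
  apply: hS; first exact: tzR_gam_posdef.
  apply: sub; first exact: (matrix_in_cst hQ).
  by apply: (matrix_in_mul hQ (matrix_in_mul hQ hn hT)); exact: (matrix_in_trC hQ hn).
apply: (matrix_in_mul hQ).
  apply: hS; first exact: tzL_posdef.
  apply: sub; first exact: (matrix_in_cst hQ).
  by apply: (matrix_in_mul hQ (matrix_in_mul hQ hp hT)); exact: (matrix_in_trC hQ hp).
apply: sub; last first.
  by apply: (matrix_in_mul hQ (matrix_in_mul hQ hp hT)); exact: (matrix_in_trC hQ hn).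
exact: (hg m.+1%:Z).
Qed.

End Continuity.

End CanonicalPoints.

(** * The rate function *)

Section NearInequalities.
Context {R : realType} {T : Type} {F : set_system T} {FF : Filter F} {t0 : T}.
Implicit Types (f : T -> R) (c : R).

Lemma converges_lt f c : converges F t0 f -> f t0 < c -> \forall t \near F, f t < c.
Proof. by move=> hf; exact: (cvgr_lt _ hf). Qed.

Lemma converges_gt f c : converges F t0 f -> c < f t0 -> \forall t \near F, c < f t.
Proof. by move=> hf; exact: (cvgr_gt _ hf). Qed.

Lemma filter_seq (I : eqType) (r : seq I) (S : I -> set T) :
  (forall i, i \in r -> F (S i)) -> F [set t | forall i, i \in r -> S i t].
Proof.
elim: r => [|i r IH] h; first by apply: filterS filterT.
have h2 := IH (fun j jr => h j (mem_behead (s := i :: r) jr)).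
apply: filterS2 (h i (mem_head _ _)) h2 => t ht ht' j; rewrite inE => /orP[/eqP ->|].
  exact: ht.
exact: ht'.
Qed.

End NearInequalities.

Section RateFunction.
Context {R : realType} {p k : nat}.
Local Notation C := R[i].
Local Notation Re := (@complex.Re R).
Local Notation Im := (@complex.Im R).
Local Notation point := (@point R p).
Local Notation row k := 'rV['M[C]_p]_k.
Implicit Types (Z : row k) (x : point).

Lemma near_coords_nbhs Z (A : set (row k)) :
  near_coords k (ptof Z) [set x | A (rowof k x)] -> nbhs Z A.
Proof.
move=> [e e0 he]; apply/nbhs_rowP; exists e => // W hW.
by have := he (ptof W) (fun c _ => hW c); rewrite /= rowofK.
Qed.

Definition inball Z := forall i, posdef (1%:M - Z 0 i *m (Z 0 i)^H).
Definition ballprod Z : R := \prod_(i < k) ballw (Z 0 i).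

Lemma ballprod_gt0 Z : inball Z -> 0 < ballprod Z.
Proof. by move=> hZ; apply: prodr_gt0 => i _; exact: ballw_gt0 (hZ i). Qed.

Lemma ballprod_le1 Z : inball Z -> ballprod Z <= 1.
Proof.
move=> hZ; apply: prodr_ile1 => i _; rewrite (ballw_le1 (hZ i)) andbT.
exact: ltW (ballw_gt0 (hZ i)).
Qed.

Lemma ln_prod (I : Type) (r : seq I) (f : I -> R) : (forall i, 0 < f i) ->
  ln (\prod_(i <- r) f i) = \sum_(i <- r) ln (f i).
Proof.
move=> f0; elim: r => [|i r IH]; first by rewrite !big_nil ln1.
by rewrite !big_cons lnM ?IH // posrE // prodr_gt0.
Qed.

Lemma rateA_inball Z : inball Z -> rateA Z = (- (2 * p%:R) * ln (ballprod Z))%:E.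
Proof.
move=> hZ; rewrite /rateA; case: asboolP => [_|]; last first.
  by case=> i; apply/interior_Dball; exact: hZ.
rewrite /ballprod ln_prod; last by move=> i; exact: ballw_gt0 (hZ i).
have e (i : 'I_k) : true ->
    ln (Re (\det (1%:M - (Z 0 i)^H *m Z 0 i))) = ln (ballw (Z 0 i)).
  move=> _; have := congr1 (fun z => ln (Re z)) (det_sub_adjC (Z 0 i)); exact.
apply: (congr1 (fun z : R => (- (2 * p%:R) * z)%:E)).
apply: (eq_bigr _ e).
Qed.

Lemma rateA_outball Z : ~ inball Z -> rateA Z = +oo%E.
Proof.
move=> hZ; rewrite /rateA; case: asboolP => // h.
by case: hZ => i; apply/interior_Dball; exact: h.
Qed.

Lemma rateA_ge0 Z : (0 <= rateA Z)%E.
Proof.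
case: (pselect (inball Z)) => [hZ|/rateA_outball ->]; last exact: leey.
rewrite rateA_inball // lee_fin mulNr oppr_ge0; apply: mulr_ge0_le0.
  by rewrite mulr_ge0.
exact: ln_le0 (ballprod_le1 hZ).
Qed.

(** A positive lower bound on the product keeps every determinant away from 0, so the open ball may
    be replaced by the closed one; this is why level sets are closed. *)
Lemma inball_ballprodP Z (c : R) : 0 < c ->
  (inball Z /\ c <= ballprod Z) <->
  ((forall i, psd (1%:M - Z 0 i *m (Z 0 i)^H)) /\ c <= ballprod Z).
Proof.
move=> c0; split=> [[hZ cZ]|[hZ cZ]]; split=> // i; first exact: posdef_psd (hZ i).
apply: psd_unit_posdef (hZ i) _; rewrite unitmxE unitfE; apply/eqP => d0.
have b0 : ballw (Z 0 i) = 0 by have := congr1 Re d0.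
have /eqP : ballprod Z = 0 by rewrite /ballprod (bigD1 i) //= b0 mul0r.
by rewrite gt_eqF // (lt_le_trans c0).
Qed.

Lemma converges_mat x0 i : (i < k)%N ->
  matrix_in (Q := @converges R _ (near_coords k x0) x0) (mat i).
Proof. by move=> ik; apply: mat_in => c ci; apply: converges_coord; rewrite ci. Qed.

Lemma converges_sub_adj (Q : (point -> R) -> Prop) (A : point -> 'M[C]_p) :
  function_algebra Q ->
  matrix_in (Q := Q) A -> matrix_in (Q := Q) (fun x => 1%:M - A x *m (A x)^H).
Proof.
move=> hQ hA; apply: (matrix_in_add hQ); first exact: (matrix_in_cst hQ).
apply: (matrix_in_opp hQ); apply: (matrix_in_mul hQ hA).
exact: (matrix_in_trC hQ).
Qed.

(** A point fails either with all blocks in the closed ball and a product below [c], or because a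
    test vector [v] makes some quadratic form negative; both strict inequalities persist nearby. *)
Lemma closed_ballprod (c : R) : 0 < c ->
  closed [set Z : row k | inball Z /\ c <= ballprod Z].
Proof.
move=> c0; rewrite -[X in closed X]setCK; apply: open_closedC.
rewrite openE => Z /= hZ; apply: near_coords_nbhs.
set x0 := ptof Z.
have hQ : function_algebra (@converges R _ (near_coords k x0) x0) by exact: converges_falg.
have hA i : (i < k)%N -> _ := fun ik => converges_sub_adj hQ (converges_mat x0 ik).
have matE (i : 'I_k) x : rowof k x 0 i = mat i x by rewrite mxE.
case: (pselect (forall i, psd (1%:M - Z 0 i *m (Z 0 i)^H))) => hp.
  have lt_c : ballprod Z < c.
    rewrite ltNge; apply/negP => cZ; apply: hZ; apply/inball_ballprodP => //.
  have hD : @converges R _ (near_coords k x0) x0 (fun x => \prod_(i < k) ballw (mat i x)).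
    have fprod (r : seq 'I_k) : @converges R _ (near_coords k x0) x0
        (fun x => \prod_(i <- r) ballw (mat i x)).
      elim: r => [|i r IH].
        by under eq_fun do rewrite big_nil; exact: (falg_cst hQ).
      under eq_fun do rewrite big_cons; apply: (falg_mul hQ) IH.
      exact: (complex_in_det hQ (hA i (ltn_ord i))).1.
    exact: fprod.
  have e0 : \prod_(i < k) ballw (mat i x0) = ballprod Z.
    by apply: eq_bigr => i _; rewrite -matE rowofK.
  have hlt : \prod_(i < k) ballw (mat i x0) < c by rewrite e0.
  apply: filterS (converges_lt hD hlt) => x hx /= -[_].
  have -> : ballprod (rowof k x) = \prod_(i < k) ballw (mat i x).
    by apply: eq_bigr => i _; rewrite matE.
  by rewrite leNgt hx.
have [i hi] : exists i, ~ psd (1%:M - Z 0 i *m (Z 0 i)^H).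
  by apply: contrapT => h; apply: hp => i; apply: contrapT => hi; apply: h; exists i.
have hH x : (1%:M - mat i x *m (mat i x)^H)^H = 1%:M - mat i x *m (mat i x)^H.
  exact: sub_adj_herm.
have eZ : Z 0 i = mat i x0 by rewrite -matE rowofK.
have [v hv] : exists v : 'cV[C]_p,
    ~ 0 <= (v^H *m (1%:M - mat i x0 *m (mat i x0)^H) *m v) 0 0.
  apply: contrapT => h; apply: hi; rewrite eZ; split; first exact: hH.
  by move=> v; apply: contrapT => hv; apply: h; exists v.
pose q x := (v^H *m (1%:M - mat i x *m (mat i x)^H) *m v) 0 0.
have Imq x : Im (q x) = 0.
  have eM : (v^H *m (1%:M - mat i x *m (mat i x)^H) *m v)^H =
      v^H *m (1%:M - mat i x *m (mat i x)^H) *m v.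
    by rewrite !trmxC_mul hH trmxCK mulmxA.
  have entry (N : 'M[C]_1) : N^H 0 0 = Num.conj (N 0 0) by rewrite !mxE.
  have : Num.conj (q x) = q x by rewrite -[LHS]entry eM.
  by move=> /(congr1 Im); rewrite ImJ => h; lra.
have q0 : Re (q x0) < 0.
  rewrite ltNge; apply/negP => h; apply: hv.
  have -> : (v^H *m (1%:M - mat i x0 *m (mat i x0)^H) *m v) 0 0 = (Re (q x0))%:C%C.
    by apply: complexP; [|exact: Imq].
  by rewrite -[0]/(0%:C%C) lecR.
have hq : @converges R _ (near_coords k x0) x0 (fun x => Re (q x)).
  apply: (proj1 (_ : complex_in (Q := @converges R _ (near_coords k x0) x0) q)).
  apply: (matrix_in_mul hQ _ (matrix_in_cst hQ v)).
  exact: (matrix_in_mul hQ (matrix_in_cst hQ v^H) (hA i (ltn_ord i))).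
apply: filterS (converges_lt hq q0) => x hx [hin _].
have := (posdef_psd (hin i)).2 v; rewrite matE -/(q x) lecE /= => /andP[_].
by rewrite leNgt hx.
Qed.

Lemma rateA_le Z (c : R) : (0 < p)%N ->
  (rateA Z <= c%:E)%E <-> (inball Z /\ expR (- c / (2 * p%:R)) <= ballprod Z).
Proof.
move=> hp; have p0 : 0 < 2 * p%:R :> R by rewrite mulr_gt0 // ltr0n.
split=> [|[hZ]].
  case: (pselect (inball Z)) => [hZ|/rateA_outball ->]; last by rewrite leye_eq.
  rewrite rateA_inball // lee_fin => h; split=> //.
  rewrite -[leRHS](lnK (ballprod_gt0 hZ)) ler_expR ler_pdivrMr //.
  by rewrite mulNr in h; lra.
rewrite -[X in _ <= X -> _](lnK (ballprod_gt0 hZ)) ler_expR ler_pdivrMr // => h.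
by rewrite rateA_inball // lee_fin mulNr; lra.
Qed.

Lemma closed_rateA (c : R) : (0 < p)%N -> closed [set Z : row k | (rateA Z <= c%:E)%E].
Proof.
move=> hp.
rewrite (_ : mkset _ = [set Z | inball Z /\ expR (- c / (2 * p%:R)) <= ballprod Z]).
  exact/closed_ballprod/expR_gt0.
by apply/seteqP; split=> Z /(rateA_le _ _ hp).
Qed.

Lemma rateA_lsc : (0 < p)%N -> lower_semicontinuous (@rateA R p k).
Proof.
move=> hp; apply/lower_semicontinuousP => c.
rewrite (_ : mkset _ = ~` [set Z | (rateA Z <= c%:E)%E]).
  exact/closed_openC/closed_rateA.
by apply/seteqP; split=> Z /=; [rewrite ltNge => /negP|move=> /negP; rewrite -ltNge].
Qed.

Lemma inball_entry Z (c : @coord p) : inball Z -> `|ptof Z c| <= 1.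
Proof.
move=> hZ; case: c => [[[m a] b] e]; case: (ltnP m k) => mk; last first.
  by rewrite ptof_out // normr0.
rewrite -[m]/(nat_of_ord (Ordinal mk)) ptof_in; set A := Z 0 _.
have : `|A a b| ^+ 2 <= 1%:C%C.
  have pA : psd (1%:M - A *m A^H) by exact: posdef_psd (hZ _).
  exact: psd_ball_entry pA.
move=> /sqr_Re_le[h1 h2].
by case: e; rewrite -(@ler_pXn2r _ 2) ?nnegrE // expr1n real_normK ?num_real.
Qed.

Lemma rateA_good : (0 < p)%N -> good_rate (U := row k) (R := R) rateA.
Proof.
move=> hp c.
apply: (@subclosed_compact _ _ [set Z : row k | forall c, `|ptof Z c| <= 1]).
- exact: closed_rateA.
- exact: compact_row_box.
- by move=> Z /(rateA_le _ _ hp)[hZ _] c'; exact: inball_entry.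
Qed.

End RateFunction.

(** * Large deviation bounds *)

Section FirstMoments.
Context {R : realType} {p k n : nat}.
Hypothesis kn : (k <= n)%N.
Local Notation C := R[i].
Local Notation point := (@point R p).
Local Notation row n := 'rV['M[C]_p]_n.
Implicit Types (S : set point) (x y : point).

Definition depends_below m S :=
  forall x y, (forall c : coord, (c.1.1.1 < m)%N -> x c = y c) -> S x -> S y.

Definition posrow_in S : set (row n) := [set Z | Opos n (ptof Z) /\ S (ptof Z)].

Lemma depends_belowP S x y : depends_below k S ->
  (forall c : coord, (c.1.1.1 < k)%N -> x c = y c) -> S x <-> S y.
Proof.
by move=> hS xy; split; apply: hS => // c ck; rewrite xy.
Qed.

Lemma posrow_in_rowof S y : depends_below k S ->
  posrow_in S (rowof n y) <-> (Opos n y /\ S y).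
Proof.
move=> hS; have h (c : coord) : (c.1.1.1 < n)%N -> ptof (rowof n y) c = y c.
  exact: ptof_rowof.
rewrite /posrow_in /= (Opos_eq h).
have h' (c : coord) : (c.1.1.1 < k)%N -> ptof (rowof n y) c = y c.
  by move=> ck; apply: h; exact: leq_trans ck kn.
by have hh := depends_belowP hS h'; split=> -[a b]; split=> //; apply/hh.
Qed.

Lemma nice_restrict S s : measurable S ->
  nice (fun x => (\1_S x)%:E * dens k s x)%E.
Proof.
move=> mS; have [m1 h1] := nice_indic mS; have [m2 h2] := @nice_dens R p k s.
split; first exact: emeasurable_funM.
by move=> x; exact: mule_ge0.
Qed.

(** [c] comes from integrating out the last [n - k] moments and does not depend on [S], so it
    disappears from probabilities. *)
Lemma volume_posrow_in : exists2 c : \bar R, (0 <= c)%E &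
  forall S, measurable S -> depends_below k S ->
    lebesgue_mx (posrow_in S) = (c * Js (fib 0 k)
      (fun x => (\1_S x)%:E * dens k ((n - k) * (p * 2))%N x) origin)%E.
Proof.
have [c c0 hc] := @dens_fib R p k (n - k) 0; exists c => // S mS hS.
have [mi i0] := nice_indic mS; have [md d0] := @nice_dens R p n 0.
have nF : nice (fun y => (\1_S y)%:E * dens n 0 y)%E.
  by split; [exact: emeasurable_funM|move=> y; exact: mule_ge0].
rewrite (@lebesgue_mx_fib R p n _ _ origin nF); last first.
  move=> y; have e := posrow_in_rowof y hS.
  rewrite /dens expr0 !indicE; case: asboolP => Oy.
    rewrite mule1; congr (_%:R)%:E; congr (nat_of_bool _).
    apply/idP/idP => [/set_mem/e[_ Sy]|/set_mem Sy]; first exact: mem_set.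
    by apply: mem_set; apply/e.
  by rewrite mule0 memNset // => /e[].
rewrite -{1}(subnKC kn) fib_cat Js_cat.
rewrite -(Js_scale _ _ (nice_restrict _ mS) c0); apply: Js_ext => x _.
transitivity (Js (fib k (n - k)) (fun y => (\1_S x)%:E * dens n 0 y)%E x).
  apply: Js_ext => y hy; congr (_ * _)%E; rewrite !indicE; congr (_%:R)%:E.
  congr (nat_of_bool _).
  have h : S y <-> S x.
    apply: depends_belowP hS _ => c' ck; apply: hy.
    by rewrite mem_fib negb_and -ltnNge ck.
  by apply/idP/idP => /set_mem/h; exact: mem_set.
rewrite Js_scale; [|by split|exact: i0].
have := hc x; rewrite (subnKC kn) add0n => ->.
by rewrite muleCA.
Qed.

Variable Q : set (row n) -> \bar R.
Hypothesis hQ : uniform_on (moment_space p n) Q.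
Hypothesis Q1 : Q setT = 1%E.

Lemma open_posrow_in S : depends_below k S -> (forall x, Opos k x -> S x -> near_coords k x S) ->
  open (posrow_in S).
Proof.
move=> dS hS; rewrite openE => Z [OZ SZ]; apply: near_coords_nbhs.
have h1 := @near_Opos R p n (ptof Z) n (leqnn n) OZ.
have h2 : near_coords n (ptof Z) S.
  have [e e0 he] := hS _ (Opos_leq kn OZ) SZ; exists e => // x hx.
  by apply: he => c ck; apply: hx; exact: leq_trans ck kn.
by apply: filterS2 h1 h2 => x Ox Sx; apply/(posrow_in_rowof _ dS).
Qed.

(** The case [S = setT] expresses the total volume with the same [c]. As that volume is finite and
    positive, so are both factors, and [c] cancels. *)
Lemma law_posrow_in S : measurable S -> depends_below k S ->
  (forall x, Opos k x -> S x -> near_coords k x S) ->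
  exists D : R, [/\ 0 < D,
    Js (@fib p 0 k) (dens k ((n - k) * (p * 2))%N) origin = D%:E &
    Q (posrow_in S) = (Js (@fib p 0 k)
      (fun x => (\1_S x)%:E * dens k ((n - k) * (p * 2))%N x) origin * D^-1%:E)%E].
Proof.
move=> mS hS oS; have [c c0 hc] := volume_posrow_in.
have [V V0 hV] := posrow_volume hQ Q1.
set s := ((n - k) * (p * 2))%N.
have hT := hc setT measurableT (fun _ _ _ _ => I).
have eT : posrow_in setT = posrow p n by apply/seteqP; split=> Z /=; [case|].
have eJ : (fun x : point => (\1_setT x)%:E * dens k s x)%E = dens k s.
  by apply/funext => y; rewrite indicT mul1e.
move: hT; rewrite eT hV eJ -/s; set J := Js _ _ _ => hT.
have J0 : (0 <= J)%E by apply: Js_ge0 => y; exact: (nice_dens k s).2.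
have : exists c' D : R, [/\ 0 < c', 0 < D, c = c'%:E & J = D%:E].
  have Vn0 : V%:E != 0%E :> \bar R by rewrite eqe gt_eqF.
  have cp : (0 < c)%E.
    by rewrite lt_neqAle c0 andbT eq_sym; apply: contra_neq Vn0 => z; rewrite hT z mul0e.
  have Jp : (0 < J)%E.
    by rewrite lt_neqAle J0 andbT eq_sym; apply: contra_neq Vn0 => z; rewrite hT z mule0.
  move: hT cp Jp; case: (c) => [c'| |] //; case: J {J0} => [D| |] //.
  - by rewrite !lte_fin => _ c'0 D0; exists c', D.
  - by move=> + c'0; rewrite gt0_muley.
  - by move=> + _ D0; rewrite gt0_mulye.
move=> [c' [D [c'0 D0 ec eD]]]; exists D; split=> //.
rewrite (law_posrow hQ (open_posrow_in hS oS) _ hV V0); last by move=> Z [].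
rewrite (hc S mS hS) ec -/s.
move: hT; rewrite ec eD -EFinM => -[->].
rewrite invfM EFinM muleACA -EFinM divff ?mul1e //.
by rewrite gt_eqF.
Qed.

End FirstMoments.

Section VolumeBounds.
Context {R : realType} {p k : nat}.
Local Notation C := R[i].
Local Notation point := (@point R p).
Local Notation row n := 'rV['M[C]_p]_n.
Implicit Types (S : set point) (x y : point).
Local Notation s n := ((n - k) * (p * 2))%N.

Lemma dens_ge0 m j x : (0 <= dens m j x)%E.
Proof. exact: (nice_dens m j).2. Qed.

Lemma indic_dens_ge0 S j x : (0 <= (\1_S x)%:E * dens k j x)%E.
Proof. by apply: mule_ge0; [rewrite lee_fin indicE|exact: dens_ge0]. Qed.

(** [w] is the volume of a cube around [x0] inside [S] on which $\det L_k>b$. It is chosen before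
    the exponent [j], hence is negligible on the exponential scale. *)
Lemma Js_dens_ge S x0 (b : R) : Opos k x0 -> near_coords k x0 S ->
  0 <= b < detL k x0 -> exists2 w : R, 0 < w & forall j,
    ((b ^+ j * w)%:E <=
      Js (@fib p 0 k) (fun x => (\1_S x)%:E * dens k j x) origin)%E.
Proof.
move=> O0 nS /andP[b0 hb].
have nO := near_Opos (leqnn k) O0.
have nD : near_coords k x0 [set x | b < detL k x].
  exact: converges_gt (converges_detL (leqnn k) O0) hb.
have [e e0 he] := filterI nS (filterI nO nD).
exists ((e *+ 2) ^+ size (@fib p 0 k)) => [|j].
  by rewrite exprn_gt0 // pmulrn_lgt0.
apply: (Js_box (z := x0)) => //; [exact: exprn_ge0|exact: indic_dens_ge0|].
move=> y hy _; have [Sy [Oy Dy]] : (S `&` ([set x | Opos k x] `&` [set x | b < detL k x])) y.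
  by apply: he => c ck; apply: hy; rewrite mem_fib.
rewrite indicE mem_set // mul1e /dens; case: asboolP => // _.
rewrite lee_fin.
by apply: lerXn2r; [exact: b0|exact: ltW (le_lt_trans b0 Dy)|exact: ltW Dy].
Qed.

Lemma Js_dens_le S (b : R) j : 0 <= b -> (forall x, S x -> Opos k x -> detL k x <= b) ->
  (Js (@fib p 0 k) (fun x => (\1_S x)%:E * dens k j x) origin
    <= (b ^+ j)%:E * lebesgue_mx (@posrow R p k))%E.
Proof.
move=> b0 hS; rewrite (lebesgue_posrow k origin).
have bj : (0 <= (b ^+ j)%:E)%E by rewrite lee_fin exprn_ge0.
rewrite -(Js_scale _ _ (nice_dens k 0) bj); apply: Js_le => [x|x _].
  exact: indic_dens_ge0.
rewrite indicE; case: (boolP (x \in S)) => [/set_mem Sx|_]; last first.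
  by rewrite mul0e; apply: mule_ge0 => //; exact: dens_ge0.
rewrite mul1e /dens expr0; case: asboolP => Ox; last by rewrite mule0.
rewrite mule1 lee_fin; apply: lerXn2r; rewrite ?nnegrE //; last exact: hS.
exact: ltW (detL_gt0 Ox).
Qed.

Variable V : R.
Hypothesis V0 : 0 < V.
Hypothesis hV : lebesgue_mx (@posrow R p k) = V%:E.

Lemma dens_volume_le j (D : R) :
  Js (@fib p 0 k) (dens k j) origin = D%:E -> D <= V.
Proof.
move=> hD; have := @Js_dens_le setT 1 j ler01 (fun x _ Ox => detL_le1 Ox).
have -> : (fun x : point => (\1_setT x)%:E * dens k j x)%E = dens k j.
  by apply/funext => y; rewrite indicT mul1e.
by rewrite hD hV expr1n mul1e lee_fin.
Qed.

Definition small (b : R) : set point := [set x | detL k x < b].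

(** The numerator is at most $a^sV$. The normalization is at least $b^sw$, from a cube around the
    origin, where $\det L_k=1>b$; taking [b] near 1 makes the loss as small as desired. *)
Lemma law_small_le (b : R) : 0 < b < 1 -> exists2 K : R, 0 < K &
  forall n (Q : set (row n) -> \bar R) (a : R), (k <= n)%N ->
    uniform_on (moment_space p n) Q -> Q setT = 1%E -> 0 < a ->
    (Q (posrow_in (small a)) <= (K * (a / b) ^+ s n)%:E)%E.
Proof.
move=> /andP[b0 b1].
have [w w0 hw] : exists2 w : R, 0 < w & forall j,
    ((b ^+ j * w)%:E <= Js (@fib p 0 k) (fun x => (\1_setT x)%:E * dens k j x) origin)%E.
  apply: (@Js_dens_ge setT origin b (Opos_origin k)); first exact: filterT.
  by rewrite detL_origin ltW.
exists (V / w); first exact: divr_gt0.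
move=> n Q a kn hQ Q1 a0.
have mS : measurable (small a).
  rewrite (_ : small a = detL k @^-1` `]-oo, a[%classic).
    by rewrite -[X in measurable X]setTI; exact: measurable_detL.
  by apply/seteqP; split=> x; rewrite /= in_itv.
have dS : depends_below k (small a).
  by move=> x y xy; rewrite /small /= (detL_eq xy).
have oS x : Opos k x -> small a x -> near_coords k x (small a).
  move=> Ox Sx.
  exact: converges_lt (converges_detL (leqnn k) Ox) Sx.
have [D [D0 hD ->]] := law_posrow_in kn hQ Q1 mS dS oS.
have hup := @Js_dens_le (small a) a (s n) (ltW a0) (fun x Sx _ => ltW Sx).
have Dge : b ^+ s n * w <= D.
  have := hw (s n); rewrite (_ : (fun x : point => _) = dens k (s n)).
    by rewrite hD lee_fin.
  by apply/funext => y; rewrite indicT mul1e.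
have D1 : (0 <= D^-1%:E)%E by rewrite lee_fin invr_ge0 ltW.
apply: le_trans (lee_wpmul2r D1 hup) _.
rewrite hV -!EFinM lee_fin ler_pdivrMr //.
have bw : 0 < b ^+ s n * w by rewrite mulr_gt0 // exprn_gt0.
have e : V / w * (a / b) ^+ s n * (b ^+ s n * w) = a ^+ s n * V.
  rewrite expr_div_n; field.
  by rewrite (gt_eqF w0) gt_eqF ?exprn_gt0.
rewrite -e; apply: ler_wpM2l Dge.
by rewrite mulr_ge0 ?exprn_ge0 ?divr_ge0 // ltW.
Qed.

Definition box x0 (e : R) : set point :=
  [set x | forall c : @coord p, (c.1.1.1 < k)%N -> `|x c - x0 c| < e].

Lemma measurable_box x0 e : measurable (box x0 e).
Proof.
have h (l : seq (@coord p)) :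
    measurable ([set x | forall c, c \in l -> `|x c - x0 c| < e] : set point).
  elim: l => [|c l IH].
    rewrite (_ : mkset _ = setT); first exact: measurableT.
    by apply/seteqP; split.
  rewrite (_ : mkset _ = [set x | `|x c - x0 c| < e] `&`
      [set x | forall c, c \in l -> `|x c - x0 c| < e]).
    apply: measurableI IH.
    have mf : measurable_fun setT (fun x : point => `|x c - x0 c|).
      apply: measurableT_comp; first exact: normr_measurable.
      by apply: measurable_funB; [exact: measurable_coord|exact: measurable_cst].
    rewrite (_ : mkset _ = (fun x : point => `|x c - x0 c|) @^-1` `]-oo, e[%classic).
      by rewrite -[X in measurable X]setTI; exact: mf.
    by apply/seteqP; split=> x; rewrite /= in_itv.
  apply/seteqP; split=> x /= hx.
    by split=> [|c' c'l]; apply: hx; rewrite inE ?eqxx // c'l orbT.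
  by move=> c'; rewrite inE => /orP[/eqP ->|]; [exact: hx.1|exact: hx.2].
rewrite (_ : box x0 e = [set x | forall c, c \in @fib p 0 k -> `|x c - x0 c| < e]).
  exact: h.
by apply/seteqP; split=> x hx c ck; apply: hx; move: ck; rewrite mem_fib.
Qed.

Lemma near_box x0 e x : box x0 e x -> near_coords k x (box x0 e).
Proof.
move=> hx.
have h : near_coords k x [set y | forall c, c \in @fib p 0 k -> `|y c - x0 c| < e].
  apply: filter_seq => c; rewrite mem_fib => /andP[_ ck].
  have hf : @converges R _ (near_coords k x) x (fun y : point => `|y c - x0 c|).
    by apply: cvg_norm; apply: cvgB; [exact: converges_coord|exact: cvg_cst].
  exact: converges_lt hf (hx c ck).
by apply: filterS h => y hy c ck; apply: hy; rewrite mem_fib.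
Qed.

(** [S] is shrunk to a box, which is measurable and depends on the first [k] moments only. The
    normalization is at most [V] because $\det L_k\le1$. *)
Lemma law_box_ge S x0 (b : R) : Opos k x0 -> near_coords k x0 S ->
  0 < b < detL k x0 -> exists (K : R) (S' : set point),
  [/\ 0 < K, S' `<=` S & forall n (Q : set (row n) -> \bar R), (k <= n)%N ->
    uniform_on (moment_space p n) Q -> Q setT = 1%E ->
    open (@posrow_in R p n S') /\
    ((K * b ^+ s n)%:E <= Q (posrow_in S'))%E].
Proof.
move=> O0 [e e0 he] /andP[b0 hb].
have nb : near_coords k x0 (box x0 e) by exists e.
have bb : 0 <= b < detL k x0 by rewrite hb ltW.
have [w w0 hw] := Js_dens_ge O0 nb bb.
exists (w / V), (box x0 e); split=> [|x hx|]; [exact: divr_gt0|exact: he|].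
move=> n Q kn hQ Q1.
have dS : depends_below k (box x0 e).
  by move=> x y xy hx c ck; rewrite -xy //; exact: hx.
have oS x (_ : Opos k x) : box x0 e x -> near_coords k x (box x0 e).
  exact: near_box.
have hop := open_posrow_in kn dS oS.
split; first exact: hop.
have [D [D0 hD ->]] := law_posrow_in kn hQ Q1 (measurable_box x0 e) dS oS.
have D1 : (0 <= D^-1%:E)%E by rewrite lee_fin invr_ge0 ltW.
apply: le_trans (lee_wpmul2r D1 (hw (s n))).
rewrite -EFinM lee_fin mulrAC [w * _]mulrC; apply: ler_wpM2l.
  by rewrite mulr_ge0 ?exprn_ge0 // ltW.
by rewrite lef_pV2 ?posrE //; exact: dens_volume_le hD.
Qed.

End VolumeBounds.

Section Limits.
Context {R : realType}.
Implicit Types (u : nat -> \bar R).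

Lemma lee_reals (x y : \bar R) : (forall r : R, (y < r%:E -> x <= r%:E)%E) -> (x <= y)%E.
Proof.
case: y => [y| |] h; [|exact: leey|].
  by apply/lee_addgt0Pr => e e0; rewrite -EFinD; apply: h; rewrite lte_fin ltrDl.
case: x h => [x| |] h //.
  by have := h (x - 1) (ltNyr (x - 1)); rewrite lee_fin lerBrDr gerDl ler10.
by have := h 0 (ltNyr (0 : R)); rewrite leye_eq.
Qed.

Lemma limn_esup_le u N (x : \bar R) : (forall n, (N <= n)%N -> (u n <= x)%E) ->
  (limn_esup u <= x)%E.
Proof.
move=> h; apply: (@le_trans _ _ (ereal_sup [set u n | n in [set n | (N <= n)%N]])).
  apply: ereal_inf_lbound; exists [set n | (N <= n)%N] => //.
  by exists N.
by apply: ge_ereal_sup => _ [n /h hn <-].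
Qed.

(** The left side tends to [q a], so constants [K] and the shift by [k] vanish at speed [n]. *)
Lemma slope_bound (k q : nat) (a b c : R) : q%:R * a < c ->
  exists N, forall n, (N <= n)%N ->
    [/\ (0 < n)%N, (k <= n)%N & n%:R^-1 * (b + ((n - k) * q)%:R * a) <= c].
Proof.
move=> ac; have d0 : 0 < c - q%:R * a by rewrite subr_gt0.
(* After multiplication by $n$ the inequality reads $b-kqa\le n(c-qa)$. *)
pose t := (b - k%:R * (q%:R * a)) / (c - q%:R * a).
exists ((Num.truncn `|t|).+1 + k)%N => n hn.
have kn : (k <= n)%N by apply: leq_trans hn; exact: leq_addl.
have n0 : (0 < n)%N by apply: leq_trans hn; rewrite addSn.
split=> //; rewrite mulrC ler_pdivrMr ?ltr0n // natrM natrB //.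
have tn : t <= n%:R.
  apply: le_trans (ler_norm t) _; apply: (ltW (lt_le_trans (truncnS_gt _) _)).
  by rewrite ler_nat; apply: leq_trans hn; exact: leq_addr.
by move: tn; rewrite /t ler_pdivrMr //; lra.
Qed.

End Limits.

(** * Transfer of the uniform law to the canonical moments *)

Section CanonicalLaw.
Context {R : realType} {p k n : nat}.
Hypothesis kn : (k <= n)%N.
Local Notation C := R[i].
Local Notation row n := 'rV['M[C]_p]_n.

Definition first_canonical (Z : row n) : row k := \row_i psi (ptof Z) i.

Lemma first_coords_canonical (Z : row n) :
  first_coords k (canonical_moments Z) = first_canonical Z.
Proof.
apply/rowP => i; rewrite !mxE; have inn : (i < n)%N by exact: leq_trans (ltn_ord i) kn.
have -> : insub (i : nat) = Some (Ordinal inn) by rewrite insubT.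
by rewrite canonical_momentsE.
Qed.

Lemma first_canonical_inball (Z : row n) : posrow p n Z ->
  inball (first_canonical Z) /\ ballprod (first_canonical Z) = detL k (ptof Z).
Proof.
move=> OZ; have Ok := Opos_leq kn (OZ : Opos n (ptof Z)); split=> [i|].
  by rewrite mxE; exact: psi_ball (Opos_leq (ltn_ord i) Ok).
by rewrite (detL_prod Ok); apply: eq_bigr => i _; rewrite mxE.
Qed.

Context d (Omega : measurableType d) (P : probability Omega R).
Context (X : {RV P >-> Borel (row n)}) (A : {RV P >-> Borel (row n)}).
Hypothesis hX : uniform_on (moment_space p n) (fun B => P (X @^-1` B)).
Hypothesis hA : forall w, (moment_space p n)^° (X w) -> A w = canonical_moments (X w).
Local Notation Q := (fun B => P (X @^-1` B)).
Local Notation E B := ((first_coords k \o A) @^-1` B).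

Lemma law_setT : Q setT = 1%E.
Proof. exact: (probability_setT P). Qed.

Lemma measurable_open (B : set (row n)) : open B -> measurable (X @^-1` B).
Proof.
move=> oB; apply: measurable_funPTI; exact: sub_sigma_algebra.
Qed.

Lemma measurable_first_coords (B : set (Borel (row k))) : measurable B ->
  measurable (E B).
Proof.
move=> mB; rewrite comp_preimage; apply: measurable_funPTI.
have mf : measurable_fun setT (first_coords k : Borel (row n) -> Borel (row k)).
  have h := @measurability _ _ (Borel (row n)) (Borel (row k)) setT (first_coords k)
    (@open (row k)) erefl.
  apply: h => _ [U oU <-].
  by rewrite setTI; apply: sub_sigma_algebra; exact: first_coords_open.
by rewrite -[X in measurable X]setTI; exact: mf.
Qed.

Lemma open_posrow : open (@posrow R p n).
Proof.
have -> : @posrow R p n = posrow_in setT by apply/seteqP; split=> Z // [].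
by apply: (open_posrow_in kn) => // x _ _; exact: filterT.
Qed.

Lemma posrow_as : Q (@posrow R p n) = 1%E.
Proof.
have [V V0 hV] := posrow_volume hX law_setT.
rewrite (law_posrow hX open_posrow (@subset_refl _ _) hV V0) hV -EFinM.
by rewrite divff // gt_eqF.
Qed.

(** Positive tuples form an open subset of the moment space, hence lie in its interior, where [A] is
    prescribed. *)
Lemma A_first_coords w : posrow p n (X w) ->
  first_coords k (A w) = first_canonical (X w).
Proof.
move=> hw; rewrite hA ?first_coords_canonical //.
have := @posrow_moment R p n; rewrite (open_subsetE _ open_posrow).
exact.
Qed.

(** The event is controlled on positive tuples only; the complementary event has probability 0 by
    [posrow_as]. *)
Lemma prob_first_le (B : set (Borel (row k))) (S : set (row n)) :
  measurable B -> open S ->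
  (forall Z, posrow p n Z -> B (first_canonical Z) -> S Z) -> (P (E B) <= Q S)%E.
Proof.
move=> mB oS h; have mO := measurable_open open_posrow.
have mS := measurable_open oS.
have sub : E B `<=` (X @^-1` S) `|` ~` (X @^-1` @posrow R p n).
  move=> w /= hw; case: (pselect (posrow p n (X w))) => hO; [left|by right].
  by apply: h; rewrite // -A_first_coords.
have mC := measurableC mO.
apply: le_trans (le_measure P _ _ sub) _; rewrite ?inE.
- exact: measurable_first_coords.
- exact: measurableU.
apply: le_trans (measureU2 P mS mC) _.
have e0 : (P (~` (X @^-1` @posrow R p n)) <= 0)%E.
  by rewrite probability_setC // (posrow_as : P (X @^-1` @posrow R p n) = 1%E) subee.
by rewrite -[leRHS]adde0; apply: leeD; [exact: lexx|exact: e0].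
Qed.

Lemma prob_first_ge (B : set (Borel (row k))) (S : set (row n)) :
  measurable B -> open S -> S `<=` posrow p n ->
  (forall Z, S Z -> B (first_canonical Z)) -> (Q S <= P (E B))%E.
Proof.
move=> mB oS SO h; apply: le_measure; rewrite ?inE.
- exact: measurable_open.
- exact: measurable_first_coords.
by move=> w /= Sw; rewrite A_first_coords; [exact: h|exact: SO].
Qed.

End CanonicalLaw.

(** * The two large deviation bounds *)

Section LargeDeviationBounds.
Context {R : realType} {p k : nat} (p0 : (0 < p)%N).
Context (d : nat -> measure_display) (Omega : forall n, measurableType (d n))
  (P : forall n, probability (Omega n) R)
  (X : forall n, {RV (P n) >-> Borel 'rV['M[R[i]]_p]_n})
  (A : forall n, {RV (P n) >-> Borel 'rV['M[R[i]]_p]_n}).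
Hypothesis hX : forall n, uniform_on (moment_space p n) (fun B => P n (X n @^-1` B)).
Hypothesis hA : forall n w, (moment_space p n)^° (X n w) ->
  A n w = canonical_moments (X n w).
Local Notation row k := 'rV['M[R[i]]_p]_k.
Local Notation q := (p * 2)%N.
Variable B : set (Borel (row k)).
Hypothesis mB : measurable B.
Let u n := (n%:R^-1%:E * lne (P n ((first_coords k \o A n) @^-1` B)))%E.

Let q0 : 0 < q%:R :> R. Proof. by rewrite ltr0n muln_gt0 p0. Qed.

Lemma scaled_lne_le n (x : \bar R) (K t : R) m : (0 <= x)%E -> 0 < K -> 0 < t ->
  (x <= (K * t ^+ m)%:E)%E ->
  (n%:R^-1%:E * lne x <= (n%:R^-1 * (ln K + m%:R * ln t))%:E)%E.
Proof.
move=> x0 K0 t0 xK; have tm : 0 < t ^+ m by rewrite exprn_gt0.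
have -> : ln K + m%:R * ln t = ln (K * t ^+ m).
  by rewrite lnM ?posrE // lnXn // mulr_natl.
rewrite EFinM; apply: lee_wpmul2l; first by rewrite lee_fin invr_ge0 ler0n.
rewrite -lne_EFin ?mulr_gt0 // lee_lne ?in_itv //= ?x0 ?leey //.
by rewrite lee_fin (ltW (mulr_gt0 K0 tm)).
Qed.

Lemma scaled_lne_ge n (x : \bar R) (K t : R) m : 0 < K -> 0 < t ->
  ((K * t ^+ m)%:E <= x)%E ->
  ((n%:R^-1 * (ln K + m%:R * ln t))%:E <= n%:R^-1%:E * lne x)%E.
Proof.
move=> K0 t0 xK; have tm : 0 < t ^+ m by rewrite exprn_gt0.
have Kt : (0 <= (K * t ^+ m)%:E)%E by rewrite lee_fin ltW // mulr_gt0.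
have -> : ln K + m%:R * ln t = ln (K * t ^+ m).
  by rewrite lnM ?posrE // lnXn // mulr_natl.
rewrite EFinM; apply: lee_wpmul2l; first by rewrite lee_fin invr_ge0 ler0n.
rewrite -lne_EFin ?mulr_gt0 // lee_lne ?in_itv //= ?Kt ?leey //.
by rewrite (le_trans Kt xK).
Qed.

(** If the rate exceeds $-r$ on the closure, the event forces $\det L_k<e^{r/(2p)}$, whose
    probability is bounded by [law_small_le]. *)
Lemma ldp_upper : (limn_esup u <= - ereal_inf (rateA @` closure (B : set (row k))))%E.
Proof.
apply: lee_reals => r rI; apply: lee_reals => r'; rewrite lte_fin => rr.
have qE : 2 * p%:R = q%:R :> R by rewrite natrM mulrC.
(* [a] is the value of $\det L_k$ at rate $-r$; [b] is so close to 1 that $q\log(a/b)$ is the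
   midpoint of [r] and [r']. *)
pose a := expR (r / q%:R); pose b := expR (- (r' - r) / (2 * q%:R)).
have a0 : 0 < a by exact: expR_gt0.
have b01 : 0 < b < 1.
  rewrite expR_gt0 -[ltRHS]expR0 ltr_expR mulNr oppr_lt0 divr_gt0 ?subr_gt0 //.
  by rewrite mulr_gt0.
have b0 : 0 < b by exact: expR_gt0.
(* The law of index [k] supplies the finite positive volume of the positive tuples of length [k]. *)
have [V V0 hV] := posrow_volume (hX (n := k)) (law_setT (X k)).
have [K K0 hK] := law_small_le V0 hV b01.
have lnab : ln (a / b) = (r + (r' - r) / 2) / q%:R.
  rewrite ln_div ?posrE // !expRK; move: (q%:R) q0 => t t0.
  by field; rewrite gt_eqF.
have slope : q%:R * ln (a / b) < r'.
  by rewrite lnab mulrC divfK ?gt_eqF //; lra.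
have [N hN] := slope_bound k (ln K) slope.
apply: (@limn_esup_le _ _ N) => n /hN[n0 kn hn].
have hsub (Z : row n) : posrow p n Z -> B (first_canonical Z) ->
    posrow_in (@small R p k a) Z.
  move=> OZ BZ; split; first exact: OZ.
  have [inZ eZ] := first_canonical_inball kn OZ.
  rewrite /small /= -eZ ltNge; apply/negP => aZ.
  have hr : (rateA (first_canonical Z : row k) <= (- r)%:E)%E.
    by apply/(rateA_le _ _ p0); split=> //; rewrite opprK qE.
  have : (ereal_inf (rateA @` closure (B : set (row k))) <= (- r)%:E)%E.
    apply: le_trans hr; apply: ereal_inf_lbound.
    by exists (first_canonical Z) => //; exact: subset_closure.
  by rewrite leNgt EFinN lteNl rI.
have os : open (@posrow_in R p n (@small R p k a)).
  have dS : depends_below k (@small R p k a).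
    by move=> x y xy; rewrite /small /= (detL_eq xy).
  apply: (open_posrow_in kn dS) => x Ox Sx.
  exact: converges_lt (converges_detL (leqnn k) Ox) Sx.
have h1 := prob_first_le kn (hX (n := n)) (hA (n := n)) mB os hsub.
have h2 := hK n _ a kn (hX (n := n)) (law_setT (X n)) a0.
have ab0 : 0 < a / b by exact: divr_gt0.
apply: le_trans (scaled_lne_le n (measure_ge0 _ _) K0 ab0 (le_trans h1 h2)) _.
by rewrite lee_fin.
Qed.

(** A point of finite rate is the image of some [x] under the canonical moments; by continuity a box
    around [x] is mapped into [B], and its probability is at least $Kb^{2p(n-k)}$ with [b] just
    below $\det L_k(x)$. *)
Lemma ldp_lower : (- ereal_inf (rateA @` (B : set (row k))^°) <= limn_einf u)%E.
Proof.
rewrite /limn_einf leeN2; apply: le_ereal_inf_tmp => _ [Z BZ <-].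
case: (pselect (inball Z)) => [inZ|/rateA_outball ->]; last exact: leey.
have qE : 2 * p%:R = q%:R :> R by rewrite natrM mulrC.
rewrite (rateA_inball inZ) qE; set c := ln (ballprod Z).
apply: lee_reals => r; rewrite lte_fin => cr.
pose W i : 'M[R[i]]_p := if insub i is Some j then Z 0 j else 0.
have [i ik|x [Ox psix]] := @psi_surjective R p k W.
  by rewrite /W insubT /=; exact: inZ.
have psiZ (i : 'I_k) : psi x i = Z 0 i by rewrite psix // /W valK.
have eD : detL k x = ballprod Z.
  by rewrite (detL_prod Ox); apply: eq_bigr => i _; rewrite psiZ.
(* $\log b$ is halfway between $c=\log\det L_k(x)$ and $-r/q$: below the first, so that a box
   exists, and above the second, so that $-q\log b<r$. *)
pose b := expR ((c - r / q%:R) / 2).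
have b0 : 0 < b by exact: expR_gt0.
have rc : - r / q%:R < c by rewrite ltr_pdivrMr //; lra.
have hb : 0 < b < detL k x.
  rewrite b0 eD -[ltRHS](lnK (ballprod_gt0 inZ)) ltr_expR -/c; lra.
pose Psi (y : point) : row k := \row_i psi y i.
have nS : near_coords k x [set y | Opos k y -> B (Psi y)].
  have [e e0 he] := (nbhs_rowP _ _).1 BZ.
  have h : near_coords k x [set y | forall c, c \in @fib p 0 k ->
      `|ptof (Psi y) c - ptof Z c| < e].
    apply: filter_seq => -[[[m a'] b'] e']; rewrite mem_fib => /andP[_ mk].
    have mk' : (m < k)%N := mk.
    have [hR hI] := converges_psi mk' (Opos_leq (ltnW mk') Ox) a' b'.
    have ptE (y : point) : ptof (Psi y) (m, a', b', e') =
        if e' then complex.Im (psi y m a' b') else complex.Re (psi y m a' b').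
      by rewrite -[m]/(nat_of_ord (Ordinal mk')) ptof_in mxE.
    have eZ : Psi x = Z by apply/rowP => i; rewrite mxE psiZ.
    have hf : @converges R _ (near_coords k x) x (fun y : point =>
        ptof (Psi y) (m, a', b', e')).
      rewrite (_ : (fun y : point => _) = fun y => if e' then
          complex.Im (psi y m a' b') else complex.Re (psi y m a' b')).
        by case: (e'); [exact: hI|exact: hR].
      by apply/funext => y; rewrite ptE.
    have hf' : @converges R _ (near_coords k x) x (fun y : point =>
        `|ptof (Psi y) (m, a', b', e') - ptof Z (m, a', b', e')|).
      by apply: cvg_norm; apply: cvgB; [exact: hf|exact: cvg_cst].
    apply: (converges_lt hf').
    by rewrite eZ subrr normr0.
  apply: filterS h => y hy _; apply: he => c'.
  case: (ltnP c'.1.1.1 k) => ck; first by apply: hy; rewrite mem_fib.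
  by rewrite !ptof_out // subrr normr0.
have [V V0 hV] := posrow_volume (hX (n := k)) (law_setT (X k)).
have [K [S' [K0 S'S hS']]] := law_box_ge V0 hV Ox nS hb.
have slope : q%:R * (- ln b) < r.
  have -> : q%:R * (- ln b) = (r - q%:R * c) / 2.
    rewrite expRK; move: (q%:R) q0 => t t0.
    by field; rewrite gt_eqF.
  by move: cr; rewrite mulNr; lra.
have [N hN] := slope_bound k (- ln K) slope.
apply: (@limn_esup_le _ _ N) => n /hN[n0 kn hn].
have [oS' hQ] := hS' n _ kn (hX (n := n)) (law_setT (X n)).
have S'B (Y : row n) : posrow_in S' Y -> B (first_canonical Y).
  by move=> [OY SY]; exact: S'S _ SY (Opos_leq kn OY).
have S'O : posrow_in S' `<=` posrow p n by move=> Y [].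
have h1 := prob_first_ge kn (hA (n := n)) mB oS' S'O S'B.
rewrite leeNl; apply: le_trans (scaled_lne_ge n K0 b0 (le_trans hQ h1)).
rewrite -EFinN lee_fin; apply: le_trans (_ : - _ <= _); first by rewrite lerN2; exact: hn.
by rewrite -mulrN opprD mulrN !opprK.
Qed.

End LargeDeviationBounds.

Theorem corollary3p8 (R : realType) (p k : nat) (hp : (0 < p)%N) (hk : (0 < k)%N)
    (d : nat -> measure_display) (Omega : forall n, measurableType (d n))
    (P : forall n, probability (Omega n) R)
    (X : forall n, {RV (P n) >-> Borel 'rV['M[R[i]]_p]_n})
    (A : forall n, {RV (P n) >-> Borel 'rV['M[R[i]]_p]_n})
    (hX : forall n, uniform_on (moment_space p n) (fun B => P n (X n @^-1` B)))
    (hA : forall n w, (moment_space p n)^° (X n w) ->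
            A n w = canonical_moments (X n w)) :
  satisfies_ldp
    (fun n (B : set 'rV['M[R[i]]_p]_k) => P n ((first_coords k \o A n) @^-1` B))
    rateA
  /\ good_rate (U := 'rV['M[R[i]]_p]_k) (R := R) rateA.
Proof.
split; last exact: rateA_good.
split; [exact: hausdorff_row|by move=> Z; exact: rateA_ge0|exact: rateA_lsc|].
move=> B mB u; split; [|exact: limn_einf_sup|].
  exact: (ldp_lower hp hX hA mB).
exact: (ldp_upper hp hX hA mB).
Qed.
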